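(* Suppose that $(T_t)_{t\ge0}$ is a $C_0$-semigroup of bounded operators on a Zen space $A^2_\nu$ such that, for some holomorphic function $G:\mathbb{C}_+\to\mathbb{C}$, its generator $A$ satisfies $Af=Gf'$ for all $f\in\operatorname{dom}(A)$. Then $(T_t)_{t\ge0}$ is a semigroup of composition operators.
   Context: $\mathbb{C}_+=\{z\in\mathbb{C}:\operatorname{Re}z>0\}$ is the right half-plane. Let $\nu$ be a positive regular Borel measure on $[0,\infty)$ satisfying the doubling condition $\sup_{t>0}\nu[0,2t)/\nu[0,t)<\infty$. The Zen space $A^2_\nu$ consists of all analytic $F:\mathbb{C}_+\to\mathbb{C}$ such that $$\|F\|^2=\sup_{\epsilon>0}\int_{\overline{\mathbb{C}_+}}|F(s+\epsilon)|^2\,d\nu(x)\,dy<\infty ,\qquad s=x+iy .$$ The Laplace transform is an isometric isomorphism from $L^2(0,\infty,w(t)\,dt)$ onto $A^2_\nu$, where $w(t)=2\pi\int_0^\infty e^{-2rt}\,d\nu(r)$ (the integral being over $[0,\infty)$). $(T_t)_{t\ge 0}$ is a semigroup of composition operators if there is a semigroup $(\varphi_t)_{t\ge0}$ of analytic self-maps of $\mathbb{C}_+$ (with $\varphi_0=\mathrm{id}$ and $\varphi_{t+u}=\varphi_t\circ\varphi_u$) such that $T_tf=f\circ\varphi_t$ for all $f\in A^2_\nu$ and $t\ge0$. *)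

(* Defs.v *)
From HB Require Import structures.
From mathcomp Require Import all_boot all_order all_algebra.
From mathcomp Require Import complex.
From mathcomp Require Import all_classical all_reals all_analysis.

Set Implicit Arguments.
Unset Strict Implicit.
Unset Printing Implicit Defensive.

Import Order.TTheory GRing.Theory Num.Theory.
Import numFieldNormedType.Exports.

Local Open Scope classical_set_scope.
Local Open Scope ring_scope.
Local Open Scope complex_scope.

(** * The right half-plane *)

Definition Cplus (R : realType) : Type := {z : R[i] | 0 < complex.Re z}.

(* A function on the half-plane, extended by 0; since the half-plane is open,
   limits of difference quotients at its points do not see the extension. *)
Definition extend (R : realType) (F : Cplus R -> R[i]) (z : R[i]) : R[i] :=
  if insub z is Some s then F s else 0.

(* [R[i]^o] is [R[i]] as a normed module over itself, so that [derivable] and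
   [derive1] are about the complex derivative. *)
Definition analytic (R : realType) (F : Cplus R -> R[i]) : Prop :=
  forall s : Cplus R, derivable (extend F : R[i]^o -> R[i]^o) (val s) 1.

Definition cderiv (R : realType) (F : Cplus R -> R[i]) (s : Cplus R) : R[i] :=
  derive1 (extend F : R[i] -> R[i]^o) (val s).

Definition analytic_selfmap (R : realType) (phi : Cplus R -> Cplus R) : Prop :=
  analytic (fun s => val (phi s)).

(** * Zen spaces *)

(* A Borel measure on [0, +oo[ is represented by its extension by 0 to R. *)
Definition supported_nneg (R : realType)
    (nu : {measure set (measurableTypeR R) -> \bar R}) : Prop :=
  nu `]-oo, 0[%classic = 0%E.

Definition regular_measure (R : realType)
    (nu : {measure set (measurableTypeR R) -> \bar R}) : Prop :=
  forall B : set (measurableTypeR R), measurable B ->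
    nu B = ereal_inf [set nu U | U in [set U : set R | open U /\ B `<=` U]] /\
    nu B = ereal_sup [set nu K | K in [set K : set R | compact K /\ K `<=` B]].

(* The first clause is what makes the quotients meaningful. *)
Definition doubling (R : realType)
    (nu : {measure set (measurableTypeR R) -> \bar R}) : Prop :=
  (forall t : R, 0 < t -> (0 < nu `[0%R, t[%classic < +oo)%E) /\
  (ereal_sup [set nu `[0%R, (2 * t)%R[%classic / nu `[0%R, t[%classic
             | t in [set t : R | (0 < t)%R]] < +oo)%E.

Definition zen_norm (R : realType)
    (nu : {measure set (measurableTypeR R) -> \bar R})
    (F : Cplus R -> R[i]) : \bar R :=
  sqrte (ereal_sup
    [set (\int[(nu \x lebesgue_measure)%E]_(p in [set p | (0 <= p.1)%R])
            ((ComplexField.Normc.normc (extend F ((p.1 + eps) +i* p.2)) ^+ 2)%R)%:E)%E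
    | eps in [set eps : R | 0 < eps]]).

Definition zen_space (R : realType)
    (nu : {measure set (measurableTypeR R) -> \bar R}) : set (Cplus R -> R[i]) :=
  [set F | analytic F /\ (zen_norm nu F < +oo)%E].

(** * Semigroups of operators *)

(* Operators on a subspace [X] of [V] normed by [N]; they are given by total
   functions [V -> V], whose values outside of [X] are irrelevant. *)
Definition bounded_operator (R : realType) (V : lmodType R[i]) (X : set V)
    (N : V -> \bar R) (S : V -> V) : Prop :=
  [/\ forall f, X f -> X (S f),
      forall (a : R[i]) (f g : V), X f -> X g ->
        S (a *: f + g) = a *: S f + S g &
      exists M : R, forall f, X f -> (N (S f) <= M%:E * N f)%E].

Definition C0_semigroup (R : realType) (V : lmodType R[i]) (X : set V)
    (N : V -> \bar R) (T : R -> V -> V) : Prop :=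
  [/\ forall t : R, 0 <= t -> bounded_operator X N (T t),
      forall f, X f -> T 0 f = f,
      forall (t u : R) f, 0 <= t -> 0 <= u -> X f ->
        T (t + u) f = T t (T u f) &
      forall f, X f -> N (T t f - f) @[t --> 0^'+] --> 0%E].

(* The graph of the generator [A]: [generator X N T f g] means that [f] is in
   the domain of [A] and that [A f = g]. *)
Definition generator (R : realType) (V : lmodType R[i]) (X : set V)
    (N : V -> \bar R) (T : R -> V -> V) (f g : V) : Prop :=
  [/\ X f, X g &
      N ((t^-1)%:C *: (T t f - f) - g) @[t --> 0^'+] --> 0%E].

Definition selfmap_semigroup (R : realType)
    (phi : R -> Cplus R -> Cplus R) : Prop :=
  [/\ forall t : R, 0 <= t -> analytic_selfmap (phi t),
      phi 0 = id &
      forall t u : R, 0 <= t -> 0 <= u -> phi (t + u) = phi t \o phi u].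

Definition composition_semigroup (R : realType)
    (nu : {measure set (measurableTypeR R) -> \bar R})
    (T : R -> (Cplus R -> R[i]) -> (Cplus R -> R[i])) : Prop :=
  exists phi : R -> Cplus R -> Cplus R, selfmap_semigroup phi /\
    forall (t : R) (f : Cplus R -> R[i]), 0 <= t -> zen_space nu f ->
      T t f = f \o phi t.

(* Main.v *)
Require Import Defs.
From HB Require Import structures.
From mathcomp Require Import all_boot all_order all_algebra.
From mathcomp Require Import complex ring lra.
From mathcomp Require Import all_classical all_reals all_analysis.
From mathcomp Require Import measurable_realfun.

(** The generator acts as f |-> G f', so every orbit solves the transport equation
    du/dt = G du/dz, whose solutions are functions transported along the flow of G.
    The work is to show that this flow exists on the whole half-plane, for
    all times; only then is T_t a composition operator.

    Point evaluations are bounded on the space, locally uniformly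
    (zen_point_evaluation): Cauchy's formula bounds a value by an integral over a
    square, and averaging the defining integrals over eps bounds integrals over vertical
    strips.  With Fatou's lemma this makes the space complete (zen_complete), and the
    doubling condition puts all high powers of 1/(s+1) into it (cauchy_kernel_zen).

    By the uniform boundedness principle the operators T_t are uniformly bounded for
    small t (zen_sg_locally_bounded).  For every f in the space, the integral of T_t f
    over [0, h] lies in the domain of the generator and is mapped to T_h f - f.
    Applying the hypothesis to these integrals, and Cauchy's estimate to their derivatives,
    shows that T_t f has the right derivative G (T_t f)' in t at every point, for
    every f in the space (sg_increment).

    Near z = 1 and for small t, put phi_t = (T_t e) / (T_t e') - 1, where e and e' are
    two consecutive powers of 1/(s+1).  The transport equation is preserved by products,
    quotients and compositions, so T_t f - f o phi_t solves it as well; it vanishes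
    at t = 0, and Cauchy's estimates show that such a solution is 0 (transport_unique).
    Hence T_t is composition with phi_t on a disc about 1, for t < eps, and eps does not
    depend on f (local_composition).

    The identity theorem then makes T_t multiplicative wherever products stay in
    the space, on all of C_+.  Comparing norms of high powers gives |T_t f| <= sup |f|,
    so T_t extends to uniform limits of elements of the space; the image psi of
    1/(s+1) satisfies |2 psi - 1| < 1 by the maximum principle, and phi_t = 1/psi - 1
    continues analytically to a self-map of C_+ with T_t f = f o phi_t everywhere
    (global_composition).  Larger t are reached by iteration, and the semigroup law for the
    phi_t follows from that for the T_t because the space separates points
    (composition_inj). *)

Import Order.TTheory GRing.Theory Num.Theory.
Import numFieldNormedType.Exports.
Set Implicit Arguments.
Unset Strict Implicit.
Unset Printing Implicit Defensive.
Local Open Scope classical_set_scope.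
Local Open Scope ring_scope.
Local Open Scope complex_scope.

Local Notation cmod := ComplexField.Normc.normc.

(** * Moduli, limits and derivatives of complex functions *)

Section Modulus.
Variable R : realType.
Implicit Types z w : R[i].

Lemma cmodE z : `|z| = (cmod z)%:C.
Proof. by []. Qed.

Lemma cmod_sqr z : cmod z ^+ 2 = complex.Re z ^+ 2 + complex.Im z ^+ 2.
Proof. by case: z => a b; rewrite /= sqr_sqrtr // addr_ge0 // sqr_ge0. Qed.

Lemma cmod_ge0 z : 0 <= cmod z.
Proof. by case: z => a b; rewrite /= sqrtr_ge0. Qed.

Lemma cmod0 : cmod (0 : R[i]) = 0.
Proof. exact: ComplexField.Normc.normc0. Qed.

Lemma cmod1 : cmod (1 : R[i]) = 1.
Proof. exact: ComplexField.Normc.normc1. Qed.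

Lemma cmod_eq0 z : (cmod z == 0) = (z == 0).
Proof.
apply/eqP/eqP => [|->]; last exact: cmod0.
exact: ComplexField.Normc.eq0_normc.
Qed.

Lemma cmod_gt0 z : (0 < cmod z) = (z != 0).
Proof. by rewrite lt_def cmod_ge0 andbT cmod_eq0. Qed.

Lemma cmodM z w : cmod (z * w) = cmod z * cmod w.
Proof. exact: ComplexField.Normc.normcM. Qed.

Lemma cmodV z : cmod z^-1 = (cmod z)^-1.
Proof. exact: ComplexField.Normc.normcV. Qed.

Lemma cmodX z n : cmod (z ^+ n) = cmod z ^+ n.
Proof. by elim: n => [|n IH]; rewrite ?expr0 ?cmod1 // !exprS cmodM IH. Qed.

Lemma cmodN z : cmod (- z) = cmod z.
Proof. exact: (@normcN _ (z : Rcomplex R)). Qed.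

Lemma cmodD z w : cmod (z + w) <= cmod z + cmod w.
Proof. exact: (@le_normcD _ (z : Rcomplex R) (w : Rcomplex R)). Qed.

Lemma cmodB z w : cmod (z - w) <= cmod z + cmod w.
Proof. by rewrite -(cmodN w) cmodD. Qed.

Lemma cmodBC z w : cmod (z - w) = cmod (w - z).
Proof. by rewrite -cmodN opprB. Qed.

Lemma cmod_triangle z w u : cmod (z - u) <= cmod (z - w) + cmod (w - u).
Proof. by rewrite -{1}(subrK w z) -addrA cmodD. Qed.

Lemma cmodB_ge z w : cmod z - cmod w <= cmod (z - w).
Proof. by rewrite lerBlDr -{1}(subrK w z) cmodD. Qed.

Lemma cmodR (x : R) : cmod x%:C = `|x|.
Proof. by rewrite /= expr0n /= addr0 sqrtr_sqr. Qed.

Lemma Re_le_cmod z : `|complex.Re z| <= cmod z.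
Proof.
rewrite -(@ler_pXn2r _ 2) ?nnegrE ?cmod_ge0 // cmod_sqr real_normK ?num_real //.
by rewrite lerDl sqr_ge0.
Qed.

Lemma Im_le_cmod z : `|complex.Im z| <= cmod z.
Proof.
rewrite -(@ler_pXn2r _ 2) ?nnegrE ?cmod_ge0 // cmod_sqr real_normK ?num_real //.
by rewrite lerDr sqr_ge0.
Qed.

Lemma cmod_le_ReIm z : cmod z <= `|complex.Re z| + `|complex.Im z|.
Proof.
rewrite -(@ler_pXn2r _ 2) ?nnegrE ?cmod_ge0 ?addr_ge0 // cmod_sqr sqrrD.
rewrite -!(real_normK (num_real (complex.Re z))).
rewrite -!(real_normK (num_real (complex.Im z))).
by rewrite lerD2r lerDl mulrn_wge0 // mulr_ge0.
Qed.

Lemma ReD z w : complex.Re (z + w) = complex.Re z + complex.Re w.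
Proof. by case: z w => [a b] [c d]. Qed.
Lemma ImD z w : complex.Im (z + w) = complex.Im z + complex.Im w.
Proof. by case: z w => [a b] [c d]. Qed.
Lemma ReN z : complex.Re (- z) = - complex.Re z.
Proof. by case: z. Qed.
Lemma ImN z : complex.Im (- z) = - complex.Im z.
Proof. by case: z. Qed.

Lemma complex_eq z w : complex.Re z = complex.Re w ->
  complex.Im z = complex.Im w -> z = w.
Proof. by case: z w => [a b] [c d] /= -> ->. Qed.

End Modulus.

Section Calculus.
Variable R : realType.
Local Notation C := R[i].
Implicit Types (D : set C) (f g : C -> C) (z w l : C).

(** Limits are taken along a set D, so that the same rules serve on the plane, on
    closed squares and on segments of time. *)
Definition ccont D f z := forall eta : R, 0 < eta -> exists2 kappa : R,
  0 < kappa & forall w, D w -> cmod (w - z) < kappa -> cmod (f w - f z) <= eta.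

Definition cdiff D f z l := forall eta : R, 0 < eta -> exists2 kappa : R,
  0 < kappa & forall w, D w -> cmod (w - z) < kappa ->
    cmod (f w - f z - l * (w - z)) <= eta * cmod (w - z).

Lemma ccont_cst D (c : C) z : ccont D (fun=> c) z.
Proof. by move=> e e0; exists 1 => // w _ _; rewrite subrr cmod0 ltW. Qed.

Lemma ccont_id D z : ccont D id z.
Proof. by move=> e e0; exists e => // w _ /ltW. Qed.

Lemma ccontD D f g z : ccont D f z -> ccont D g z ->
  ccont D (fun w => f w + g w) z.
Proof.
move=> cf cg e e0; have e20 : 0 < e / 2 by rewrite divr_gt0.
have [k k0 fk] := cf _ e20; have [k' k'0 gk] := cg _ e20.
exists (Num.min k k') => [|w Dw]; first by rewrite lt_min k0.
rewrite lt_min => /andP[wk wk'].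
have -> : f w + g w - (f z + g z) = (f w - f z) + (g w - g z) by ring.
apply: (le_trans (cmodD _ _)); have := fk _ Dw wk; have := gk _ Dw wk'; lra.
Qed.

Lemma ccontM D f g z : ccont D f z -> ccont D g z ->
  ccont D (fun w => f w * g w) z.
Proof.
move=> cf cg e e0.
pose A := cmod (f z) + 1; pose B := cmod (g z) + 1.
have A0 : 0 < A by rewrite ltr_wpDl ?cmod_ge0.
have B0 : 0 < B by rewrite ltr_wpDl ?cmod_ge0.
have [k k0 fk] : exists2 k, 0 < k & forall w, D w -> cmod (w - z) < k ->
    cmod (f w - f z) <= Num.min 1 (e / 2 / B).
  by apply: cf; rewrite lt_min ltr01 !divr_gt0.
have [k' k'0 gk] := cg _ (divr_gt0 (divr_gt0 e0 (ltr0Sn R 1)) A0).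
exists (Num.min k k') => [|w Dw]; first by rewrite lt_min k0.
rewrite lt_min => /andP[wk wk'].
have := fk _ Dw wk; rewrite le_min => /andP[f1 fe].
have ge := gk _ Dw wk'.
have -> : f w * g w - f z * g z = f w * (g w - g z) + (f w - f z) * g z by ring.
apply: (le_trans (cmodD _ _)); rewrite !cmodM.
have fA : cmod (f w) <= A.
  have -> : f w = f z + (f w - f z) by ring.
  by apply: (le_trans (cmodD _ _)); rewrite lerD2l.
have gB : cmod (g z) <= B by rewrite lerDl.
have -> : e = A * (e / 2 / A) + e / 2 / B * B.
  by rewrite mulrC !divfK ?gt_eqF //; field.
by apply: lerD; apply: ler_pM; rewrite ?cmod_ge0.
Qed.

Lemma ccontV D f z : f z != 0 -> ccont D f z -> ccont D (fun w => (f w)^-1) z.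
Proof.
move=> fz0 cf e e0; have m0 : 0 < cmod (f z) by rewrite cmod_gt0.
pose m := cmod (f z); rewrite -/m in m0.
have [k k0 fk] : exists2 k, 0 < k & forall w, D w -> cmod (w - z) < k ->
    cmod (f w - f z) <= Num.min (m / 2) (e * (m * m / 2)).
  by apply: cf; rewrite lt_min ?divr_gt0 // !mulr_gt0.
exists k => // w Dw wk; have := fk _ Dw wk; rewrite le_min => /andP[f1 fe].
have mf : m / 2 <= cmod (f w).
  have := cmodB_ge (f z) (f w); rewrite -cmodBC -/m in f1 *; lra.
have fw0 : f w != 0 by rewrite -cmod_gt0; apply: lt_le_trans mf; rewrite divr_gt0.
have -> : (f w)^-1 - (f z)^-1 = - (f w - f z) * ((f w)^-1 * (f z)^-1).
  by field; rewrite fw0 fz0.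
rewrite !cmodM cmodN !cmodV -/m -invfM ler_pdivrMr ?mulr_gt0 ?cmod_gt0 //.
apply: (le_trans fe); rewrite ler_pM2l //; nra.
Qed.

Lemma ccont_comp D D' f g z : ccont D f z -> ccont D' g (f z) ->
  (forall w, D w -> D' (f w)) -> ccont D (fun w => g (f w)) z.
Proof.
move=> cf cg DD' e e0; have [k k0 gk] := cg _ e0.
have k20 : 0 < k / 2 by rewrite divr_gt0.
have [k' k'0 fk] := cf _ k20; exists k' => // w Dw wk.
apply: gk; first exact: DD'.
by apply: le_lt_trans (fk _ Dw wk) _; rewrite ltr_pdivrMr // ltr_pMr // ltr1n.
Qed.

(** Carathéodory's form of differentiability reduces the rules of calculus to
    those for continuity. *)
Lemma cdiffP D f z l : cdiff D f z l <->
  exists h, [/\ forall w, f w = f z + h w * (w - z), ccont D h z & h z = l].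
Proof.
split=> [df|[h [fh ch <-]] e e0]; last first.
  have [k k0 hk] := ch _ e0; exists k => // w Dw wk.
  have -> : f w - f z - h z * (w - z) = (h w - h z) * (w - z).
    by rewrite (fh w); ring.
  by rewrite cmodM ler_wpM2r ?cmod_ge0 //; apply: hk.
exists (fun w => if w == z then l else (f w - f z) / (w - z)).
split; last by rewrite eqxx.
  move=> w; case: eqVneq => [->|wz]; first by rewrite subrr mulr0 addr0.
  by rewrite divfK ?subr_eq0 //; ring.
move=> e e0; have [k k0 fk] := df _ e0; exists k => // w Dw wk.
rewrite eqxx; case: eqVneq => [_|wz]; first by rewrite subrr cmod0 ltW.
have wz0 : w - z != 0 by rewrite subr_eq0.
have -> : (f w - f z) / (w - z) - l = (f w - f z - l * (w - z)) / (w - z).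
  by field; rewrite wz0.
by rewrite cmodM cmodV ler_pdivrMr ?cmod_gt0 //; apply: fk.
Qed.

Lemma cdiff_ccont D f z l : cdiff D f z l -> ccont D f z.
Proof.
move=> /cdiffP[h [fh ch _]] e e0.
have /(_ _ e0)[k k0 kP] : ccont D (fun w => f z + h w * (w - z)) z.
  apply: ccontD; first exact: ccont_cst.
  by apply: ccontM => //; apply: ccontD; [exact: ccont_id|exact: ccont_cst].
exists k => // w Dw wk; have := kP w Dw wk.
by rewrite -fh subrr mulr0 addr0.
Qed.

Lemma cdiff_cst D (c : C) z : cdiff D (fun=> c) z 0.
Proof.
apply/cdiffP; exists (fun=> 0); split=> //; last exact: ccont_cst.
by move=> w; rewrite mul0r addr0.
Qed.

Lemma cdiff_id D z : cdiff D id z 1.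
Proof.
apply/cdiffP; exists (fun=> 1); split=> //; last exact: ccont_cst.
by move=> w; rewrite mul1r addrC subrK.
Qed.

Lemma cdiffD D f g z l m : cdiff D f z l -> cdiff D g z m ->
  cdiff D (fun w => f w + g w) z (l + m).
Proof.
move=> /cdiffP[h [fh ch <-]] /cdiffP[k [gk ck <-]]; apply/cdiffP.
exists (fun w => h w + k w); split=> //; last exact: ccontD.
by move=> w; rewrite (fh w) (gk w); ring.
Qed.

Lemma cdiffM D f g z l m : cdiff D f z l -> cdiff D g z m ->
  cdiff D (fun w => f w * g w) z (l * g z + f z * m).
Proof.
move=> df dg; have cg := cdiff_ccont dg.
move: df dg => /cdiffP[h [fh ch <-]] /cdiffP[k [gk ck <-]]; apply/cdiffP.
exists (fun w => h w * g w + f z * k w); split=> //.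
  by move=> w; rewrite [in LHS](fh w) (gk w); ring.
by apply: ccontD; apply: ccontM => //; apply: ccont_cst.
Qed.

Lemma cdiffV D f z l : f z != 0 -> cdiff D f z l ->
  cdiff D (fun w => (f w)^-1) z (- l / f z ^+ 2).
Proof.
move=> fz0 df e e0; have cf := cdiff_ccont df.
have [k k0 fk] := cf (cmod (f z) / 2) ltac:(by rewrite divr_gt0 // cmod_gt0).
move: df => /cdiffP[h [fh ch hl]].
have : ccont D (fun w => - h w * ((f z)^-1 * (f w)^-1)) z.
  apply: ccontM; last by apply: ccontM; [exact: ccont_cst|exact: ccontV].
  have -> : (fun w => - h w) = (fun w => -1 * h w).
    by apply/funext => w; rewrite mulN1r.
  by apply: ccontM => //; apply: ccont_cst.
move=> /(_ _ e0)[k' k'0 hk]; exists (Num.min k k') => [|w Dw].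
  by rewrite lt_min k0.
rewrite lt_min => /andP[wk wk'].
have fw0 : f w != 0.
  rewrite -cmod_gt0.
  have := fk _ Dw wk; have := cmodB_ge (f z) (f w).
  have : 0 < cmod (f z) by rewrite cmod_gt0.
  rewrite [cmod (f w - _)]cmodBC; lra.
have -> : (f w)^-1 - (f z)^-1 - - l / f z ^+ 2 * (w - z) =
    (- h w * ((f z)^-1 * (f w)^-1) - (- h z * ((f z)^-1 * (f z)^-1))) * (w - z).
  have E : (f w)^-1 - (f z)^-1 = - (f w - f z) * ((f z)^-1 * (f w)^-1).
    by field; rewrite fw0 fz0.
  have E' : f w - f z = h w * (w - z) by rewrite (fh w); ring.
  by rewrite E E' hl; field; rewrite fz0 fw0.
by rewrite cmodM ler_wpM2r ?cmod_ge0 //; apply: hk.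
Qed.

Lemma cdiff_comp D D' f g z l m : cdiff D f z l -> cdiff D' g (f z) m ->
  (forall w, D w -> D' (f w)) -> cdiff D (fun w => g (f w)) z (m * l).
Proof.
move=> df dg DD'; have cf := cdiff_ccont df.
move: df dg => /cdiffP[h [fh ch <-]] /cdiffP[k [gk ck <-]]; apply/cdiffP.
exists (fun w => k (f w) * h w); split=> //.
  move=> w; rewrite {1}gk; have -> : f w - f z = h w * (w - z).
    by rewrite (fh w); ring.
  by rewrite mulrA.
by apply: ccontM => //; apply: ccont_comp cf ck _.
Qed.

Lemma cdiffX D f z l n : cdiff D f z l ->
  cdiff D (fun w => f w ^+ n) z (n%:R * f z ^+ n.-1 * l).
Proof.
move=> df; elim: n => [|n IH]; first by rewrite !mul0r; exact: cdiff_cst.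
have := cdiffM df IH; rewrite /= -natr1.
have -> : l * f z ^+ n + f z * (n%:R * f z ^+ n.-1 * l) =
    (n%:R + 1) * f z ^+ n * l.
  by case: n {IH} => [|n] /=; rewrite ?expr0 ?exprS; ring.
by congr cdiff; apply/funext => w; rewrite exprS.
Qed.

Lemma cdiff_sub D D' f z l : (forall w, D w -> D' w) ->
  cdiff D' f z l -> cdiff D f z l.
Proof.
by move=> DD' df e /df[k k0 kP]; exists k => // w /DD'; apply: kP.
Qed.

Lemma ccont_sub D D' f z : (forall w, D w -> D' w) ->
  ccont D' f z -> ccont D f z.
Proof.
by move=> DD' df e /df[k k0 kP]; exists k => // w /DD'; apply: kP.
Qed.

Lemma cdiff_near D f g z l (r : R) : 0 < r ->
  (forall w, D w -> cmod (w - z) < r -> g w = f w) -> D z ->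
  cdiff D f z l -> cdiff D g z l.
Proof.
move=> r0 fg Dz df e /df[k k0 kP]; exists (Num.min k r) => [|w Dw].
  by rewrite lt_min k0.
rewrite lt_min => /andP[wk wr]; rewrite !fg ?subrr ?cmod0 //; exact: kP.
Qed.

Lemma cdiff_quotient f z l : cdiff setT f z l <->
  (forall eta : R, 0 < eta -> exists2 kappa : R, 0 < kappa & forall h, h != 0 ->
    cmod h < kappa -> cmod (h^-1 * (f (h + z) - f z) - l) <= eta).
Proof.
split=> df e e0; have [k k0 kP] := df _ e0; exists k => //.
  move=> h h0 hk; have := kP (h + z) I; rewrite addrK => /(_ hk).
  have -> : h^-1 * (f (h + z) - f z) - l = (f (h + z) - f z - l * h) / h.
    by field; rewrite h0.
  by rewrite cmodM cmodV ler_pdivrMr ?cmod_gt0.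
move=> w _ wk; have [->|wz] := eqVneq w z; first by rewrite !subrr mulr0 subrr cmod0 mulr0.
have wz0 : w - z != 0 by rewrite subr_eq0.
have := kP _ wz0 wk; rewrite subrK.
have -> : (w - z)^-1 * (f w - f z) - l = (f w - f z - l * (w - z)) / (w - z).
  by field; rewrite wz0.
by rewrite cmodM cmodV ler_pdivrMr ?cmod_gt0.
Qed.

(** Radii and errors range over positive elements of R[i] in the filters of the
    normed module R[i]; such elements are real. *)
Lemma cvg_dnbhs0P (q : C -> C) l :
  ((q h : C^o) @[h --> (0 : C^o)^'] --> (l : C^o)) <->
  (forall eta : R, 0 < eta -> exists2 kappa : R, 0 < kappa & forall h, h != 0 ->
    cmod h < kappa -> cmod (q h - l) <= eta).
Proof.
split=> [/cvgrPdist_le ql e e0|ql].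
  have ec0 : (0 : C) < e%:C by rewrite ltcR.
  have := ql _ ec0 => -[/= d d0 dP].
  have dE : d = (complex.Re d)%:C.
    by move: d0; rewrite ltcE /= => /andP[/eqP Id _]; apply: complex_eq.
  exists (complex.Re d) => [|h h0 hk]; first by move: d0; rewrite ltcE /= => /andP[].
  have /= := dP h; rewrite sub0r normrN dE !cmodE ltcR => /(_ hk h0).
  by rewrite lecR cmodBC.
apply/cvgrPdist_le => /= eps eps0.
have eE : eps = (complex.Re eps)%:C.
  by move: eps0; rewrite ltcE /= => /andP[/eqP Id _]; apply: complex_eq.
have e0 : 0 < complex.Re eps by move: eps0; rewrite ltcE /= => /andP[].
have [k k0 kP] := ql _ e0.
exists k%:C => /=; first by rewrite ltcR.
move=> h /=; rewrite sub0r normrN cmodE ltcR => hk h0.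
by rewrite eE cmodE lecR cmodBC; apply: kP.
Qed.

Lemma derivable_cdiff f z : derivable (f : C^o -> C^o) z 1 ->
  cdiff setT f z (derive1 (f : C -> C^o) z).
Proof.
move=> df; apply/cdiff_quotient/cvg_dnbhs0P.
move: df; rewrite /derivable /derive1.
have -> : (fun h : C => h^-1 *: (((f : C^o -> C^o) \o shift z) (h *: (1:C^o)) - f z))
   = (fun h : C => h^-1 * (f (h + z) - f z)).
  by apply/funext => h; rewrite /= /shift /= scaler1.
exact.
Qed.

Lemma cdiff_derivable f z l : cdiff setT f z l ->
  derivable (f : C^o -> C^o) z 1 /\ derive1 (f : C -> C^o) z = l.
Proof.
move=> /cdiff_quotient/cvg_dnbhs0P df; split; last exact: cvg_lim df.
apply/cvg_ex; exists l.
have -> : (fun h : C => h^-1 *: (((f : C^o -> C^o) \o shift z) (h *: (1:C^o)) - f z))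
   = (fun h : C => h^-1 * (f (h + z) - f z)).
  by apply/funext => h; rewrite /= /shift /= scaler1.
exact: df.
Qed.
End Calculus.

(** * Integrals over segments *)

Section SegmentIntegral.
Variable R : realType.
Local Notation C := R[i].
Local Notation leb := (@lebesgue_measure R).
Implicit Types (c : R -> C) (f : R -> R) (a b : R).

Definition segcontR f a b := forall x, a <= x <= b -> forall e : R, 0 < e ->
  exists2 k : R, 0 < k &
    forall y, a <= y <= b -> `|y - x| < k -> `|f y - f x| <= e.

Definition segcont c a b := forall x, a <= x <= b -> forall e : R, 0 < e ->
  exists2 k : R, 0 < k &
    forall y, a <= y <= b -> `|y - x| < k -> cmod (c y - c x) <= e.

Definition rint f a b : R := \int[leb]_(x in `[a, b]) f x.

Definition cint c a b : C :=
  rint (fun x => complex.Re (c x)) a b +i* rint (fun x => complex.Im (c x)) a b.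

Lemma segcontR_integrable f a b : segcontR f a b ->
  leb.-integrable `[a, b] (EFin \o f).
Proof.
move=> cf; apply: continuous_compact_integrable; first exact: segment_compact.
apply/subspace_continuousP => x; rewrite /= in_itv /= => xab.
apply/cvgrPdist_le => e e0; have [k k0 kP] := cf x xab e e0.
exists k => //= y /= yk; rewrite in_itv /= => yab.
by rewrite distrC; apply: kP => //; rewrite distrC.
Qed.

Lemma segcont_Re c a b : segcont c a b -> segcontR (fun x => complex.Re (c x)) a b.
Proof.
move=> cc x xab e e0; have [k k0 kP] := cc x xab e e0; exists k => // y yab yk.
by apply: le_trans (kP y yab yk); rewrite -ReN -ReD Re_le_cmod.
Qed.

Lemma segcont_Im c a b : segcont c a b -> segcontR (fun x => complex.Im (c x)) a b.
Proof.
move=> cc x xab e e0; have [k k0 kP] := cc x xab e e0; exists k => // y yab yk.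
by apply: le_trans (kP y yab yk); rewrite -ImN -ImD Im_le_cmod.
Qed.

Lemma segcont_cmod c a b : segcont c a b -> segcontR (fun x => cmod (c x)) a b.
Proof.
move=> cc x xab e e0; have [k k0 kP] := cc x xab e e0; exists k => // y yab yk.
apply: le_trans (kP y yab yk); rewrite ler_norml cmodB_ge andbT.
by rewrite cmodBC lerNl opprB cmodB_ge.
Qed.

Lemma segcont_sub c a b a' b' : a <= a' -> b' <= b ->
  segcont c a b -> segcont c a' b'.
Proof.
move=> aa bb cc x /andP[ax xb] e e0.
have xab : a <= x <= b by rewrite (le_trans aa) // (le_trans xb).
have [k k0 kP] := cc x xab e e0; exists k => // y /andP[ay yb] yk.
by apply: kP => //; rewrite (le_trans aa) // (le_trans yb).
Qed.

Lemma segcont_ext c1 c2 a b : (forall x, a <= x <= b -> c1 x = c2 x) ->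
  segcont c1 a b -> segcont c2 a b.
Proof.
move=> c12 cc x xab e e0; have [k k0 kP] := cc x xab e e0; exists k => // y yab yk.
by rewrite -!c12 //; exact: kP.
Qed.

Lemma segcont_cst (k : C) a b : segcont (fun=> k) a b.
Proof. by move=> x _ e e0; exists 1 => // y _ _; rewrite subrr cmod0 ltW. Qed.

Lemma segcontD c1 c2 a b : segcont c1 a b -> segcont c2 a b ->
  segcont (fun x => c1 x + c2 x) a b.
Proof.
move=> h1 h2 x xab e e0; have e20 : 0 < e / 2 by rewrite divr_gt0.
have [k k0 kP] := h1 x xab _ e20; have [k' k'0 kP'] := h2 x xab _ e20.
exists (Num.min k k') => [|y yab]; first by rewrite lt_min k0.
rewrite lt_min => /andP[yk yk'].
have -> : c1 y + c2 y - (c1 x + c2 x) = (c1 y - c1 x) + (c2 y - c2 x) by ring.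
apply: (le_trans (cmodD _ _)).
by have := kP _ yab yk; have := kP' _ yab yk'; lra.
Qed.

Lemma segcontZ (l : C) c a b : segcont c a b -> segcont (fun x => l * c x) a b.
Proof.
move=> h x xab e e0.
have l1 : 0 < cmod l + 1 by rewrite ltr_wpDl ?cmod_ge0.
have [k k0 kP] := h x xab _ (divr_gt0 e0 l1); exists k => // y yab yk.
rewrite -mulrBr cmodM; have := kP y yab yk.
rewrite ler_pdivlMr // => hle; apply: le_trans hle.
by rewrite mulrC ler_wpM2l ?cmod_ge0 // lerDl.
Qed.

Lemma segcont_path (D : set C) (f : C -> C) (g : R -> C) a b :
  (forall x, a <= x <= b -> ccont D f (g x)) ->
  (forall x, a <= x <= b -> D (g x)) ->
  (forall x y, cmod (g y - g x) <= `|y - x|) ->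
  segcont (fun x => f (g x)) a b.
Proof.
move=> cf Dg gl x xab e e0; have [k k0 kP] := cf x xab e e0.
exists k => // y yab yk; apply: kP; first exact: Dg.
exact: le_lt_trans (gl _ _) yk.
Qed.

Lemma rint_split f a m b : a <= m <= b -> segcontR f a b ->
  rint f a b = rint f a m + rint f m b.
Proof.
move=> /andP[am mb] cf; have If := segcontR_integrable cf.
have : rint f a b - rint f a m = \int[leb]_(t in `]m, b]) f t.
  by apply: Rintegral_itvB; rewrite // bnd_simp.
move=> /eqP; rewrite subr_eq => /eqP ->; rewrite addrC; congr (_ + _).
apply: Rintegral_itv_obnd_cbnd; apply: integrableS If => //.
by apply: subset_itv; rewrite bnd_simp.
Qed.

Lemma rint_cst (k : R) a b : a <= b -> rint (fun=> k) a b = k * (b - a).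
Proof.
move=> ab; rewrite /rint Rintegral_cst //= lebesgue_measure_itv /= lte_fin.
case: ltP => [//|ba]; have -> : a = b by apply/eqP; rewrite eq_le ab.
by rewrite subrr.
Qed.

Lemma rint_ext f1 f2 a b : (forall x, a <= x <= b -> f1 x = f2 x) ->
  rint f1 a b = rint f2 a b.
Proof.
by move=> h; apply: eq_Rintegral => x; rewrite inE /= in_itv /=; apply: h.
Qed.

Lemma rint_le f1 f2 a b : segcontR f1 a b -> segcontR f2 a b ->
  (forall x, a <= x <= b -> f1 x <= f2 x) -> rint f1 a b <= rint f2 a b.
Proof.
by move=> h1 h2 h; apply: le_Rintegral => //; exact: segcontR_integrable.
Qed.

Lemma rint_norm f a b : segcontR f a b ->
  `|rint f a b| <= rint (fun x => `|f x|) a b.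
Proof.
by move=> h; apply: le_normr_Rintegral => //; exact: segcontR_integrable.
Qed.

Lemma segcontR_cst (k : R) a b : segcontR (fun=> k) a b.
Proof. by move=> x _ e e0; exists 1 => // y _ _; rewrite subrr normr0 ltW. Qed.

Lemma segcontR_norm f a b : segcontR f a b -> segcontR (fun x => `|f x|) a b.
Proof.
move=> h x xab e e0; have [k k0 kP] := h x xab e e0; exists k => // y yab yk.
exact: le_trans (ler_dist_dist _ _) (kP _ yab yk).
Qed.

Lemma cint_split c a m b : a <= m <= b -> segcont c a b ->
  cint c a b = cint c a m + cint c m b.
Proof.
move=> amb cc; apply: complex_eq; rewrite ?ReD ?ImD /=; apply: rint_split => //.
  exact: segcont_Re.
exact: segcont_Im.
Qed.

Lemma cint_ext c1 c2 a b : (forall x, a <= x <= b -> c1 x = c2 x) ->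
  cint c1 a b = cint c2 a b.
Proof.
by move=> h; congr (_ +i* _); apply: rint_ext => x xab; rewrite h.
Qed.

Lemma cint_cst (k : C) a b : a <= b -> cint (fun=> k) a b = k * (b - a)%:C.
Proof.
by move=> ab; case: k => k1 k2; apply: complex_eq; rewrite /= rint_cst //; ring.
Qed.

Lemma cintD c1 c2 a b : segcont c1 a b -> segcont c2 a b ->
  cint (fun x => c1 x + c2 x) a b = cint c1 a b + cint c2 a b.
Proof.
move=> h1 h2; apply: complex_eq; rewrite ?ReD ?ImD /= -RintegralD //.
all: try (by apply: rint_ext => x _; rewrite ?ReD ?ImD).
all: apply: segcontR_integrable.
all: by [exact: segcont_Re|exact: segcont_Im].
Qed.

Lemma cintZ (l : C) c a b : segcont c a b ->
  cint (fun x => l * c x) a b = l * cint c a b.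
Proof.
case: l => p q h.
have Ire := segcontR_integrable (segcont_Re h).
have Iim := segcontR_integrable (segcont_Im h).
have ZI (r : R) f : leb.-integrable `[a, b] (EFin \o f) ->
    leb.-integrable `[a, b] (EFin \o (fun x => r * f x)).
  by move=> If; apply: (integrableZl _ r If).
apply: complex_eq => /=.
  rewrite /rint -!RintegralZl // -RintegralB //; try exact: ZI.
  by apply: rint_ext => x _; case: (c x).
rewrite /rint -!RintegralZl // -RintegralD //; try exact: ZI.
by apply: rint_ext => x _; case: (c x).
Qed.

Lemma cintB c1 c2 a b : segcont c1 a b -> segcont c2 a b ->
  cint (fun x => c1 x - c2 x) a b = cint c1 a b - cint c2 a b.
Proof.
move=> h1 h2; have h2' := segcontZ (-1) h2.
rewrite -mulN1r -cintZ // -cintD //; apply: cint_ext => x _.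
by rewrite mulN1r.
Qed.

(** The real and imaginary parts are bounded separately, whence the factor 2. *)
Lemma cint_le c a b : segcont c a b ->
  cmod (cint c a b) <= 2 * rint (fun x => cmod (c x)) a b.
Proof.
move=> h; have hr := segcont_Re h; have hi := segcont_Im h.
apply: (le_trans (cmod_le_ReIm _)); rewrite mulr2n mulrDl mul1r /=.
apply: lerD.
  apply: (le_trans (rint_norm hr)); apply: rint_le => [||x _].
  - exact: segcontR_norm.
  - exact: segcont_cmod.
  - exact: Re_le_cmod.
apply: (le_trans (rint_norm hi)); apply: rint_le => [||x _].
- exact: segcontR_norm.
- exact: segcont_cmod.
- exact: Im_le_cmod.
Qed.

Lemma cint_bound c a b (M : R) : a <= b -> segcont c a b ->
  (forall x, a <= x <= b -> cmod (c x) <= M) ->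
  cmod (cint c a b) <= 2 * M * (b - a).
Proof.
move=> ab h cM; apply: (le_trans (cint_le h)); rewrite -mulrA ler_pM2l //.
rewrite -rint_cst //; apply: rint_le => //; first exact: segcont_cmod.
exact: segcontR_cst.
Qed.

End SegmentIntegral.

(** * Goursat's theorem for rectangles *)

Section Rectangle.
Variable R : realType.
Local Notation C := R[i].
Implicit Types (f g : C -> C) (a b c d : R).

Definition rect a b c d : set C :=
  [set z | a <= complex.Re z <= b /\ c <= complex.Im z <= d].

Definition hseg f a b y := cint (fun x => f (x +i* y)) a b.
Definition vseg f c d x := cint (fun y => f (x +i* y)) c d.

(** The integral along the boundary of the rectangle, counterclockwise. *)
Definition bint f a b c d : C :=
  hseg f a b c - hseg f a b d + 'i%C * (vseg f c d b - vseg f c d a).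

Lemma ccont_hseg (D : set C) f a b y :
  (forall x, a <= x <= b -> ccont D f (x +i* y)) ->
  (forall x, a <= x <= b -> D (x +i* y)) ->
  segcont (fun x => f (x +i* y)) a b.
Proof.
move=> cf Df; apply: (segcont_path cf Df) => s t.
have -> : (t +i* y) - (s +i* y) = (t - s)%:C.
  by apply: complex_eq; rewrite /= ?subrr.
by rewrite cmodR.
Qed.

Lemma ccont_vseg (D : set C) f c d x :
  (forall y, c <= y <= d -> ccont D f (x +i* y)) ->
  (forall y, c <= y <= d -> D (x +i* y)) ->
  segcont (fun y => f (x +i* y)) c d.
Proof.
move=> cf Df; apply: (segcont_path cf Df) => s t.
have -> : (x +i* t) - (x +i* s) = 'i%C * (t - s)%:C.
  by apply: complex_eq => /=; ring.
by rewrite cmodM cmodR /= expr0n expr1n add0r sqrtr1 mul1r.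
Qed.

Lemma bint_splitx f a m b c d : a <= m <= b ->
  segcont (fun x => f (x +i* c)) a b -> segcont (fun x => f (x +i* d)) a b ->
  bint f a b c d = bint f a m c d + bint f m b c d.
Proof.
move=> amb hc hd; rewrite /bint /hseg !(cint_split amb) //; ring.
Qed.

Lemma bint_splity f a b c m d : c <= m <= d ->
  segcont (fun y => f (a +i* y)) c d -> segcont (fun y => f (b +i* y)) c d ->
  bint f a b c d = bint f a b c m + bint f a b m d.
Proof.
move=> cmd ha hb; rewrite /bint /vseg !(cint_split cmd) //; ring.
Qed.

Definition bdcont f a b c d :=
  [/\ segcont (fun x => f (x +i* c)) a b, segcont (fun x => f (x +i* d)) a b,
      segcont (fun y => f (a +i* y)) c d & segcont (fun y => f (b +i* y)) c d].

Lemma bintD f g a b c d : bdcont f a b c d -> bdcont g a b c d ->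
  bint (fun z => f z + g z) a b c d = bint f a b c d + bint g a b c d.
Proof.
move=> [f1 f2 f3 f4] [g1 g2 g3 g4]; rewrite /bint /hseg /vseg !cintD //; ring.
Qed.

Lemma bintZ (l : C) f a b c d : bdcont f a b c d ->
  bint (fun z => l * f z) a b c d = l * bint f a b c d.
Proof.
move=> [f1 f2 f3 f4]; rewrite /bint /hseg /vseg !cintZ //; ring.
Qed.

Lemma bint_ext f g a b c d :
  (forall z, rect a b c d z -> (complex.Re z = a \/ complex.Re z = b) \/
      (complex.Im z = c \/ complex.Im z = d) -> f z = g z) ->
  a <= b -> c <= d -> bint f a b c d = bint g a b c d.
Proof.
move=> fg ab cd; rewrite /bint; congr (_ - _ + _ * (_ - _)); apply: cint_ext => x xab;
  apply: fg; rewrite /rect /= ?lexx ?ab ?cd //; tauto.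
Qed.

Lemma bint_bound f a b c d (M : R) : a <= b -> c <= d -> bdcont f a b c d ->
  (forall z, rect a b c d z -> (complex.Re z = a \/ complex.Re z = b) \/
      (complex.Im z = c \/ complex.Im z = d) -> cmod (f z) <= M) ->
  cmod (bint f a b c d) <= 4 * M * ((b - a) + (d - c)).
Proof.
move=> ab cd [f1 f2 f3 f4] fM; rewrite /bint.
have hc : cmod (hseg f a b c) <= 2 * M * (b - a).
  apply: cint_bound => // x xab; apply: fM; rewrite /rect /= ?lexx ?ab ?cd //; tauto.
have hd : cmod (hseg f a b d) <= 2 * M * (b - a).
  apply: cint_bound => // x xab; apply: fM; rewrite /rect /= ?lexx ?ab ?cd //; tauto.
have ha : cmod (vseg f c d a) <= 2 * M * (d - c).
  apply: cint_bound => // x xab; apply: fM; rewrite /rect /= ?lexx ?ab ?cd //; tauto.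
have hb : cmod (vseg f c d b) <= 2 * M * (d - c).
  apply: cint_bound => // x xab; apply: fM; rewrite /rect /= ?lexx ?ab ?cd //; tauto.
apply: (le_trans (cmodD _ _)); rewrite cmodM.
have -> : cmod ('i%C : C) = 1 by rewrite /= expr0n expr1n add0r sqrtr1.
have := cmodB (hseg f a b c) (hseg f a b d).
have := cmodB (vseg f c d b) (vseg f c d a); lra.
Qed.

(** The values of an affine function on opposite sides differ by a constant, so that the
    two pairs of sides cancel. *)
Lemma bint_affine (p q : C) a b c d : a <= b -> c <= d ->
  bdcont (fun z => p + q * z) a b c d /\ bint (fun z => p + q * z) a b c d = 0.
Proof.
move=> ab cd.
have cc (z : C) : ccont setT (fun z => p + q * z) z.
  apply: ccontD; first exact: ccont_cst.
  by apply: ccontM; [exact: ccont_cst|exact: ccont_id].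
have B : bdcont (fun z => p + q * z) a b c d.
  by split; [apply: (@ccont_hseg setT (fun z => p + q * z))|apply: (@ccont_hseg setT (fun z => p + q * z))
            |apply: (@ccont_vseg setT (fun z => p + q * z))|apply: (@ccont_vseg setT (fun z => p + q * z))].
split=> //; case: B => b1 b2 b3 b4; rewrite /bint /hseg /vseg -!cintB //.
rewrite (@cint_ext _ _ (fun=> q * ('i%C * (c - d)%:C))); last first.
  by move=> x _; case: (p) (q) => [p1 p2] [q1 q2]; apply: complex_eq => /=; ring.
rewrite (@cint_ext _ (fun x => p + q * (b +i* x) - _) (fun=> q * (b - a)%:C)); last first.
  by move=> x _; case: (p) (q) => [p1 p2] [q1 q2]; apply: complex_eq => /=; ring.
by rewrite !cint_cst //; case: (q) => [q1 q2]; apply: complex_eq => /=; ring.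
Qed.

Lemma rect_bdcont (D : set C) f a b c d : a <= b -> c <= d ->
  (forall z, rect a b c d z -> ccont D f z) -> (rect a b c d `<=` D) ->
  bdcont f a b c d.
Proof.
move=> ab cd cf rD; split.
- apply: (@ccont_hseg D) => x xab; [apply: cf|apply: rD]; rewrite /rect /= lexx //.
- apply: (@ccont_hseg D) => x xab; [apply: cf|apply: rD]; rewrite /rect /= lexx cd //.
- apply: (@ccont_vseg D) => x xab; [apply: cf|apply: rD]; rewrite /rect /= lexx ab //.
- apply: (@ccont_vseg D) => x xab; [apply: cf|apply: rD]; rewrite /rect /= lexx ab //.
Qed.

(** The integrals over the four quarters add up to the integral over the rectangle, so
    they cannot all be small. *)
Lemma bint_quarter f a c (w h : R) : 0 <= w -> 0 <= h ->
  (forall z, rect a (a + w) c (c + h) z -> ccont (rect a (a + w) c (c + h)) f z) ->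
  exists2 p : R * R, (a <= p.1 <= a + w / 2) /\ (c <= p.2 <= c + h / 2) &
    cmod (bint f a (a + w) c (c + h)) <=
      4 * cmod (bint f p.1 (p.1 + w / 2) p.2 (p.2 + h / 2)).
Proof.
move=> w0 h0 cf.
have S x : a <= x <= a + w -> segcont (fun y => f (x +i* y)) c (c + h).
  by move=> xab; apply: (@ccont_vseg (rect a (a + w) c (c + h))) => y ycd;
    [apply: cf|]; split.
have S' y : c <= y <= c + h -> segcont (fun x => f (x +i* y)) a (a + w).
  by move=> ycd; apply: (@ccont_hseg (rect a (a + w) c (c + h))) => x xab;
    [apply: cf|]; split.
have [a' a'E] : exists a', a' = a + w / 2 by eexists.
have [c' c'E] : exists c', c' = c + h / 2 by eexists.
have aE : a' + w / 2 = a + w by lra.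
have cE : c' + h / 2 = c + h by lra.
have amb : a <= a' <= a + w by lra.
have cmd : c <= c' <= c + h by lra.
have E : bint f a (a + w) c (c + h) =
    (bint f a (a + w / 2) c (c + h / 2) + bint f a (a + w / 2) c' (c' + h / 2)) +
    (bint f a' (a' + w / 2) c (c + h / 2) + bint f a' (a' + w / 2) c' (c' + h / 2)).
  rewrite aE cE -a'E -c'E (bint_splitx amb); first last.
  - by apply: S'; rewrite lerDl h0 lexx.
  - by apply: S'; rewrite lerDl h0 lexx.
  by congr (_ + _); apply: bint_splity => //; apply: S; lra.
have a0 : a <= a <= a + w / 2 by lra.
have a1 : a <= a' <= a + w / 2 by lra.
have c0 : c <= c <= c + h / 2 by lra.
have c1 : c <= c' <= c + h / 2 by lra.
apply: contrapT => H.
have H' p1 p2 : (a <= p1 <= a + w / 2) -> (c <= p2 <= c + h / 2) ->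
    4 * cmod (bint f p1 (p1 + w / 2) p2 (p2 + h / 2)) <
    cmod (bint f a (a + w) c (c + h)).
  by move=> h1 h2; rewrite ltNge; apply/negP => hle; apply: H; exists (p1, p2).
have h1 := H' a c a0 c0; have h2 := H' a c' a0 c1.
have h3 := H' a' c a1 c0; have h4 := H' a' c' a1 c1.
have := cmodD (bint f a (a + w / 2) c (c + h / 2) + bint f a (a + w / 2) c' (c' + h / 2))
 (bint f a' (a' + w / 2) c (c + h / 2) + bint f a' (a' + w / 2) c' (c' + h / 2)).
rewrite -E.
have := cmodD (bint f a (a + w / 2) c (c + h / 2)) (bint f a (a + w / 2) c' (c' + h / 2)).
have := cmodD (bint f a' (a' + w / 2) c (c + h / 2)) (bint f a' (a' + w / 2) c' (c' + h / 2)).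
move: h1 h2 h3 h4; move: (bint f a (a + w) c _) (bint f a _ c _) (bint f a _ c' _).
by move: (bint f a' _ c _) (bint f a' _ c' _) => B1 B2 B3 B4 B5; lra.
Qed.

Lemma nested_point (a : nat -> R) (w : R) : 0 <= w ->
  (forall n, a n <= a n.+1 <= a n + w / 2 ^+ n.+1) ->
  exists x, forall n, a n <= x <= a n + w / 2 ^+ n.
Proof.
move=> w0 an.
have up n m : a n <= a (n + m)%N /\
    a (n + m)%N + w / 2 ^+ (n + m) <= a n + w / 2 ^+ n.
  elim: m => [|m [IH1 IH2]]; first by rewrite addn0.
  rewrite addnS; have /andP[h1 h2] := an (n + m)%N; split; first exact: le_trans IH1 h1.
  apply: le_trans IH2; have -> : w / 2 ^+ (n + m) = w / 2 ^+ (n + m).+1 + w / 2 ^+ (n + m).+1.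
    by rewrite exprS invfM; field; rewrite expf_neq0.
  by rewrite addrA lerD2r.
have bd n m : a m <= a n + w / 2 ^+ n.
  have p0 k : 0 <= w / 2 ^+ k by rewrite divr_ge0 // exprn_ge0.
  have [nm|mn] := leqP n m.
    have [_] := up n (m - n)%N; rewrite subnKC //; apply: le_trans.
    by rewrite lerDl.
  have [h _] := up m (n - m)%N; rewrite subnKC in h; last exact: ltnW.
  by apply: (le_trans h); rewrite lerDl.
have S : has_sup (range a).
  split; first by exists (a 0); exists 0.
  by exists (a 0 + w / 2 ^+ 0) => _ [m _ <-]; exact: bd.
exists (sup (range a)) => n; apply/andP; split.
  by apply: sup_upper_bound => //; exists n.
by apply: ge_sup; [exists (a 0); exists 0|move=> _ [m _ <-]; exact: bd].
Qed.

(** Bisection: the quarters with the largest integrals shrink to a point z.  Near z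
    the function is affine up to o(|w - z|), and the integral of this error is small
    against the area of the quarter. *)
Theorem goursat f a b c d : a <= b -> c <= d ->
  (forall z, rect a b c d z -> exists l, cdiff (rect a b c d) f z l) ->
  bint f a b c d = 0.
Proof.
move=> ab cd df; pose w := b - a; pose h := d - c.
have bE : b = a + w by rewrite /w; lra.
have dE : d = c + h by rewrite /h; lra.
have w0 : 0 <= w by rewrite subr_ge0.
have h0 : 0 <= h by rewrite subr_ge0.
have cf z : rect a b c d z -> ccont (rect a b c d) f z.
  by move=> /df[l]; exact: cdiff_ccont.
pose sub n (p : R * R) := [/\ a <= p.1, p.1 + w / 2 ^+ n <= b, c <= p.2 &
  p.2 + h / 2 ^+ n <= d].
pose J n (p : R * R) := cmod (bint f p.1 (p.1 + w / 2 ^+ n) p.2 (p.2 + h / 2 ^+ n)).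
have half n (x : R) : x / 2 ^+ n / 2 = x / 2 ^+ n.+1.
  by rewrite exprS invfM mulrA mulrAC.
have wn0 n : 0 <= w / 2 ^+ n by rewrite divr_ge0 // exprn_ge0.
have hn0 n : 0 <= h / 2 ^+ n by rewrite divr_ge0 // exprn_ge0.
have subrect n p : sub n p ->
    rect p.1 (p.1 + w / 2 ^+ n) p.2 (p.2 + h / 2 ^+ n) `<=` rect a b c d.
  by move=> [s1 s2 s3 s4] z [/andP[z1 z2] /andP[z3 z4]]; split; apply/andP; split; lra.
have step (np : nat * (R * R)) : exists p' : R * R, sub np.1 np.2 ->
    [/\ sub np.1.+1 p', np.2.1 <= p'.1 <= np.2.1 + w / 2 ^+ np.1.+1,
       np.2.2 <= p'.2 <= np.2.2 + h / 2 ^+ np.1.+1 &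
       J np.1 np.2 <= 4 * J np.1.+1 p'].
  case: np => n p /=; have [sp|//] := pselect (sub n p); last by exists p.
  have [|p' [h1 h2] hJ] := @bint_quarter f p.1 p.2 _ _ (wn0 n) (hn0 n).
    move=> z zr; apply: ccont_sub (subrect _ _ sp) (cf _ (subrect _ _ sp _ zr)).
  exists p' => _; rewrite !half in h1 h2 hJ; split=> //.
  case: sp => s1 s2 s3 s4; have := half n w; have := half n h.
  by rewrite /sub; move=> eh ew; split; lra.
have [nxt nxtP] := choice step.
pose fix p n : R * R := if n is m.+1 then nxt (m, p m) else (a, c).
have psub n : sub n (p n).
  elim: n => [|n IH]; last by have [] := nxtP (n, p n) IH.
  by rewrite /sub /= expr0 !divr1 -bE -dE !lexx.
have pJ n : J 0 (p 0) <= 4 ^+ n * J n (p n).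
  elim: n => [|n IH]; first by rewrite expr0 mul1r.
  apply: (le_trans IH); rewrite exprSr -mulrA ler_wpM2l ?exprn_ge0 //.
  by have [] := nxtP (n, p n) (psub n).
have [x xP] : exists x, forall n, (p n).1 <= x <= (p n).1 + w / 2 ^+ n.
  by apply: nested_point => // n; have [] := nxtP (n, p n) (psub n).
have [y yP] : exists y, forall n, (p n).2 <= y <= (p n).2 + h / 2 ^+ n.
  by apply: nested_point => // n; have [] := nxtP (n, p n) (psub n).
pose z : C := x +i* y.
have zr : rect a b c d z.
  by apply: (subrect 0 (p 0) (psub 0)); split; [exact: (xP 0)|exact: (yP 0)].
have [l dfz] := df _ zr.
have J0E : J 0 (p 0) = cmod (bint f a b c d).
  by rewrite /J /= expr0 !divr1 -bE -dE.
apply/eqP; rewrite -cmod_eq0 -J0E eq_le cmod_ge0 andbT.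
rewrite leNgt; apply/negP => J0.
pose L := w + h.
have L0 : 0 <= L by rewrite addr_ge0.
have eta0 : 0 < J 0 (p 0) / (4 * L * L + 1).
  by rewrite divr_gt0 // ltr_wpDl // !mulr_ge0.
have [k k0 kP] := dfz _ eta0.
have [n nk] : exists n : nat, L / 2 ^+ n < k.
  have := archi_boundP (divr_ge0 L0 (ltW k0)).
  set n := Num.bound _ => Ln; exists n.
  rewrite ltr_pdivrMr ?exprn_gt0 // mulrC -ltr_pdivrMr //.
  by apply: (lt_le_trans Ln); rewrite -natrX ler_nat; exact/ltnW/ltn_expl.
have Bn := psub n.
set an := (p n).1 in Bn *; set cn := (p n).2 in Bn *.
have sr := subrect _ _ (psub n).
have anb : an <= an + w / 2 ^+ n by rewrite lerDl.
have cnb : cn <= cn + h / 2 ^+ n by rewrite lerDl.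
pose e w' := f w' - (f z - l * z + l * w').
have [A1 A2] := bint_affine (f z - l * z) l anb cnb.
have cfn : bdcont f an (an + w / 2 ^+ n) cn (cn + h / 2 ^+ n).
  by apply: (rect_bdcont anb cnb _ sr) => u ur; apply: cf; exact: sr.
have small u : rect an (an + w / 2 ^+ n) cn (cn + h / 2 ^+ n) u ->
    cmod (u - z) <= L / 2 ^+ n.
  move=> [/andP[u1 u2] /andP[u3 u4]]; apply: (le_trans (cmod_le_ReIm _)).
  rewrite /L mulrDl !ReD !ImD !ReN !ImN /=.
  have /andP[x1 x2] := xP n; have /andP[y1 y2] := yP n.
  apply: lerD; rewrite ler_norml; apply/andP; split; rewrite /an /cn in u1 u2 u3 u4 *; lra.
have cc : bdcont e an (an + w / 2 ^+ n) cn (cn + h / 2 ^+ n).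
  have ccA (u : C) : ccont setT (fun w' => - (f z - l * z + l * w')) u.
    have -> : (fun w' => - (f z - l * z + l * w')) = (fun w' => - (f z - l * z) + (- l) * w').
      by apply/funext => w'; ring.
    apply: ccontD; first exact: ccont_cst.
    by apply: ccontM; [exact: ccont_cst|exact: ccont_id].
  apply: (rect_bdcont anb cnb _ sr) => u ur.
  exact: ccontD (cf _ (sr _ ur)) (ccont_sub _ (ccA u)).
have : J n (p n) <= 4 * (J 0 (p 0) / (4 * L * L + 1) * (L / 2 ^+ n)) * (L / 2 ^+ n).
  have -> : J n (p n) = cmod (bint e an (an + w / 2 ^+ n) cn (cn + h / 2 ^+ n)).
    rewrite /J -/an -/cn; congr cmod.
    rewrite -[RHS]addr0 -A2 -bintD //; apply: bint_ext => // u _ _.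
    by rewrite /e subrK.
  apply: (le_trans (bint_bound (M := J 0 (p 0) / (4 * L * L + 1) * (L / 2 ^+ n)) _ _ cc _)) => //.
    move=> u ur _; have us := small _ ur.
    have : cmod (e u) <= J 0 (p 0) / (4 * L * L + 1) * cmod (u - z).
      have -> : e u = f u - f z - l * (u - z) by rewrite /e; ring.
      by apply: kP; [exact: sr|exact: le_lt_trans us nk].
    by move/le_trans; apply; apply: ler_wpM2l => //; exact: ltW.
  have -> // : an + w / 2 ^+ n - an + (cn + h / 2 ^+ n - cn) = L / 2 ^+ n.
  by rewrite /L (mulrDl w h); lra.
have := pJ n; move=> h1 h2.
have : J 0 (p 0) <= 4 ^+ n * (4 * (J 0 (p 0) / (4 * L * L + 1) * (L / 2 ^+ n)) * (L / 2 ^+ n)).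
  by apply: (le_trans h1); rewrite ler_wpM2l // exprn_ge0.
have -> : 4 ^+ n * (4 * (J 0 (p 0) / (4 * L * L + 1) * (L / 2 ^+ n)) * (L / 2 ^+ n)) =
   J 0 (p 0) * ((4 * L * L) / (4 * L * L + 1)).
  have -> : (4 : R) ^+ n = 2 ^+ n * 2 ^+ n by rewrite -exprMn -natrM.
  by field; rewrite expf_neq0 //= gt_eqF // ltr_wpDl // !mulr_ge0.
apply/negP; rewrite -ltNge gtr_pMr // ltr_pdivrMr ?mul1r ?ltrDl //.
by rewrite ltr_wpDl // !mulr_ge0.
Qed.

End Rectangle.

(** * Cauchy's formula on squares *)

Section Cauchy.
Variable R : realType.
Local Notation C := R[i].
Implicit Types (f g : C -> C) (a z w : C) (r s M : R).

(** Squares take the place of discs: their sides suit rectangular integrals. *)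
Definition csq a r : set C := rect (complex.Re a - r) (complex.Re a + r)
  (complex.Im a - r) (complex.Im a + r).

Definition bsq f a r : C := bint f (complex.Re a - r) (complex.Re a + r)
  (complex.Im a - r) (complex.Im a + r).

Definition csq_bd a r : set C := [set z | csq a r z /\
  ((complex.Re z = complex.Re a - r \/ complex.Re z = complex.Re a + r) \/
   (complex.Im z = complex.Im a - r \/ complex.Im z = complex.Im a + r))].

Lemma csq_bd_ge a r z : 0 <= r -> csq_bd a r z -> r <= cmod (z - a).
Proof.
move=> r0 [_ []] [] zE.
- apply: le_trans (Re_le_cmod _); rewrite ReD ReN zE ler_normr; lra.
- apply: le_trans (Re_le_cmod _); rewrite ReD ReN zE ler_normr; lra.
- apply: le_trans (Im_le_cmod _); rewrite ImD ImN zE ler_normr; lra.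
- apply: le_trans (Im_le_cmod _); rewrite ImD ImN zE ler_normr; lra.
Qed.

Lemma csq_le a r z : csq a r z -> cmod (z - a) <= 2 * r.
Proof.
move=> [/andP[z1 z2] /andP[z3 z4]]; apply: (le_trans (cmod_le_ReIm _)).
rewrite ReD ImD ReN ImN mulr2n mulrDl mul1r.
by apply: lerD; rewrite ler_norml; lra.
Qed.

Lemma ball_csq a r z : cmod (z - a) <= r -> csq a r z.
Proof.
move=> zr; have := le_trans (Re_le_cmod _) zr; have := le_trans (Im_le_cmod _) zr.
by rewrite ReD ImD ReN ImN !ler_norml /csq /rect /=; lra.
Qed.

Lemma csq_sub a r s : s <= r -> csq a s `<=` csq a r.
Proof. by move=> sr z [h1 h2]; split; lra. Qed.

Lemma csq_center a r : 0 <= r -> csq a r a.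
Proof. by move=> r0; split; lra. Qed.

Lemma csq_bdcont (D : set C) f a r : 0 <= r ->
  (forall z, csq_bd a r z -> ccont D f z) -> csq_bd a r `<=` D ->
  bdcont f (complex.Re a - r) (complex.Re a + r)
    (complex.Im a - r) (complex.Im a + r).
Proof.
move=> r0 cf rD; split.
- apply: (@ccont_hseg _ D) => x xab; [apply: cf|apply: rD];
    by split; [split|right; left] => //=; lra.
- apply: (@ccont_hseg _ D) => x xab; [apply: cf|apply: rD];
    by split; [split|right; right] => //=; lra.
- apply: (@ccont_vseg _ D) => x xab; [apply: cf|apply: rD];
    by split; [split|left; left] => //=; lra.
- apply: (@ccont_vseg _ D) => x xab; [apply: cf|apply: rD];
    by split; [split|left; right] => //=; lra.
Qed.

(** The region between the two squares is cut into four rectangles that avoid the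
    centre, and Goursat's theorem applies to each of them. *)
Lemma bsq_shrink f a r s : 0 < s <= r ->
  (forall z, csq a r z -> z != a -> exists l, cdiff (csq a r) f z l) ->
  bsq f a r = bsq f a s.
Proof.
move=> /andP[s0 sr] df; case: a df => p q df; rewrite /bsq /=.
have cf z : csq (p +i* q) r z -> z != p +i* q -> ccont (csq (p +i* q) r) f z.
  by move=> zr za; have [l] := df _ zr za; exact: cdiff_ccont.
have ne1 x y : x != p -> x +i* y != p +i* q.
  by apply: contra => /eqP[-> _].
have ne2 x y : y != q -> x +i* y != p +i* q.
  by apply: contra => /eqP[_ ->].
have H y (x1 x2 : R) : p - r <= x1 -> x2 <= p + r -> q - r <= y <= q + r -> y != q ->
    segcont (fun x => f (x +i* y)) x1 x2.
  move=> h1 h2 hy yq; apply: (@ccont_hseg _ (csq (p +i* q) r)) => x hx.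
    by apply: cf; [split => /=; lra|exact: ne2].
  by split => /=; lra.
have V x (y1 y2 : R) : q - r <= y1 -> y2 <= q + r -> p - r <= x <= p + r -> x != p ->
    segcont (fun y => f (x +i* y)) y1 y2.
  move=> h1 h2 hx xp; apply: (@ccont_vseg _ (csq (p +i* q) r)) => y hy.
    by apply: cf; [split => /=; lra|exact: ne1].
  by split => /=; lra.
have G (u v y1 y2 : R) : p - r <= u <= v -> v <= p + r -> q - r <= y1 <= y2 ->
    y2 <= q + r -> (v < p \/ p < u) \/ (y2 < q \/ q < y1) -> bint f u v y1 y2 = 0.
  move=> h1 h2 h3 h4 h5; apply: goursat; [lra|lra|].
  move=> z [z1 z2].
  have zr : csq (p +i* q) r z by split => /=; lra.
  have [|l dl] := df z zr.
    case: z z1 z2 {zr} => x y /= z1 z2.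
    by case: h5 => h5; [apply: ne1|apply: ne2]; case: h5 => h5; rewrite neq_lt; lra.
  exists l; apply: cdiff_sub dl => t [t1 t2]; split => /=; lra.
rewrite (@bint_splitx _ _ _ (p - s)); [| lra | |]; first last.
- by apply: H; rewrite ?lexx //; first lra; rewrite gt_eqF //; lra.
- by apply: H; rewrite ?lexx //; first lra; rewrite lt_eqF //; lra.
rewrite (@bint_splitx _ _ (p - s) (p + s)); [| lra | |]; first last.
- by apply: H; rewrite ?lexx //; try lra; rewrite gt_eqF //; lra.
- by apply: H; rewrite ?lexx //; try lra; rewrite lt_eqF //; lra.
rewrite (G (p - r) (p - s)); [|lra..|by left; left; lra].
rewrite (G (p + s) (p + r)); [|lra..|by left; right; lra].
rewrite (@bint_splity _ _ (p - s) (p + s) _ (q - s)); [| lra | |]; first last.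
- by apply: V; rewrite ?lexx //; try lra; rewrite gt_eqF //; lra.
- by apply: V; rewrite ?lexx //; try lra; rewrite lt_eqF //; lra.
rewrite (@bint_splity _ _ (p - s) (p + s) (q - s) (q + s)); [| lra | |]; first last.
- by apply: V; rewrite ?lexx //; try lra; rewrite gt_eqF //; lra.
- by apply: V; rewrite ?lexx //; try lra; rewrite lt_eqF //; lra.
rewrite (G (p - s) _ (q - r) (q - s)); [|lra..|by right; left; lra].
rewrite (G (p - s) _ (q + s) (q + r)); [|lra..|by right; right; lra].
by rewrite !add0r !addr0.
Qed.

Lemma csq_bd_neq a r z : 0 < r -> csq_bd a r z -> z != a.
Proof.
move=> r0 /(csq_bd_ge (ltW r0)) zr; rewrite -subr_eq0 -cmod_gt0.
exact: lt_le_trans zr.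
Qed.

Lemma csq_bd_bound f a r M : 0 < r ->
  (forall z, csq_bd a r z -> ccont (csq a r) f z) ->
  (forall z, csq_bd a r z -> cmod (f z) <= M) -> cmod (bsq f a r) <= 16 * M * r.
Proof.
move=> r0 cf fM.
have := @bint_bound _ f (complex.Re a - r) (complex.Re a + r)
    (complex.Im a - r) (complex.Im a + r) M ltac:(lra) ltac:(lra).
have -> : 4 * M * (complex.Re a + r - (complex.Re a - r) +
    (complex.Im a + r - (complex.Im a - r))) = 16 * M * r by ring.
apply; last by move=> z zr zb; apply: fM; split.
apply: (csq_bdcont (ltW r0) cf); by move=> z [].
Qed.

Lemma ccont_inv_sub (D : set C) a z : z != a -> ccont D (fun u => (u - a)^-1) z.
Proof.
move=> za; apply: ccontV; first by rewrite subr_eq0.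
by apply: ccontD; [exact: ccont_id|exact: ccont_cst].
Qed.

Lemma cdiff_sub_cst (D : set C) a z : cdiff D (fun u => u - a) z 1.
Proof.
by rewrite -[1]addr0; apply: cdiffD; [exact: cdiff_id|exact: cdiff_cst].
Qed.

(** Cauchy's formula: subtracting g a makes the integrand o(1/|z-a|), so that its
    integral over small squares vanishes in the limit. *)
Lemma cauchy_center g a r : 0 < r -> ccont (csq a r) g a ->
  (forall z, csq a r z -> z != a -> exists l, cdiff (csq a r) g z l) ->
  bsq (fun z => g z * (z - a)^-1) a r = g a * bsq (fun z => (z - a)^-1) a r.
Proof.
move=> r0 ca dg.
pose h z := (g z - g a) * (z - a)^-1.
have dh z : csq a r z -> z != a -> exists l, cdiff (csq a r) h z l.
  move=> zr za; have [l dl] := dg z zr za; eexists; apply: cdiffM.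
    by apply: cdiffD; [exact: dl|exact: cdiff_cst].
  by apply: cdiffV; [rewrite subr_eq0|exact: cdiff_sub_cst].
have h0 : bsq h a r = 0.
  apply/eqP; rewrite -cmod_eq0 eq_le cmod_ge0 andbT; apply/ler_addgt0Pr => e e0.
  rewrite add0r; have e16 : 0 < e / 16 by rewrite divr_gt0.
  have [k k0 kP] := ca _ e16.
  pose s := Num.min r (k / 4).
  have s0 : 0 < s by rewrite lt_min r0 divr_gt0.
  have sr : s <= r by rewrite ge_min lexx.
  rewrite (@bsq_shrink h a r s) ?s0 //.
  have -> : e = 16 * (e / 16 / s) * s by field; rewrite gt_eqF.
  apply: csq_bd_bound => // z zs; have zr := csq_sub sr zs.1.
    have [l dl] := dh z zr (csq_bd_neq s0 zs).
    by apply: ccont_sub (cdiff_ccont dl); exact: csq_sub.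
  have zs' := csq_bd_ge (ltW s0) zs.
  rewrite cmodM cmodV; apply: ler_pM; rewrite ?cmod_ge0 ?invr_ge0 ?cmod_ge0 //.
    apply: kP => //; apply: le_lt_trans (csq_le zs.1) _.
    have : s <= k / 4 by rewrite ge_min lexx orbT.
    lra.
  by rewrite lef_pV2 // posrE //; exact: lt_le_trans zs'.
have bI : bdcont (fun z => (z - a)^-1) (complex.Re a - r) (complex.Re a + r)
    (complex.Im a - r) (complex.Im a + r).
  apply: (@csq_bdcont setT) => //; first exact: ltW.
  by move=> z zr; apply: ccont_inv_sub; exact: csq_bd_neq zr.
have bh : bdcont h (complex.Re a - r) (complex.Re a + r)
    (complex.Im a - r) (complex.Im a + r).
  apply: (@csq_bdcont (csq a r)); [exact: ltW| |by move=> z []].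
  move=> z zr; have [l] := dh z zr.1 (csq_bd_neq r0 zr); exact: cdiff_ccont.
have bI2 : bdcont (fun z => g a * (z - a)^-1) (complex.Re a - r) (complex.Re a + r)
    (complex.Im a - r) (complex.Im a + r).
  by case: bI => i1 i2 i3 i4; split; apply: segcontZ.
rewrite /bsq -bintZ // -[RHS]add0r -h0 /bsq -bintD //; apply: bint_ext; try lra.
by move=> z _ _; rewrite /h; ring.
Qed.

Lemma ReV z : complex.Re z^-1 = complex.Re z / (complex.Re z ^+ 2 + complex.Im z ^+ 2).
Proof. by case: z. Qed.

Lemma ImV z : complex.Im z^-1 = - complex.Im z / (complex.Re z ^+ 2 + complex.Im z ^+ 2).
Proof. by case: z => x y; rewrite /= mulNr. Qed.

Lemma rint_ge_cst (f : R -> R) (m u v : R) : u <= v -> segcontR f u v ->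
  (forall x, u <= x <= v -> m <= f x) -> m * (v - u) <= rint f u v.
Proof.
move=> uv cf mf; rewrite -rint_cst //; apply: rint_le => //.
exact: segcontR_cst.
Qed.

Lemma rint_le_cst (f : R -> R) (m u v : R) : u <= v -> segcontR f u v ->
  (forall x, u <= x <= v -> f x <= m) -> rint f u v <= m * (v - u).
Proof.
move=> uv cf mf; rewrite -rint_cst //; apply: rint_le => //.
exact: segcontR_cst.
Qed.

(** The exact value is 2 pi i; each side contributes at least 1 to the imaginary
    part. *)
Lemma winding_integral_ge a r : 0 < r -> 4 <= cmod (bsq (fun z => (z - a)^-1) a r).
Proof.
move=> r0; apply: le_trans (Im_le_cmod _); apply: le_trans (ler_norm _).
have [b1 b2 b3 b4] : bdcont (fun z => (z - a)^-1) (complex.Re a - r)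
    (complex.Re a + r) (complex.Im a - r) (complex.Im a + r).
  apply: (@csq_bdcont setT) => //; first exact: ltW.
  by move=> z zr; apply: ccont_inv_sub; exact: csq_bd_neq zr.
case: a b1 b2 b3 b4 => p q b1 b2 b3 b4; rewrite /= in b1 b2 b3 b4.
have r2 (t : R) : - r <= t <= r -> 0 < r ^+ 2 + t ^+ 2 <= 2 * r ^+ 2.
  move=> tr; have tr2 : t ^+ 2 <= r ^+ 2.
    by rewrite -[t ^+ 2]real_normK ?num_real // ler_sqr ?nnegrE ?(ltW r0) // ler_norml.
  by apply/andP; split; [rewrite ltr_wpDr ?sqr_ge0 ?exprn_gt0|lra].
have K (t : R) : - r <= t <= r -> (2 * r)^-1 <= r / (r ^+ 2 + t ^+ 2).
  move=> /r2 /andP[t0 t2]; rewrite ler_pdivlMr // mulrC ler_pdivrMr ?mulr_gt0 //; lra.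
have K' (t : R) : - r <= t <= r -> (- r) / (r ^+ 2 + t ^+ 2) <= - (2 * r)^-1.
  by move=> /K; rewrite mulNr lerN2.
have one : (2 * r)^-1 * (p + r - (p - r)) = 1 by field; rewrite gt_eqF.
have one' : (2 * r)^-1 * (q + r - (q - r)) = 1 by field; rewrite gt_eqF.
have rr : (- r) ^+ 2 = r ^+ 2 by ring.
have h1 : 1 <= complex.Im (hseg (fun z => (z - (p +i* q))^-1) (p - r) (p + r) (q - r)).
  rewrite -one; apply: rint_ge_cst; [lra|exact: segcont_Im|] => x xr.
  rewrite ImV /=; have -> : q - r - q = - r by ring.
  by rewrite opprK rr [_ + r ^+ 2]addrC; apply: K; lra.
have h2 : complex.Im (hseg (fun z => (z - (p +i* q))^-1) (p - r) (p + r) (q + r)) <= -1.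
  rewrite -one -mulNr; apply: rint_le_cst; [lra|exact: segcont_Im|] => x xr.
  rewrite ImV /=; have -> : q + r - q = r by ring.
  by rewrite [_ + r ^+ 2]addrC; apply: K'; lra.
have h3 : 1 <= complex.Re (vseg (fun z => (z - (p +i* q))^-1) (q - r) (q + r) (p + r)).
  rewrite -one'; apply: rint_ge_cst; [lra|exact: segcont_Re|] => x xr.
  rewrite ReV /=; have -> : p + r - p = r by ring.
  by apply: K; lra.
have h4 : complex.Re (vseg (fun z => (z - (p +i* q))^-1) (q - r) (q + r) (p - r)) <= -1.
  rewrite -one' -mulNr; apply: rint_le_cst; [lra|exact: segcont_Re|] => x xr.
  rewrite ReV /=; have -> : p - r - p = - r by ring.
  by rewrite rr; apply: K'; lra.
have -> : bsq (fun z => (z - (p +i* q))^-1) (p +i* q) r =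
  hseg (fun z => (z - (p +i* q))^-1) (p - r) (p + r) (q - r) -
  hseg (fun z => (z - (p +i* q))^-1) (p - r) (p + r) (q + r) +
  'i%C * (vseg (fun z => (z - (p +i* q))^-1) (q - r) (q + r) (p + r) -
          vseg (fun z => (z - (p +i* q))^-1) (q - r) (q + r) (p - r)) by [].
move: h1 h2 h3 h4; case: (hseg _ _ _ (q - r)) => ? ?; case: (hseg _ _ _ _) => ? ?.
case: (vseg _ _ _ (p + r)) => ? ?; case: (vseg _ _ _ _) => ? ? /= h1 h2 h3 h4; lra.
Qed.

Lemma cauchy_center_le g a r : 0 < r -> ccont (csq a r) g a ->
  (forall z, csq a r z -> z != a -> exists l, cdiff (csq a r) g z l) ->
  4 * cmod (g a) <= cmod (bsq (fun z => g z * (z - a)^-1) a r).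
Proof.
move=> r0 ca dg; rewrite cauchy_center // cmodM mulrC ler_wpM2l ?cmod_ge0 //.
exact: winding_integral_ge.
Qed.

Lemma ccont_quotient g a r : 0 < r ->
  (forall z, csq a r z -> z != a -> exists l, cdiff (csq a r) g z l) ->
  forall z, csq_bd a r z -> ccont (csq a r) (fun z => g z * (z - a)^-1) z.
Proof.
move=> r0 dg z zr; have za := csq_bd_neq r0 zr.
apply: ccontM; last exact: ccont_inv_sub.
have [l] := dg z zr.1 za; exact: cdiff_ccont.
Qed.

(** Cauchy's formula in the role of the maximum principle: the factor 4 disappears in
    the arguments below, where powers of a function are estimated or where only a
    multiple of the bound matters. *)
Lemma cauchy_sup g a r M : 0 < r -> ccont (csq a r) g a ->
  (forall z, csq a r z -> z != a -> exists l, cdiff (csq a r) g z l) ->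
  (forall z, csq_bd a r z -> cmod (g z) <= M) -> cmod (g a) <= 4 * M.
Proof.
move=> r0 ca dg gM; rewrite -(@ler_pM2l _ 4) //.
apply: (le_trans (cauchy_center_le r0 ca dg)).
have -> : 4 * (4 * M) = 16 * (M / r) * r by field; rewrite gt_eqF.
apply: csq_bd_bound => //; first exact: ccont_quotient.
move=> z zr; have zs := csq_bd_ge (ltW r0) zr.
rewrite cmodM cmodV; apply: ler_pM; rewrite ?cmod_ge0 ?invr_ge0 ?cmod_ge0 ?gM //.
by rewrite lef_pV2 // posrE //; exact: lt_le_trans zs.
Qed.

(** The values on the four sides are kept under the integral sign here, to be averaged
    over the size of the square. *)
Lemma cauchy_mean g a r : 0 < r ->
  (forall z, csq a r z -> exists l, cdiff (csq a r) g z l) ->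
  cmod (g a) <= r^-1 *
   (rint (fun x => cmod (g (x +i* (complex.Im a - r)))) (complex.Re a - r) (complex.Re a + r) +
    rint (fun x => cmod (g (x +i* (complex.Im a + r)))) (complex.Re a - r) (complex.Re a + r) +
    rint (fun y => cmod (g ((complex.Re a - r) +i* y))) (complex.Im a - r) (complex.Im a + r) +
    rint (fun y => cmod (g ((complex.Re a + r) +i* y))) (complex.Im a - r) (complex.Im a + r)).
Proof.
move=> r0 dg.
have t1 x : complex.Re a - r <= x <= complex.Re a + r -> csq_bd a r (x +i* (complex.Im a - r)).
  by move=> xr; split; [split => /=; lra|right; left].
have t2 x : complex.Re a - r <= x <= complex.Re a + r -> csq_bd a r (x +i* (complex.Im a + r)).
  by move=> xr; split; [split => /=; lra|right; right].
have t3 y : complex.Im a - r <= y <= complex.Im a + r -> csq_bd a r ((complex.Re a - r) +i* y).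
  by move=> yr; split; [split => /=; lra|left; left].
have t4 y : complex.Im a - r <= y <= complex.Im a + r -> csq_bd a r ((complex.Re a + r) +i* y).
  by move=> yr; split; [split => /=; lra|left; right].
have ca : ccont (csq a r) g a.
  by have [l] := dg a (csq_center a (ltW r0)); exact: cdiff_ccont.
have dg' z : csq a r z -> z != a -> exists l, cdiff (csq a r) g z l.
  by move=> zr _; apply: dg.
have h := cauchy_center_le r0 ca dg'.
have [q1 q2 q3 q4] := @csq_bdcont _ _ a r (ltW r0) (ccont_quotient r0 dg') (fun z => @proj1 _ _).
have [g1 g2 g3 g4] : bdcont g (complex.Re a - r) (complex.Re a + r)
    (complex.Im a - r) (complex.Im a + r).
  apply: (@csq_bdcont (csq a r)); [exact: ltW| |by move=> z []].
  by move=> z [zr _]; have [l] := dg z zr; exact: cdiff_ccont.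
have side (t : R -> C) (u v : R) : segcont (fun x => g (t x) * (t x - a)^-1) u v ->
    segcont (fun x => g (t x)) u v -> (forall x, u <= x <= v -> csq_bd a r (t x)) ->
    cmod (cint (fun x => g (t x) * (t x - a)^-1) u v) <=
    2 * r^-1 * rint (fun x => cmod (g (t x))) u v.
  move=> c1 c2 tb; apply: (le_trans (cint_le c1)); rewrite -mulrA ler_pM2l //.
  rewrite -RintegralZl //; last by apply: segcontR_integrable; exact: segcont_cmod.
  apply: rint_le; first exact: segcont_cmod.
    move=> x xuv e e0; have [k k0 kP] := segcont_cmod (segcontZ (r^-1)%:C c2) xuv e0.
    exists k => // y yuv yk; have := kP y yuv yk.
    have rn : `|r^-1| = r^-1 by rewrite ger0_norm // invr_ge0 ltW.
    by rewrite !cmodM cmodR rn.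
  move=> x xuv; have xb := tb x xuv; rewrite cmodM cmodV mulrC ler_wpM2r ?cmod_ge0 //.
  have xr := csq_bd_ge (ltW r0) xb; rewrite lef_pV2 // posrE //.
  exact: lt_le_trans xr.
have s1 := side _ _ _ q1 g1 t1; have s2 := side _ _ _ q2 g2 t2.
have s3 := side _ _ _ q3 g3 t3; have s4 := side _ _ _ q4 g4 t4.
rewrite -(@ler_pM2l _ 4) //; apply: (le_trans h).
rewrite /bsq /bint; apply: (le_trans (cmodD _ _)); rewrite cmodM.
have -> : cmod ('i%C : C) = 1 by rewrite /= expr0n expr1n add0r sqrtr1.
rewrite mul1r.
have B1 := cmodB (hseg (fun z => g z * (z - a)^-1) (complex.Re a - r) (complex.Re a + r) (complex.Im a - r)) (hseg (fun z => g z * (z - a)^-1) (complex.Re a - r) (complex.Re a + r) (complex.Im a + r)).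
have B2 := cmodB (vseg (fun z => g z * (z - a)^-1) (complex.Im a - r) (complex.Im a + r) (complex.Re a + r)) (vseg (fun z => g z * (z - a)^-1) (complex.Im a - r) (complex.Im a + r) (complex.Re a - r)).
have pos (t : R -> C) (u v : R) : 0 <= rint (fun x => cmod (g (t x))) u v.
  by apply: Rintegral_ge0 => x _; exact: cmod_ge0.
apply: (le_trans (lerD B1 B2)).
rewrite /hseg /vseg; apply: (le_trans (lerD (lerD s1 s2) (lerD s4 s3))).
set A1 := rint _ _ _; set A2 := rint _ _ _; set A3 := rint _ _ _; set A4 := rint _ _ _.
have -> : 2 / r * A1 + 2 / r * A2 + (2 / r * A3 + 2 / r * A4) =
   2 * (r^-1 * (A1 + A2 + A4 + A3)) by ring.
apply: ler_wpM2r; last by rewrite ler_nat.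
by rewrite mulr_ge0 ?invr_ge0 ?(ltW r0) // !addr_ge0 // pos.
Qed.

Definition holat f z := exists l, cdiff setT f z l.

Lemma holat_ccont D f z : holat f z -> ccont D f z.
Proof. by move=> [l /cdiff_ccont]; apply: ccont_sub. Qed.

Lemma holat_csq a r f : (forall z, csq a r z -> holat f z) ->
  forall z, csq a r z -> exists l, cdiff (csq a r) f z l.
Proof. by move=> df z /df[l dl]; exists l; apply: cdiff_sub dl. Qed.

(** The divided difference at a is differentiable off a and continuous at a, where its
    value is the derivative. *)
Lemma cauchy_estimate f a l r M : 0 < r -> (forall z, csq a r z -> holat f z) ->
  (forall z, csq a r z -> cmod (f z) <= M) -> cdiff setT f a l ->
  cmod l <= 8 * M / r.
Proof.
move=> r0 df fM dfa.
have ar := csq_center a (ltW r0).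
have /cdiffP[h [fh ch <-]] := dfa.
have -> : 8 * M / r = 4 * (2 * M / r) by ring.
have hE z : z != a -> h z = (f z - f a) * (z - a)^-1.
  move=> za; rewrite (fh z) addrAC subrr add0r mulfK //; by rewrite subr_eq0.
apply: (@cauchy_sup h a r) => //; first exact: ccont_sub ch.
  move=> z zr za.
  have [d dP] : exists d, cdiff (csq a r) (fun z => (f z - f a) * (z - a)^-1) z d.
    have [m dm] := holat_csq df zr; eexists; apply: cdiffM.
      by apply: cdiffD; [exact: dm|exact: cdiff_cst].
    by apply: cdiffV; [rewrite subr_eq0|exact: cdiff_sub_cst].
  exists d; apply: (@cdiff_near _ _ _ _ _ _ (cmod (z - a))) dP => //.
    by rewrite cmod_gt0 subr_eq0.
  move=> w _ wz; apply: hE; apply/eqP => wa; move: wz.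
  by rewrite wa cmodBC ltxx.
move=> z zr; have zs := csq_bd_ge (ltW r0) zr; have za := csq_bd_neq r0 zr.
rewrite hE // cmodM cmodV; apply: ler_pM; rewrite ?cmod_ge0 ?invr_ge0 ?cmod_ge0 //.
  apply: (le_trans (cmodB _ _)); rewrite mulr2n mulrDl mul1r.
  by apply: lerD; apply: fM => //; exact: zr.1.
by rewrite lef_pV2 // posrE //; exact: lt_le_trans zs.
Qed.

End Cauchy.

(** * Analytic functions on the half-plane: uniqueness and the maximum principle *)

Section HalfPlane.
Variable R : realType.
Local Notation C := R[i].
Implicit Types (f g : C -> C) (a z w : C) (r s M : R).

Lemma cont_pair (D : set C) f (p : R * R) : ccont D f (p.1 +i* p.2) ->
  forall e : R, 0 < e -> \forall q \near p, D (q.1 +i* q.2) ->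
    cmod (f (q.1 +i* q.2) - f (p.1 +i* p.2)) <= e.
Proof.
move=> cf e e0; have [k k0 kP] := cf e e0.
have k2 : 0 < k / 2 by rewrite divr_gt0.
exists (ball p.1 (k / 2), ball p.2 (k / 2)) => /=.
  by split; apply: nbhsx_ballx.
move=> q [/= q1 q2] Dq; apply: kP => //.
apply: (le_lt_trans (cmod_le_ReIm _)); rewrite /= distrC [X in _ + X]distrC.
by rewrite /ball /= in q1 q2; lra.
Qed.

Lemma ccont_bounded f a r : 0 <= r ->
  (forall z, csq a r z -> ccont (csq a r) f z) ->
  exists2 M, 0 <= M & forall z, csq a r z -> cmod (f z) <= M.
Proof.
move=> r0 cf.
pose K : set (R * R) := `[complex.Re a - r, complex.Re a + r] `*`
  `[complex.Im a - r, complex.Im a + r].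
pose F (p : R * R) := cmod (f (p.1 +i* p.2)).
have Kc : compact K by apply: compact_setX; exact: segment_compact.
have KE (p : R * R) : K p -> csq a r (p.1 +i* p.2).
  by rewrite /K /= !in_itv.
have Fc : {within K, continuous F}.
  apply/subspace_continuousP => p Kp; apply/cvgrPdist_le => e e0.
  have := cont_pair (cf _ (KE _ Kp)) e0.
  apply: filterS => q qP Kq; apply: le_trans (qP (KE _ Kq)).
  rewrite ler_norml cmodBC cmodB_ge andbT.
  by rewrite cmodBC lerNl opprB cmodB_ge.
have := compact_bounded (continuous_compact Fc Kc).
move=> [M [_ MP]]; exists (`|M| + 1); first by rewrite addr_ge0.
move=> z zr; have /= := MP (`|M| + 1) _ (cmod (f z)).
rewrite (@ger0_norm _ (cmod (f z))) ?cmod_ge0 //; apply.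
  by apply: (le_lt_trans (ler_norm M)); rewrite ltrDl.
exists (complex.Re z, complex.Im z); last by rewrite /F /=; case: (z).
by rewrite /K /= !in_itv.
Qed.

Lemma holatX f n z : holat f z -> holat (fun w => f w ^+ n) z.
Proof. by move=> [l dl]; eexists; apply: cdiffX dl. Qed.

Lemma holatM f g z : holat f z -> holat g z -> holat (fun w => f w * g w) z.
Proof. by move=> [l dl] [m dm]; eexists; apply: cdiffM dl dm. Qed.

Lemma holatD f g z : holat f z -> holat g z -> holat (fun w => f w + g w) z.
Proof. by move=> [l dl] [m dm]; eexists; apply: cdiffD dl dm. Qed.

Lemma holatV f z : f z != 0 -> holat f z -> holat (fun w => (f w)^-1) z.
Proof. by move=> fz [l dl]; eexists; apply: cdiffV fz dl. Qed.

Lemma holat_cst (c : C) z : holat (fun=> c) z.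
Proof. by exists 0; exact: cdiff_cst. Qed.

Lemma holat_id z : holat id z.
Proof. by exists 1; exact: cdiff_id. Qed.

Lemma holat_near f g z (r : R) : 0 < r ->
  (forall w, cmod (w - z) < r -> g w = f w) -> holat f z -> holat g z.
Proof.
move=> r0 fg [l dl]; exists l; apply: cdiff_near r0 _ _ dl => //.
by move=> w _; exact: fg.
Qed.

Lemma holat_comp f g z : holat f z -> holat g (f z) -> holat (fun w => g (f w)) z.
Proof. by move=> [l dl] [m dm]; eexists; apply: cdiff_comp dl dm _. Qed.

Lemma geo_small (q B : R) : 0 <= q < 1 -> 0 < B -> exists n : nat, q ^+ n < B.
Proof.
move=> /andP[q0 q1] B0; have /cvgrPdist_lt/(_ B B0) : (fun n => q ^+ n) @ \oo --> (0 : R).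
  by apply: cvg_expr; rewrite ger0_norm.
move=> [n _ nP]; exists n; have := nP n (leqnn n).
by rewrite /= sub0r normrN ger0_norm // exprn_ge0.
Qed.

(** A function that vanishes near c may be divided by any power of z - c without
    losing differentiability; the maximum principle for these quotients forces
    f to vanish in a neighbourhood of fixed size. *)
Lemma zero_near f a c r d : 0 < r -> 0 < d ->
  (forall z, csq a r z -> holat f z) -> cmod (a - c) <= r / 4 ->
  (forall z, cmod (z - c) < d -> f z = 0) -> f a = 0.
Proof.
move=> r0 d0 df ac fc; have [->|nac] := eqVneq a c.
  by apply: fc; rewrite subrr cmod0.
have [M M0 fM] := ccont_bounded (ltW r0) (fun z zr => holat_ccont _ (df z zr)).
pose F k z := f z * ((z - c)^-1) ^+ k.
have dF k z : csq a r z -> holat (F k) z.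
  move=> zr; have [zc|zc] := ltP (cmod (z - c)) d.
    apply: (@holat_near (fun=> 0) _ _ (d - cmod (z - c))); last exact: holat_cst.
      by rewrite subr_gt0.
    move=> w wz; rewrite /F fc ?mul0r //.
    by have := cmod_triangle w z c; lra.
  apply: holatM; first exact: df.
  apply: holatX; apply: holatV.
    by rewrite -cmod_gt0; exact: lt_le_trans zc.
  by apply: holatD; [exact: holat_id|exact: holat_cst].
have r34 : 0 < 3 * r / 4 by rewrite !mulr_gt0.
have Fa k : cmod (F k a) <= 4 * (M * ((3 * r / 4)^-1) ^+ k).
  have dFk := holat_csq (dF k).
  apply: (@cauchy_sup _ _ a r) => //.
  - by apply: holat_ccont; apply: dF; apply: csq_center; exact: ltW.
  - by move=> z zr _; exact: dFk.
  move=> z zr; rewrite /F cmodM cmodX cmodV.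
  apply: ler_pM; rewrite ?cmod_ge0 ?exprn_ge0 ?invr_ge0 ?cmod_ge0 ?fM //; first exact: zr.1.
  have zc : 3 * r / 4 <= cmod (z - c).
    by have := csq_bd_ge (ltW r0) zr; have := cmod_triangle z c a; rewrite [cmod (c - a)]cmodBC; lra.
  apply: lerXn2r; rewrite ?nnegrE ?invr_ge0 ?cmod_ge0 ?(ltW r34) //.
  by rewrite lef_pV2 // posrE //; exact: lt_le_trans zc.
apply: ComplexField.Normc.eq0_normc; apply/eqP.
rewrite eq_le cmod_ge0 andbT leNgt; apply/negP => fa0.
have [||k kP] := @geo_small (3^-1 : R) (cmod (f a) / (4 * M + 1)).
- by rewrite invr_ge0 ler0n /= invf_lt1 // ltr1n.
- by rewrite divr_gt0 // ltr_wpDl // mulr_ge0.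
have ac0 : 0 < cmod (a - c) by rewrite cmod_gt0 subr_eq0.
have := Fa k; rewrite /F cmodM cmodX cmodV.
rewrite [(cmod (a - c))^-1 ^+ k]exprVn ler_pdivrMr ?exprn_gt0 //.
apply/negP; rewrite -ltNge.
have -> : 4 * (M * (3 * r / 4)^-1 ^+ k) * cmod (a - c) ^+ k =
   4 * M * (cmod (a - c) / (3 * r / 4)) ^+ k.
  by rewrite exprMn !exprVn; ring.
apply: (@le_lt_trans _ _ (4 * M * 3^-1 ^+ k)).
  apply: ler_wpM2l; first by rewrite mulr_ge0.
  have q3 : cmod (a - c) / (3 * r / 4) <= 3^-1 by rewrite ler_pdivrMr //; lra.
  apply: lerXn2r => //; rewrite nnegrE ?invr_ge0 //.
  exact: divr_ge0 (cmod_ge0 _) (ltW r34).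
rewrite ltr_pdivlMr ?ltr_wpDl ?mulr_ge0 // in kP.
apply: le_lt_trans kP; rewrite [leRHS]mulrC ler_wpM2r ?exprn_ge0 ?invr_ge0 //.
by rewrite lerDl.
Qed.

Definition hp : set C := [set z | 0 < complex.Re z].
Definition hol f := forall z, hp z -> holat f z.

Lemma csq_hp a r : r < complex.Re a -> csq a r `<=` hp.
Proof. by move=> ra z [z1 _]; rewrite /hp /=; lra. Qed.

Lemma hol_csq f a r : hol f -> r < complex.Re a -> forall z, csq a r z -> holat f z.
Proof. by move=> hf ra z /(csq_hp ra); exact: hf. Qed.

(** A property that spreads to discs of radius proportional to the distance to
    the boundary spreads to the whole half-plane. *)
Lemma hp_propagate (P : C -> Prop) (k : R) : 0 < k ->
  (forall a b, hp a -> hp b -> cmod (b - a) <= k * complex.Re a -> P a -> P b) ->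
  forall a b, hp a -> hp b -> P a -> P b.
Proof.
move=> k0 step a b ha hb Pa.
pose rho := Num.min (complex.Re a) (complex.Re b).
have rho0 : 0 < rho by rewrite lt_min ha hb.
have kr0 : 0 < k * rho by rewrite mulr_gt0.
have := archi_boundP (divr_ge0 (cmod_ge0 (b - a)) (ltW kr0)).
set n := Num.bound _ => nP.
have n0 : 0 < n%:R :> R.
  by apply: le_lt_trans nP; rewrite divr_ge0 ?cmod_ge0 ?ltW.
have nz : (n%:R : R) != 0 by rewrite gt_eqF.
pose pt (m : nat) : C := a + (m%:R / n%:R)%:C * (b - a).
have ptRe m : (m <= n)%N -> rho <= complex.Re (pt m).
  move=> mn; have t1 : m%:R / n%:R <= 1 :> R by rewrite ler_pdivrMr // mul1r ler_nat.
  have t0 : 0 <= m%:R / n%:R :> R by rewrite divr_ge0.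
  have -> : complex.Re (pt m) = (1 - m%:R / n%:R) * complex.Re a + m%:R / n%:R * complex.Re b.
    by rewrite /pt; case: (a) (b) => [? ?] [? ?] /=; ring.
  have ra : rho <= complex.Re a by rewrite ge_min lexx.
  have rb : rho <= complex.Re b by rewrite ge_min lexx orbT.
  nra.
suff H m : (m <= n)%N -> P (pt m).
  have -> : b = pt n by rewrite /pt divff // mul1r addrC subrK.
  exact: H.
elim: m => [|m IH] mn; first by rewrite /pt mul0r mul0r addr0.
apply: (step (pt m)); last by apply: IH; exact: ltnW.
- by apply: lt_le_trans (ptRe m (ltnW mn)).
- by apply: lt_le_trans (ptRe m.+1 mn).
have -> : pt m.+1 - pt m = (n%:R^-1)%:C * (b - a).
  rewrite /pt -natr1; case: (a) (b) => [? ?] [? ?]; apply: complex_eq => /=; ring.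
rewrite cmodM cmodR ger0_norm ?invr_ge0 //.
apply: (@le_trans _ _ (k * rho)).
  by rewrite mulrC ler_pdivrMr // mulrC -ler_pdivrMr // ltW.
by rewrite ler_pM2l //; apply: ptRe; exact: ltnW.
Qed.

(** The radius of a disc of zeros may be replaced by a fixed proportion of the distance
    to the boundary, and so the zeros propagate. *)
Lemma identity_theorem f a d : hol f -> hp a -> 0 < d ->
  (forall z, cmod (z - a) < d -> f z = 0) -> forall z, hp z -> f z = 0.
Proof.
move=> hf ha d0 fa z hz.
suff [e e0 eP] : exists2 e : R, 0 < e & forall w, cmod (w - z) < e -> f w = 0.
  by apply: eP; rewrite subrr cmod0.
apply: (@hp_propagate (fun z => exists2 e : R, 0 < e &
  forall w, cmod (w - z) < e -> f w = 0) (20^-1) _ _ a) => //; last by exists d.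
move=> u v hu hv uv [e e0 eP]; exists (complex.Re u / 20).
  by rewrite divr_gt0.
rewrite /hp /= in hu hv.
move=> w wv; have wu : cmod (w - u) <= complex.Re u / 10.
  by have := cmod_triangle w v u; lra.
apply: (@zero_near f w u (complex.Re u / 2) e) => //.
- by rewrite divr_gt0.
- apply: hol_csq => //; have := le_trans (Re_le_cmod _) wu.
  by rewrite ReD ReN ler_norml; lra.
- by lra.
Qed.

(** If |m| = 1 at a and m b differs from m a, composing m with a disc automorphism
    that vanishes at m b contradicts Schwarz's lemma at a; squaring the composition
    keeps the quotient by z - b differentiable at b. *)
Lemma modulus1_near m a b r : 0 < r -> (forall z, csq a r z -> holat m z) ->
  (forall z, csq a r z -> cmod (m z) <= 1) -> cmod (m a) = 1 ->
  cmod (b - a) <= r / 10 -> m b = m a.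
Proof.
move=> r0 dm m1 ma ba; have [->//|nba] := eqVneq b a.
apply/eqP; apply: contraT => mba.
have br : csq a r b by apply: ball_csq; lra.
pose p z := 1 - (m a)^-1 * m z.
have ma0 : m a != 0 by rewrite -cmod_gt0 ma.
pose beta := p b.
have b0 : beta != 0.
  rewrite /beta /p; apply: contra mba; rewrite subr_eq0 => /eqP E.
  by apply/eqP; rewrite -[RHS]mulr1 E mulrA divff // mul1r.
have Rep z : csq a r z -> cmod (1 - p z) <= 1.
  move=> zr; rewrite /p opprB addrC subrK cmodM cmodV ma invr1 mul1r; exact: m1.
have dp z : csq a r z -> holat p z.
  move=> zr; apply: holatD; first exact: holat_cst.
  have -> : (fun w => - ((m a)^-1 * m w)) = (fun w => (- (m a)^-1) * m w).
    by apply/funext => w; rewrite mulNr.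
  by apply: holatM; [exact: holat_cst|exact: dm].
have pa : p a = 0 by rewrite /p mulVf // subrr.
clearbody p.
have Re_ge z : csq a r z -> p z != 0 -> 0 < complex.Re (p z).
  move=> zr pz; have := Rep z zr; rewrite -(@ler_pXn2r _ 2) ?nnegrE ?cmod_ge0 //.
  rewrite cmod_sqr expr1n ReD ImD ReN ImN.
  have -> : complex.Re (1 : C) = 1 by [].
  have -> : complex.Im (1 : C) = 0 by [].
  have : 0 < cmod (p z) ^+ 2 by rewrite exprn_gt0 // cmod_gt0.
  rewrite cmod_sqr; move: (complex.Re (p z)) (complex.Im (p z)) => x y; nra.
have Re_ge0 z : csq a r z -> 0 <= complex.Re (p z).
  move=> zr; have [->|/(Re_ge z zr)/ltW//] := eqVneq (p z) 0; by [].
have Rb := Re_ge b br b0.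
pose cb : C := complex.Re beta -i* complex.Im beta.
have den z : csq a r z -> p z + cb != 0.
  move=> zr; apply/eqP => /(congr1 (@complex.Re _)); rewrite ReD.
  have -> : complex.Re cb = complex.Re beta by [].
  have -> : complex.Re (0 : C) = 0 by [].
  rewrite -/beta in Rb; have h1 := Re_ge0 z zr.
  by move=> /eqP; rewrite gt_eqF // ltr_wpDl.
pose k z := (p z - beta) * (p z + cb)^-1.
have k1 z : csq a r z -> cmod (k z) <= 1.
  move=> zr; rewrite cmodM cmodV ler_pdivrMr ?cmod_gt0 ?den // mul1r.
  rewrite -(@ler_pXn2r _ 2) ?nnegrE ?cmod_ge0 // !cmod_sqr !ReD !ImD ReN ImN.
  have -> : complex.Re cb = complex.Re beta by [].
  have -> : complex.Im cb = - complex.Im beta by [].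
  rewrite -/beta in Rb; have := mulr_ge0 (Re_ge0 z zr) (ltW Rb).
  move: (complex.Re (p z)) (complex.Im (p z)) (complex.Re beta) (complex.Im beta).
  by move=> x y u v; nra.
have kb : k b = 0 by rewrite /k subrr mul0r.
have ka : cmod (k a) = 1.
  rewrite /k pa sub0r add0r cmodM cmodV cmodN.
  have -> : cmod cb = cmod beta.
    apply/eqP; rewrite -(@eqrXn2 _ 2) ?cmod_ge0 // !cmod_sqr /=; apply/eqP; ring.
  by rewrite divff // cmod_eq0.
have dk z : csq a r z -> holat k z.
  move=> zr; apply: holatM; first by apply: holatD; [exact: dp|exact: holat_cst].
  apply: holatV; first exact: den.
  by apply: holatD; [exact: dp|exact: holat_cst].
(* The divided difference of k^2 at b is h^2 (z - b), where k = h (z - b). *)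
pose g z := k z ^+ 2 * (z - b)^-1.
have dg z : csq a r z -> holat g z.
  move=> zr; have [zb|zb] := eqVneq z b; last first.
    apply: holatM; first by apply: holatX; exact: dk.
    apply: holatV; first by rewrite subr_eq0.
    by apply: holatD; [exact: holat_id|exact: holat_cst].
  rewrite zb; have [l /cdiffP[h [kh ch _]]] := dk b br.
  exists (h b ^+ 2); apply/cdiffP; exists (fun w => h w ^+ 2); split => //.
    move=> w; rewrite /g kb expr0n /= mul0r add0r (kh w) kb add0r exprMn.
    have [->|wb] := eqVneq w b; first by rewrite subrr !expr0n /= !(mulr0, mul0r).
    by rewrite expr2; field; rewrite subr_eq0.
  by apply: ccontM.
have : cmod (g a) <= 4 * (r - cmod (b - a))^-1.
  have dgk := holat_csq dg.
  apply: (@cauchy_sup _ g a r) => //.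
  - by apply: holat_ccont; apply: dg; apply: csq_center; exact: ltW.
  - by move=> z zr _; exact: dgk.
  move=> z zr; rewrite /g cmodM cmodX cmodV -[leRHS]mul1r.
  apply: ler_pM; rewrite ?exprn_ge0 ?invr_ge0 ?cmod_ge0 //.
    by rewrite exprn_ile1 ?cmod_ge0 ?k1 //; exact: zr.1.
  have := csq_bd_ge (ltW r0) zr; have := cmod_triangle z b a => h1 h2.
  by rewrite lef_pV2 ?posrE; lra.
rewrite /g cmodM cmodX ka expr1n mul1r cmodV [cmod (a - b)]cmodBC.
have ba0 : 0 < cmod (b - a) by rewrite cmod_gt0 subr_eq0.
rewrite -ler_pdivrMr ?invr_gt0 ?subr_gt0; last lra.
rewrite invrK ler_pdivrMl // mulrC => h; lra.
Qed.

Lemma modulus_lt1 m a : hol m -> (forall z, hp z -> cmod (m z) <= 1) ->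
  hp a -> cmod (m a) < 1 -> forall z, hp z -> cmod (m z) < 1.
Proof.
move=> hm m1 ha ma z hz; rewrite lt_neqAle m1 // andbT; apply/eqP => mz.
suff : cmod (m a) = 1 by move=> E; move: ma; rewrite E ltxx.
apply: (@hp_propagate (fun z => cmod (m z) = 1) (20^-1) _ _ z) => //.
move=> u v hu hv uv mu; rewrite (@modulus1_near m u v (complex.Re u / 2)) //.
- by rewrite divr_gt0.
- by apply: hol_csq => //; rewrite /hp /= in hu; lra.
- by move=> w wr; apply: m1; apply: csq_hp wr; rewrite /hp /= in hu; lra.
- by rewrite /hp /= in hu; lra.
Qed.

End HalfPlane.

(** * Uniform limits and the transport equation *)

Section Growth.
Variable R : realType.
Local Notation C := R[i].
Implicit Types (f : C -> C) (a z w : C).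

(** A mean value inequality for right derivatives: the times up to which it holds
    (with an error e) have a supremum, and this supremum cannot be less than T. *)
Lemma growth_bound (u : R -> C) (g : R -> R) (T : R) : 0 <= T -> segcont u 0 T ->
  (forall s t, 0 <= s -> s <= t -> t <= T -> g s <= g t) ->
  (forall s, 0 <= s < T -> forall eta : R, 0 < eta -> exists2 k : R, 0 < k &
    forall t, s < t < s + k -> t <= T ->
      cmod (u t - u s) <= g t - g s + eta * (t - s)) ->
  cmod (u T - u 0) <= g T - g 0.
Proof.
move=> T0 uc gm ug; apply/ler_addgt0Pr => e e0.
(* Over [0, T] the slope eta costs at most e. *)
pose eta := e / (T + 1).
have T1 : 0 < T + 1 by rewrite ltr_wpDl.
have eta0 : 0 < eta by rewrite divr_gt0.
pose S : set R := [set s | 0 <= s <= T /\ cmod (u s - u 0) <= g s - g 0 + eta * s].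
have S0 : S 0 by split; rewrite ?lexx //= !subrr cmod0 add0r mulr0.
have hS : has_sup S by split; [exists 0|exists T => s [/andP[]]].
pose sg := sup S.
have sg0 : 0 <= sg by apply: sup_upper_bound.
have sgT : sg <= T by apply: ge_sup; [exists 0|move=> s [/andP[]]].
have Ssg : S sg.
  split; first by rewrite sg0.
  apply/ler_addgt0Pr => d d0; have sgr : 0 <= sg <= T by rewrite sg0.
  have [k k0 kP] := uc sg sgr d d0.
  have [s Ss ks] := sup_adherent k0 hS.
  have ssg : s <= sg by apply: sup_upper_bound.
  case: Ss => /andP[s0 sT] us.
  have h1 : cmod (u s - u sg) <= d.
    apply: kP; rewrite ?s0 // distrC ger0_norm ?subr_ge0 //.
    by rewrite -/sg in ks; lra.
  have h2 := cmod_triangle (u sg) (u s) (u 0).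
  have h3 := gm s sg s0 ssg sgT; rewrite cmodBC in h1.
  have h4 : eta * s <= eta * sg by rewrite ler_pM2l.
  lra.
have [sgeT|sgltT] := leP T sg.
  have E : sg = T by apply/eqP; rewrite eq_le sgT.
  case: Ssg => _; rewrite E => /le_trans; apply; rewrite lerD2l.
  by rewrite /eta mulrAC ler_pdivrMr // ler_pM2l // lerDl.
exfalso; have sgr : 0 <= sg < T by rewrite sg0.
have [k k0 kP] := ug sg sgr eta eta0.
pose t := Num.min (sg + k / 2) T.
have sgt : sg < t by rewrite lt_min sgltT andbT ltrDl divr_gt0.
have tT : t <= T by rewrite ge_min lexx orbT.
have tk : t < sg + k.
  apply: (@le_lt_trans _ _ (sg + k / 2)); first by rewrite ge_min lexx.
  by rewrite ltrD2l ltr_pdivrMr // ltr_pMr // ltr1n.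
have : S t.
  split; first by rewrite tT andbT (le_trans sg0) // ltW.
  have := kP t _ tT; rewrite sgt tk => /(_ isT) h1; case: Ssg => _ h2.
  have := cmod_triangle (u t) (u sg) (u 0); lra.
by move=> /(sup_upper_bound hS); rewrite leNgt sgt.
Qed.

Lemma mean_value f (rho L : R) z w :
  (forall p, rho <= complex.Re p -> exists2 l, cdiff setT f p l & cmod l <= L) ->
  rho <= complex.Re z -> rho <= complex.Re w -> cmod (f w - f z) <= L * cmod (w - z).
Proof.
move=> df rz rw.
have L0 : 0 <= L by have [l _] := df z rz; apply: le_trans; exact: cmod_ge0.
pose pt (t : R) : C := z + t%:C * (w - z).
have ptRe t : 0 <= t <= 1 -> rho <= complex.Re (pt t).
  move=> t01; have -> : complex.Re (pt t) = (1 - t) * complex.Re z + t * complex.Re w.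
    by rewrite /pt; case: (z) (w) => [? ?] [? ?] /=; ring.
  nra.
have ptB s t : pt t - pt s = (t - s)%:C * (w - z).
  by rewrite /pt raddfB /=; ring.
have := @growth_bound (fun t => f (pt t)) (fun t => L * cmod (w - z) * t) 1 ler01.
have -> : pt 1 = w by rewrite /pt mul1r addrC subrK.
have -> : pt 0 = z by rewrite /pt mul0r addr0.
rewrite mulr1 mulr0 subr0; apply.
- move=> t t01 e e0; have [l /cdiff_ccont dl _] := df _ (ptRe t t01).
  have [k k0 kP] := dl e e0.
  have wz1 : 0 < cmod (w - z) + 1 by rewrite ltr_wpDl ?cmod_ge0.
  exists (k / (cmod (w - z) + 1)) => [|s s01]; first by rewrite divr_gt0.
  rewrite ltr_pdivlMr // => h; apply: kP => //; rewrite ptB cmodM cmodR.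
  by apply: le_lt_trans h; rewrite ler_wpM2l // lerDl.
- by move=> s t s0 st _; rewrite ler_wpM2l // mulr_ge0 ?cmod_ge0.
move=> s /andP[s0 s1] eta eta0.
have s01 : 0 <= s <= 1 by rewrite s0 ltW.
have [l dl lL] := df _ (ptRe s s01).
have wz1 : 0 < cmod (w - z) + 1 by rewrite ltr_wpDl ?cmod_ge0.
have [k k0 kP] := dl _ (divr_gt0 eta0 wz1).
exists (k / (cmod (w - z) + 1)) => [|t /andP[st tk] t1]; first by rewrite divr_gt0.
have ts : 0 < t - s by rewrite subr_gt0.
have tsk : cmod (pt t - pt s) < k.
  rewrite ptB cmodM cmodR gtr0_norm //.
  have : (t - s) * (cmod (w - z) + 1) < k by rewrite -ltr_pdivlMr //; lra.
  by apply: le_lt_trans; rewrite ler_wpM2l ?lerDl // ltW.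
have h := kP _ I tsk.
have E : f (pt t) - f (pt s) = (f (pt t) - f (pt s) - l * (pt t - pt s)) + l * (pt t - pt s).
  by ring.
have h2 := cmodD (f (pt t) - f (pt s) - l * (pt t - pt s)) (l * (pt t - pt s)).
rewrite -E in h2; apply: (le_trans h2).
rewrite -mulrBr [leRHS]addrC; apply: lerD.
  apply: (le_trans h); rewrite ptB cmodM cmodR gtr0_norm //.
  rewrite mulrCA mulrC ler_wpM2r ?(ltW ts) // mulrAC ler_pdivrMr //.
  by rewrite ler_pM2l // lerDl.
rewrite cmodM ptB cmodM cmodR gtr0_norm // mulrCA [leRHS]mulrC ler_wpM2l ?(ltW ts) //.
by rewrite ler_wpM2r ?cmod_ge0.
Qed.

Lemma R_complete (u : nat -> R) :
  (forall e : R, 0 < e -> exists N, forall n m, (N <= n)%N -> (N <= m)%N ->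
    `|u n - u m| <= e) ->
  exists l, forall e : R, 0 < e -> exists N, forall n, (N <= n)%N -> `|u n - l| <= e.
Proof.
move=> cu.
have /cauchy_cvg/cvg_ex[l ul] : cauchy (u @ \oo).
  apply: cauchy_exP => e e0; have [N NP] := cu (e / 2) (divr_gt0 e0 (ltr0Sn _ 1)).
  exists (u N); exists N => // n /= Nn; rewrite /ball /=.
  by apply: le_lt_trans (NP _ _ (leqnn N) Nn) _; rewrite ltr_pdivrMr // ltr_pMr // ltr1n.
exists l => e e0; move/cvgrPdist_le : ul => /(_ e e0)[N _ NP].
by exists N => n Nn; rewrite distrC; exact: NP.
Qed.

Lemma C_complete (u : nat -> C) :
  (forall e : R, 0 < e -> exists N, forall n m, (N <= n)%N -> (N <= m)%N ->
    cmod (u n - u m) <= e) ->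
  exists l, forall e : R, 0 < e -> exists N, forall n, (N <= n)%N -> cmod (u n - l) <= e.
Proof.
move=> cu.
have [|x xP] := @R_complete (fun n => complex.Re (u n)).
  move=> e e0; have [N NP] := cu e e0; exists N => n m Nn Nm.
  by apply: le_trans (NP n m Nn Nm); rewrite -ReN -ReD Re_le_cmod.
have [|y yP] := @R_complete (fun n => complex.Im (u n)).
  move=> e e0; have [N NP] := cu e e0; exists N => n m Nn Nm.
  by apply: le_trans (NP n m Nn Nm); rewrite -ImN -ImD Im_le_cmod.
exists (x +i* y) => e e0; have e2 : 0 < e / 2 by rewrite divr_gt0.
have [N NP] := xP _ e2; have [M MP] := yP _ e2; exists (maxn N M) => n.
rewrite geq_max => /andP[Nn Mn]; apply: (le_trans (cmod_le_ReIm _)).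
by rewrite ReD ImD ReN ImN /=; have := NP n Nn; have := MP n Mn; lra.
Qed.

Definition unif_cauchy (u : nat -> C -> C) := forall rho e : R, 0 < rho -> 0 < e ->
  exists N, forall n m, (N <= n)%N -> (N <= m)%N -> forall z, rho <= complex.Re z ->
    cmod (u n z - u m z) <= e.

Definition unif_lim (u : nat -> C -> C) (f : C -> C) := forall rho e : R,
  0 < rho -> 0 < e -> exists N, forall n, (N <= n)%N -> forall z,
    rho <= complex.Re z -> cmod (u n z - f z) <= e.

Lemma unif_cauchy_lim u : unif_cauchy u -> exists f, unif_lim u f.
Proof.
move=> cu.
have H z : exists l, hp z -> forall e : R, 0 < e ->
    exists N, forall n, (N <= n)%N -> cmod (u n z - l) <= e.
  have [hz|] := pselect (hp z); last by exists 0.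
  have [|l lP] := @C_complete (fun n => u n z); last by exists l.
  move=> e e0; have [N NP] := cu (complex.Re z) e hz e0.
  by exists N => n m Nn Nm; apply: NP.
have [f fP] := choice H; exists f => rho e r0 e0.
have [N NP] := cu rho e r0 e0; exists N => n Nn z rz.
apply/ler_addgt0Pr => d d0.
have [M MP] := fP z (lt_le_trans r0 rz) d d0.
have h1 := NP n (maxn N M) Nn (leq_maxl _ _) z rz.
have h2 := MP (maxn N M) (leq_maxr _ _).
have := cmod_triangle (u n z) (u (maxn N M) z) (f z); lra.
Qed.

Lemma holatB f g z : holat f z -> holat g z -> holat (fun w => f w - g w) z.
Proof.
move=> hf hg; have := holatD hf (holatM (holat_cst (-1) z) hg).
by congr holat; apply/funext => w; rewrite mulN1r.
Qed.

Lemma cdiffN (D : set C) f z l : cdiff D f z l -> cdiff D (fun w => - f w) z (- l).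
Proof.
move=> df; have := cdiffM (cdiff_cst D (-1) z) df.
rewrite mul0r add0r mulN1r; congr cdiff.
by apply/funext => w; rewrite mulN1r.
Qed.

Lemma cdiff_unique f z l m : cdiff setT f z l -> cdiff setT f z m -> l = m.
Proof.
by move=> /cdiff_derivable[_ <-] /cdiff_derivable[_ <-].
Qed.

Lemma hol_derivative f : hol f ->
  exists f', forall z, hp z -> cdiff setT f z (f' z).
Proof.
move=> hf; have H z : exists l, hp z -> cdiff setT f z l.
  have [hz|] := pselect (hp z); last by exists 0.
  by have [l lP] := hf z hz; exists l.
by have [f' f'P] := choice H; exists f'.
Qed.

(** Weierstrass: by Cauchy's estimate the derivatives converge uniformly too, and
    the mean value inequality passes their limit to the limit function. *)
Lemma weierstrass u f : (forall n, hol (u n)) -> unif_lim u f -> hol f.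
Proof.
move=> hu uf.
have Hd n := hol_derivative (hu n).
have [u' u'P] := choice Hd.
have cu' : unif_cauchy u'.
  move=> rho e r0 e0; pose d := rho / 2.
  have d0 : 0 < d by rewrite divr_gt0.
  have ed : 0 < e * d / 16 by rewrite !mulr_gt0.
  have [N NP] := uf d _ d0 ed; exists N => n m Nn Nm z rz.
  have hz : hp z by apply: lt_le_trans rz.
  have -> : e = 8 * (e * d / 8) / d by field; rewrite gt_eqF.
  have dB : cdiff setT (fun w => u n w - u m w) z (u' n z - u' m z).
    by apply: cdiffD; [exact: u'P|apply: cdiffN; exact: u'P].
  apply: (cauchy_estimate d0 _ _ dB) => w wr.
    have hw : hp w by apply: csq_hp wr; rewrite /d; lra.
    by apply: holatB; exact: hu.
  have dw : d <= complex.Re w by case: wr => wr _; rewrite /d in wr *; lra.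
  have h1 := NP n Nn w dw; have h2 := NP m Nm w dw.
  have := cmod_triangle (u n w) (f w) (u m w); rewrite [cmod (f w - _)]cmodBC; lra.
have [f' f'P] := unif_cauchy_lim cu'.
move=> z hz; exists (f' z) => eta eta0.
pose rho := complex.Re z / 2.
have rho0 : 0 < rho by rewrite divr_gt0.
have e4 : 0 < eta / 4 by rewrite divr_gt0.
have [N NP] := f'P rho _ rho0 e4.
have [N' N'P] := cu' rho _ rho0 e4.
pose n := maxn N N'.
have [k k0 kP] := u'P n z hz _ e4.
exists (Num.min k rho) => [|w _]; first by rewrite lt_min k0.
rewrite lt_min => /andP[wk wr].
have rw : rho <= complex.Re w.
  have := le_lt_trans (Re_le_cmod _) wr; rewrite ReD ReN /rho ltr_norml; lra.
have rz : rho <= complex.Re z by rewrite /rho /hp /= in hz *; lra.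
have mv m : (N' <= m)%N ->
    cmod ((u m w - u n w) - (u m z - u n z)) <= eta / 4 * cmod (w - z).
  move=> Nm; apply: (@mean_value (fun p => u m p - u n p) rho) => // p rp.
  have hpp : hp p by apply: lt_le_trans rp.
  exists (u' m p - u' n p).
    by apply: cdiffD; [exact: u'P|apply: cdiffN; exact: u'P].
  by apply: N'P => //; exact: leq_maxr.
have lim : cmod ((f w - u n w) - (f z - u n z)) <= eta / 4 * cmod (w - z).
  apply/ler_addgt0Pr => d d0; have d2 : 0 < d / 2 by rewrite divr_gt0.
  have [M MP] := uf rho _ rho0 d2.
  have h1 := MP (maxn N' M) (leq_maxr _ _) w rw.
  have h2 := MP (maxn N' M) (leq_maxr _ _) z rz.
  have h3 := mv (maxn N' M) (leq_maxl _ _).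
  set m := maxn N' M in h1 h2 h3.
  have -> : (f w - u n w) - (f z - u n z) =
     ((u m w - u n w) - (u m z - u n z)) + ((u m z - f z) - (u m w - f w)) by ring.
  apply: (le_trans (cmodD _ _)); have := cmodB (u m z - f z) (u m w - f w); lra.
have h1 := kP w I wk; have h2 := NP n (leq_maxl _ _) z rz.
have -> : f w - f z - f' z * (w - z) = ((f w - u n w) - (f z - u n z)) +
   ((u n w - u n z - u' n z * (w - z)) + (u' n z - f' z) * (w - z)) by ring.
apply: (le_trans (cmodD _ _)).
have := cmodD (u n w - u n z - u' n z * (w - z)) ((u' n z - f' z) * (w - z)).
rewrite [cmod ((u' n z - f' z) * _)]cmodM.
have : cmod (u' n z - f' z) * cmod (w - z) <= eta / 4 * cmod (w - z).
  by rewrite ler_wpM2r ?cmod_ge0.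
have : 0 <= eta * cmod (w - z) by rewrite mulr_ge0 ?cmod_ge0 // ltW.
lra.
Qed.

Lemma pow_increment (s t : R) n : 0 <= s <= t ->
  n.+1%:R * s ^+ n * (t - s) <= t ^+ n.+1 - s ^+ n.+1.
Proof.
move=> /andP[s0 st]; elim: n => [|n IH]; first by rewrite expr0 !expr1; lra.
have -> : t ^+ n.+2 - s ^+ n.+2 = t * (t ^+ n.+1 - s ^+ n.+1) + s ^+ n.+1 * (t - s).
  by rewrite !exprS; ring.
have -> : n.+2%:R * s ^+ n.+1 * (t - s) =
    s * (n.+1%:R * s ^+ n * (t - s)) + s ^+ n.+1 * (t - s).
  by rewrite -[n.+2%:R]natr1 !exprS; ring.
rewrite lerD2r; apply: (@le_trans _ _ (s * (t ^+ n.+1 - s ^+ n.+1))).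
  by rewrite ler_wpM2l.
rewrite ler_wpM2r // subr_ge0; apply: lerXn2r => //; rewrite nnegrE //.
exact: le_trans st.
Qed.

(** What Cauchy's estimate loses on discs of radius proportional to 1/n is bounded
    independently of n. *)
Lemma euler_bound (n : nat) : (n.+2%:R / n.+1%:R) ^+ n <= expR 1 :> R.
Proof.
have n0 : 0 < n.+1%:R :> R by [].
have -> : n.+2%:R / n.+1%:R = 1 + n.+1%:R^-1 :> R.
  by rewrite -[n.+2%:R]natr1; field; rewrite gt_eqF.
apply: (@le_trans _ _ (expR (n.+1%:R^-1) ^+ n)).
  apply: lerXn2r; rewrite ?nnegrE ?expR_ge0 ?addr_ge0 ?invr_ge0 //.
  exact: expR_ge1Dx.
rewrite -expRM_natl ler_expR; rewrite ler_pdivrMr // mul1r ler_nat.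
exact: leqnSn.
Qed.

(** Uniqueness for the transport equation v_t = G v_z among functions analytic in z.
    Cauchy's estimate on discs of radius proportional to d/n, where d is the distance
    to the boundary, turns the bound (A t / d)^n into the same bound with n + 1; for
    small t these bounds tend to 0. *)
Lemma transport_unique (v : R -> C -> C) (G : C -> C) (c : C) (r T B K : R) :
  0 < r -> 0 < K -> 0 <= B ->
  (forall t z, 0 <= t <= T -> cmod (z - c) < r -> holat (v t) z) ->
  (forall t z, 0 <= t <= T -> cmod (z - c) < r -> cmod (v t z) <= B) ->
  (forall z, cmod (z - c) < r -> v 0 z = 0) ->
  (forall z, cmod (z - c) < r -> cmod (G z) <= K) ->
  (forall z, cmod (z - c) < r -> segcont (fun t => v t z) 0 T) ->
  (forall z s l, cmod (z - c) < r -> 0 <= s < T -> cdiff setT (v s) z l ->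
    forall eta : R, 0 < eta -> exists2 k : R, 0 < k &
      forall t, s < t < s + k -> t <= T ->
        cmod (v t z - v s z - (t - s)%:C * (G z * l)) <= eta * (t - s)) ->
  forall t z, 0 <= t <= T -> t <= r / (128 * K * expR 1) -> cmod (z - c) <= r / 2 ->
    v t z = 0.
Proof.
move=> r0 K0 B0 hv vB v0 GK vc dv.
pose A := 32 * K * expR 1.
have E0 : 0 < expR 1 :> R by exact: expR_gt0.
have A0 : 0 < A by rewrite !mulr_gt0.
have main n t z : 0 <= t <= T -> cmod (z - c) < r ->
    cmod (v t z) <= B * (A * t / (r - cmod (z - c))) ^+ n.
  elim: n t z => [|n IH] t z tT zr; first by rewrite expr0 mulr1 vB.
  pose d := r - cmod (z - c).
  have d0 : 0 < d by rewrite subr_gt0.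
  (* The square of half-side dl about z stays at distance at least
     d (n+1)/(n+2) from the boundary of the disc. *)
  pose dl := d / (2 * n.+2%:R).
  have dl0 : 0 < dl by rewrite divr_gt0 // mulr_gt0.
  have dlE : 2 * dl = d / n.+2%:R by rewrite /dl; field; rewrite gt_eqF.
  have sub w : csq z dl w -> cmod (w - c) < r /\ d * (n.+1%:R / n.+2%:R) <= r - cmod (w - c).
    move=> wz; have h1 := csq_le wz; have h2 := cmod_triangle w z c.
    rewrite dlE in h1.
    have h3 : d * (n.+1%:R / n.+2%:R) = d - d / n.+2%:R.
      have -> : n.+1%:R = n.+2%:R - 1 :> R by rewrite -[n.+2%:R]natr1 addrK.
      have : n.+2%:R != 0 :> R by [].
      by move: (n.+2%:R : R) => x x0; field.
    have h4 : 0 < d * (n.+1%:R / n.+2%:R) by rewrite mulr_gt0 // divr_gt0.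
    have dE : r - cmod (z - c) = d by [].
    move: h1 h3 h4; move: (d * (n.+1%:R / n.+2%:R)) => X.
    move: (d / n.+2%:R) => Y h1 h3 h4; clearbody d.
    by split; lra.
  pose q := A / d.
  have q0 : 0 < q by rewrite divr_gt0.
  have der s l : 0 <= s <= T -> cdiff setT (v s) z l ->
      cmod (G z * l) <= B * q ^+ n.+1 * (n.+1%:R * s ^+ n).
    move=> sT dl'; have /andP[s0 _] := sT.
    have L : cmod l <= 8 * (B * (q * s) ^+ n * expR 1) / dl.
      apply: (cauchy_estimate dl0 _ _ dl') => w wz; have [w1 w2] := sub w wz.
        exact: hv.
      apply: (le_trans (IH s w sT w1)); rewrite -[leRHS]mulrA ler_wpM2l //.
      apply: (@le_trans _ _ ((q * s) ^+ n * (n.+2%:R / n.+1%:R) ^+ n)); last first.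
        by rewrite ler_wpM2l ?euler_bound // exprn_ge0 // mulr_ge0 // ltW.
      have w0 : 0 < r - cmod (w - c) by rewrite subr_gt0.
      rewrite -exprMn; apply: lerXn2r.
      - by rewrite nnegrE divr_ge0 ?mulr_ge0 // ltW.
      - by rewrite nnegrE !mulr_ge0 ?invr_ge0 // ltW.
      have -> : q * s * (n.+2%:R / n.+1%:R) = A * s / (d * (n.+1%:R / n.+2%:R)).
        by rewrite /q; field; rewrite !gt_eqF.
      apply: ler_wpM2l; first by rewrite mulr_ge0 // ltW.
      by rewrite lef_pV2 // posrE // mulr_gt0 // divr_gt0.
    rewrite cmodM; apply: (@le_trans _ _ (K * (8 * (B * (q * s) ^+ n * expR 1) / dl))).
      by apply: ler_pM; rewrite ?cmod_ge0 ?GK.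
    have -> : K * (8 * (B * (q * s) ^+ n * expR 1) / dl) =
        B * (q ^+ n * s ^+ n) * (16 * K * expR 1 / d) * n.+2%:R.
      by rewrite /dl exprMn; field; rewrite !gt_eqF.
    have -> : B * q ^+ n.+1 * (n.+1%:R * s ^+ n) =
        B * (q ^+ n * s ^+ n) * (16 * K * expR 1 / d) * (2 * n.+1%:R).
      by rewrite exprS {1}/q /A; field; rewrite gt_eqF.
    apply: ler_wpM2l.
      by rewrite !mulr_ge0 ?invr_ge0 ?exprn_ge0 ?(ltW E0) ?(ltW K0) ?(ltW q0) ?(ltW d0).
    by rewrite -natrM ler_nat mul2n -addnn addnS addSn ltnS ltnS leq_addr.
  have /andP[t0 tT'] := tT.
  have gb := @growth_bound (fun s => v s z) (fun s => B * q ^+ n.+1 * s ^+ n.+1) t t0.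
  have BQ : 0 <= B * q ^+ n.+1 by rewrite mulr_ge0 // exprn_ge0 // ltW.
  rewrite v0 // subr0 expr0n /= mulr0 subr0 in gb.
  rewrite -/d -mulrA [t / d]mulrC mulrA -/q exprMn mulrA; apply: gb.
  - exact: segcont_sub (vc z zr).
  - move=> s s' s0 ss' _; rewrite ler_wpM2l //; apply: lerXn2r => //; rewrite nnegrE //.
    exact: le_trans ss'.
  move=> s /andP[s0 st] eta eta0.
  have sT : 0 <= s < T by rewrite s0 (lt_le_trans st).
  have sT' : 0 <= s <= T by rewrite s0 ltW //; case/andP: sT.
  have [l dl'] := hv s z sT' zr.
  have [k k0 kP] := dv z s l zr sT dl' eta eta0.
  exists k => // s' ss' s't.
  have h1 := kP s' ss' (le_trans s't tT').
  have /andP[ss1 _] := ss'.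
  have h2 : cmod ((s' - s)%:C * (G z * l)) <=
      B * q ^+ n.+1 * (s' ^+ n.+1 - s ^+ n.+1).
    rewrite cmodM cmodR ger0_norm ?subr_ge0 ?(ltW ss1) // mulrC.
    apply: (@le_trans _ _ (B * q ^+ n.+1 * (n.+1%:R * s ^+ n) * (s' - s))).
      by rewrite ler_wpM2r ?subr_ge0 ?(ltW ss1) // der.
    by rewrite -mulrA ler_wpM2l // pow_increment // s0 ltW.
  rewrite -mulrBr.
  have := cmodD (v s' z - v s z - (s' - s)%:C * (G z * l)) ((s' - s)%:C * (G z * l)).
  rewrite subrK; lra.
move=> t z tT tr zr.
have zr' : cmod (z - c) < r by lra.
apply: (@ComplexField.Normc.eq0_normc R); apply/eqP.
rewrite eq_le cmod_ge0 andbT leNgt; apply/negP => vz.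
have /andP[t0 _] := tT.
have B1 : 0 < B + 1 by rewrite ltr_wpDl.
have [|n nP] := @geo_small R (2^-1) (cmod (v t z) / (B + 1)) _ (divr_gt0 vz B1).
  by rewrite invr_ge0 ler0n /= invf_lt1 // ltr1n.
have := main n t z tT zr'; apply/negP; rewrite -ltNge.
have d0 : 0 < r - cmod (z - c) by rewrite subr_gt0.
rewrite ltr_pdivlMr // mulrC in nP; apply: le_lt_trans nP.
apply: ler_pM => //.
- by rewrite exprn_ge0 // divr_ge0 ?mulr_ge0 // ltW.
- by rewrite lerDl.
apply: lerXn2r; rewrite ?nnegrE ?invr_ge0 //.
  by rewrite divr_ge0 ?mulr_ge0 // ltW.
rewrite ler_pdivrMr //; move: tr; rewrite ler_pdivlMr; last by rewrite !mulr_gt0.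
by rewrite /A; lra.
Qed.

End Growth.

(** * The norm of a Zen space *)

Section Measurability.
Variable R : realType.
Local Notation C := R[i].
Local Notation mR := (measurableTypeR R).
Local Notation V := (Cplus R -> R[i]).
Implicit Types (F G : V).

(** Every point of an open planar set lies in a rational box inside the set, and there
    are countably many such boxes. *)
Lemma open_measurable2 (O : set (R * R)) : open O -> measurable (O : set (mR * mR)).
Proof.
move=> oO.
pose box (q : (rat * rat) * (rat * rat)) : set (R * R) :=
  `]ratr q.1.1, ratr q.1.2[ `*` `]ratr q.2.1, ratr q.2.2[.
have rat_nbhs (x : R) (S : set R) : nbhs x S -> exists q : rat * rat,
    `]ratr q.1, ratr q.2[%classic x /\ (`]ratr q.1, ratr q.2[ `<=` S).
  move=> [e /= e0 eS].
  have [q1 q1P] : exists q : rat, (ratr q : R) \in `]x - e, x[.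
    by apply: rat_in_itvoo; rewrite ltrBlDr ltrDl.
  have [q2 q2P] : exists q : rat, (ratr q : R) \in `]x, x + e[.
    by apply: rat_in_itvoo; rewrite ltrDl.
  move: q1P q2P; rewrite !in_itv /= => /andP[a1 a2] /andP[b1 b2].
  exists (q1, q2) => /=; split; first by rewrite in_itv /= a2.
  move=> y /=; rewrite in_itv /= => /andP[y1 y2]; apply: eS => /=.
  by rewrite distrC ltr_distl; lra.
have -> : O = \bigcup_q (if `[< box q `<=` O >] then box q else set0).
  apply/seteqP; split=> [p Op|p [q _]]; last by case: asboolP => // h; apply: h.
  have [[A B] [/= nA nB] AB] := oO p Op.
  have [q1 [q1p q1A]] := rat_nbhs _ _ nA; have [q2 [q2p q2B]] := rat_nbhs _ _ nB.
  exists (q1, q2) => //; case: asboolP => [_|]; first by split.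
  by case; move=> u [u1 u2]; apply: AB; split; [exact: q1A|exact: q2B].
apply: countable_bigcupT_measurable => // q; case: asboolP => _ //.
by apply: measurableX; exact: measurable_itv.
Qed.

Lemma extendE F (s : Cplus R) : extend F (val s) = F s.
Proof. by rewrite /extend valK. Qed.

Lemma extend0 F (z : C) : ~ hp z -> extend F z = 0.
Proof. by rewrite /extend /hp /=; case: insubP => // s -> . Qed.

Lemma extend_val F (z : C) (hz : hp z) : extend F z = F (exist _ z hz).
Proof. by rewrite -extendE. Qed.

Lemma analyticP F : analytic F <-> hol (extend F).
Proof.
split=> [aF z hz|hF s].
  exists (derive1 (extend F : C -> C^o) z).
  exact: derivable_cdiff (aF (exist _ z hz)).
by have [l /cdiff_derivable[]] := hF (val s) (valP s).
Qed.

(** The extension by 0 may jump at the boundary, but the sets where its modulus is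
    larger than some x >= 0 lie in the half-plane and are open. *)
Lemma cmod_extend_measurable F : hol (extend F) ->
  measurable_fun [set: mR * mR]
    (fun p : mR * mR => (cmod (extend F (p.1 +i* p.2)) ^+ 2)%:E : \bar R).
Proof.
move=> hF; apply/measurable_EFinP; apply: measurable_funX.
apply: (measurability _ (RGenOInfty.measurableE R)) => //.
move=> _ [_ [x ->] <-]; rewrite setTI; have [x0|x0] := ltP x 0.
  rewrite [X in measurable X](_ : _ = setT); first exact: measurableT.
  apply/seteqP; split=> // p _ /=; rewrite in_itv /= andbT.
  exact: lt_le_trans x0 (cmod_ge0 _).
apply: open_measurable2; rewrite openE => p /=; rewrite in_itv /= andbT => xp.
have hpp : hp (p.1 +i* p.2).
  by apply: contrapT => /(extend0 F) E; move: xp; rewrite E cmod0 ltNge x0.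
have [l dl] := hF _ hpp.
have e0 : 0 < (cmod (extend F (p.1 +i* p.2)) - x) / 2.
  by rewrite divr_gt0 // subr_gt0.
have := cont_pair (cdiff_ccont dl) e0.
apply: filterS => q /(_ I) h; rewrite /= in_itv /= andbT.
have := cmodB_ge (extend F (p.1 +i* p.2)) (extend F (q.1 +i* q.2)).
by rewrite cmodBC; lra.
Qed.

Lemma shift_measurable (e : R) :
  measurable_fun [set: mR * mR] (fun p => (p.1 + e, p.2) : mR * mR).
Proof.
apply: measurable_fun_pair; last exact: measurable_snd.
by apply: measurable_funD => //; exact: measurable_fst.
Qed.

Lemma cmod_shift_measurable F (e : R) : hol (extend F) ->
  measurable_fun [set: mR * mR]
    (fun p : mR * mR => (cmod (extend F ((p.1 + e) +i* p.2)) ^+ 2)%:E : \bar R).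
Proof.
move=> hF.
exact: (measurableT_comp (cmod_extend_measurable hF) (shift_measurable e)).
Qed.

End Measurability.

Section Zen.
Variable R : realType.
Local Notation C := R[i].
Local Notation mR := (measurableTypeR R).
Local Notation leb := (@lebesgue_measure R).
Local Notation V := (Cplus R -> R[i]).
Variable nu : {measure set mR -> \bar R}.
Implicit Types (F G : V) (s : Cplus R).
Local Open Scope ereal_scope.

Definition rhalf : set (mR * mR) := [set p | (0 <= p.1)%R].

(** The integrals of which the squared norm is the supremum. *)
Definition slice F (e : R) : \bar R := \int[nu \x leb]_(p in rhalf)
  ((cmod (extend F ((p.1 + e)%R +i* p.2)) ^+ 2)%R)%:E.

Definition zsq F : \bar R := ereal_sup [set slice F e | e in [set e : R | (0 < e)%R]].

Lemma zen_normE F : zen_norm nu F = sqrte (zsq F).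
Proof. by []. Qed.

Lemma rhalf_measurable : measurable rhalf.
Proof.
have -> : rhalf = @fst mR mR @^-1` `[0%R, +oo[%classic.
  by apply/seteqP; split => p; rewrite /rhalf /= in_itv /= andbT.
by rewrite -[X in measurable X]setTI; apply: measurable_fst => //.
Qed.

Lemma slice_ge0 F e : 0 <= slice F e.
Proof. by apply: integral_ge0 => p _; rewrite lee_fin exprn_ge0 // cmod_ge0. Qed.

Lemma slice_le F e : (0 < e)%R -> slice F e <= zsq F.
Proof. by move=> e0; apply: ereal_sup_ubound; exists e. Qed.

Lemma zsq_ge0 F : 0 <= zsq F.
Proof. exact: le_trans (slice_ge0 F 1) (slice_le F ltr01). Qed.

Lemma zsq_le F (c : \bar R) : (forall e : R, (0 < e)%R -> slice F e <= c) -> zsq F <= c.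
Proof. by move=> h; apply: ge_ereal_sup => _ [e e0 <-]; exact: h. Qed.

Lemma extend_shift F (e x y : R) : (0 < e)%R -> (0 <= x)%R ->
  exists s, extend F ((x + e)%R +i* y) = F s /\ val s = (x + e)%R +i* y.
Proof.
move=> e0 x0; have hz : @hp R ((x + e)%R +i* y) by rewrite /hp /= ltr_wpDl.
by exists (exist _ _ hz); rewrite extend_val.
Qed.

(** All closure properties of the space come from pointwise estimates between squares
    of moduli, which pass to the integrals. *)
Lemma slice_dominated F G H (A B e : R) : (0 <= A)%R -> (0 <= B)%R -> (0 < e)%R ->
  hol (extend F) -> hol (extend G) -> hol (extend H) ->
  (forall s, (cmod (F s) ^+ 2 <= A * cmod (G s) ^+ 2 + B * cmod (H s) ^+ 2)%R) ->
  slice F e <= A%:E * slice G e + B%:E * slice H e.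
Proof.
move=> A0 B0 e0 hF hG hH h; rewrite /slice.
have mD := rhalf_measurable.
have mS K : hol (extend K) -> measurable_fun rhalf
    (fun p : mR * mR => ((cmod (extend K ((p.1 + e)%R +i* p.2)) ^+ 2)%R)%:E : \bar R).
  by move=> hK; apply: measurable_funTS; exact: cmod_shift_measurable.
have pos K (p : mR * mR) : 0 <= ((cmod (extend K ((p.1 + e)%R +i* p.2)) ^+ 2)%R)%:E.
  by rewrite lee_fin exprn_ge0 // cmod_ge0.
rewrite -!ge0_integralZl //; try exact: mS.
rewrite -ge0_integralD //.
- apply: ge0_le_integral => //; first exact: mS.
  + by apply: emeasurable_funD; apply: measurable_funeM; exact: mS.
  + move=> p p0; have [s [E vs]] := extend_shift F p.2 e0 p0.
    rewrite E -!EFinM -EFinD lee_fin -!vs !extendE; exact: h.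
- by move=> p _; rewrite mule_ge0 // lee_fin.
- by apply: measurable_funeM; exact: mS.
- by move=> p _; rewrite mule_ge0 // lee_fin.
- by apply: measurable_funeM; exact: mS.
Qed.

Local Notation X := (zen_space nu).

(** The norm as a real number, which means something only on the space itself. *)
Definition nrm F : R := fine (zen_norm nu F).

Lemma nrm_ge0 F : (0 <= nrm F)%R.
Proof. by rewrite /nrm fine_ge0 // zen_normE sqrte_ge0. Qed.

Lemma zen_norm_fin F : (zen_norm nu F < +oo) = (zsq F < +oo).
Proof.
rewrite zen_normE -!ge0_fin_numE ?sqrte_ge0 ?zsq_ge0 //.
by rewrite sqrte_fin_num // zsq_ge0.
Qed.

Lemma zen_normK F : X F -> zen_norm nu F = (nrm F)%:E.
Proof.
by move=> [_ h]; rewrite /nrm fineK // ge0_fin_numE // zen_normE sqrte_ge0.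
Qed.

Lemma zsqE F : X F -> zsq F = ((nrm F ^+ 2)%R)%:E.
Proof.
move=> XF; have := zen_normK XF; rewrite zen_normE => E.
by rewrite -(sqr_sqrte (zsq_ge0 F)) E EFin_expe.
Qed.

Lemma zen_hol F : X F -> hol (extend F).
Proof. by move=> [/analyticP]. Qed.

Lemma zen_intro F (c : R) : (0 <= c)%R -> hol (extend F) -> zsq F <= ((c ^+ 2)%R)%:E ->
  X F /\ (nrm F <= c)%R.
Proof.
move=> c0 hF hc; have XF : X F.
  split; first exact/analyticP.
  by rewrite zen_norm_fin; apply: le_lt_trans hc _; rewrite ltry.
split=> //; rewrite -(@ler_pXn2r _ 2) ?nnegrE ?nrm_ge0 //.
by rewrite -lee_fin -zsqE.
Qed.

Lemma zen_dominated F G H (A B : R) : (0 <= A)%R -> (0 <= B)%R ->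
  hol (extend F) -> X G -> X H ->
  (forall s, (cmod (F s) ^+ 2 <= A * cmod (G s) ^+ 2 + B * cmod (H s) ^+ 2)%R) ->
  X F /\ (nrm F ^+ 2 <= A * nrm G ^+ 2 + B * nrm H ^+ 2)%R.
Proof.
move=> A0 B0 hF XG XH h.
have c0 : (0 <= A * nrm G ^+ 2 + B * nrm H ^+ 2)%R.
  by rewrite addr_ge0 // mulr_ge0 // exprn_ge0 // nrm_ge0.
have [|XF hn] := @zen_intro F (Num.sqrt (A * nrm G ^+ 2 + B * nrm H ^+ 2))
    (sqrtr_ge0 _) hF.
  apply: zsq_le => e e0; rewrite sqr_sqrtr //.
  apply: (le_trans (slice_dominated A0 B0 e0 hF (zen_hol XG) (zen_hol XH) h)).
  rewrite EFinD (EFinM A) (EFinM B) -!zsqE //; apply: leeD; apply: lee_wpmul2l => //;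
    by rewrite ?lee_fin // slice_le.
split=> //; rewrite -[leRHS]sqr_sqrtr //.
by rewrite ler_pXn2r ?nnegrE ?nrm_ge0 ?sqrtr_ge0.
Qed.

Lemma zen_bounded_mult F G (K : R) : (0 <= K)%R -> hol (extend F) -> X G ->
  (forall s, (cmod (F s) <= K * cmod (G s))%R) -> X F /\ (nrm F <= K * nrm G)%R.
Proof.
move=> K0 hF XG h.
have [|||||s|XF hn] := @zen_dominated F G G (K ^+ 2) 0 => //; first exact: exprn_ge0.
  rewrite mul0r addr0 -exprMn ler_pXn2r ?nnegrE ?cmod_ge0 //.
  by rewrite mulr_ge0 // cmod_ge0.
split=> //; rewrite mul0r addr0 -exprMn ler_pXn2r ?nnegrE ?nrm_ge0 // in hn.
by rewrite mulr_ge0 // nrm_ge0.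
Qed.

Lemma extendD F G z : extend (F + G)%R z = (extend F z + extend G z)%R.
Proof. by rewrite /extend; case: insubP => // _; rewrite addr0. Qed.

Lemma extendZ (a : C) F z : extend (a *: F)%R z = (a * extend F z)%R.
Proof. by rewrite /extend; case: insubP => // _; rewrite mulr0. Qed.

Lemma hol_extendD F G : hol (extend F) -> hol (extend G) -> hol (extend (F + G)%R).
Proof.
move=> hF hG; have -> : extend (F + G)%R = (fun z => (extend F z + extend G z)%R).
  by apply/funext => z; exact: extendD.
by move=> z hz; apply: holatD; [exact: hF|exact: hG].
Qed.

Lemma hol_extendZ (a : C) F : hol (extend F) -> hol (extend (a *: F)%R).
Proof.
move=> hF; have -> : extend (a *: F)%R = (fun z => (a * extend F z)%R).
  by apply/funext => z; exact: extendZ.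
by move=> z hz; apply: holatM; [exact: holat_cst|exact: hF].
Qed.

Lemma zenZ (a : C) F : X F -> X (a *: F)%R /\ (nrm (a *: F)%R <= cmod a * nrm F)%R.
Proof.
move=> XF; apply: zen_bounded_mult => //; first exact: cmod_ge0.
  exact/hol_extendZ/zen_hol.
by move=> s; rewrite -cmodM.
Qed.

(** The triangle inequality for the norms follows from the pointwise one because
    (a+b)^2 is the infimum over c of (1+c) a^2 + (1+1/c) b^2. *)
Lemma zenD F G : X F -> X G -> X (F + G)%R /\ (nrm (F + G)%R <= nrm F + nrm G)%R.
Proof.
move=> XF XG; have hFG := hol_extendD (zen_hol XF) (zen_hol XG).
have D (c : R) : (0 < c)%R -> X (F + G)%R /\
    (nrm (F + G)%R ^+ 2 <= (1 + c) * nrm F ^+ 2 + (1 + c^-1) * nrm G ^+ 2)%R.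
  move=> c0; have ci0 : (0 < c^-1)%R by rewrite invr_gt0.
  apply: zen_dominated => //; [lra|lra|] => s.
  apply: (@le_trans _ _ ((cmod (F s) + cmod (G s)) ^+ 2)%R).
    by rewrite ler_pXn2r ?nnegrE ?addr_ge0 ?cmod_ge0 // cmodD.
  have := sqr_ge0 (c * cmod (F s) - cmod (G s))%R.
  move: (cmod (F s)) (cmod (G s)) => a b h.
  have : (0 <= c^-1 * (c * a - b) ^+ 2)%R by rewrite mulr_ge0 // ltW.
  have -> : (c^-1 * (c * a - b) ^+ 2 = c * a ^+ 2 - 2 * a * b + c^-1 * b ^+ 2)%R.
    by field; rewrite gt_eqF.
  by rewrite sqrrD !mulrDl !mul1r; lra.
split; first exact: (D 1%R ltr01).1.
apply/ler_addgt0Pr => e e0.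
pose a : R := (nrm F + e / 2)%R; pose b : R := (nrm G + e / 2)%R.
have e2 : (0 < e / 2)%R by rewrite divr_gt0.
have a0 : (0 < a)%R by rewrite ltr_wpDl ?nrm_ge0.
have b0 : (0 < b)%R by rewrite ltr_wpDl ?nrm_ge0.
have c0 : (0 < b / a)%R by rewrite divr_gt0.
rewrite -(@ler_pXn2r _ 2) ?nnegrE ?nrm_ge0 ?addr_ge0 ?nrm_ge0 ?(ltW e0) //.
apply: (le_trans (D _ c0).2).
have -> : ((nrm F + nrm G + e) ^+ 2 = (1 + b / a) * a ^+ 2 + (1 + (b / a)^-1) * b ^+ 2)%R.
  have -> : (nrm F + nrm G + e = a + b)%R by rewrite /a /b; field.
  by rewrite invf_div; field; rewrite !gt_eqF.
have ge0 x : (0 < x)%R -> (0 <= 1 + x)%R by move=> /ltW x0; rewrite addr_ge0.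
apply: lerD; apply: ler_wpM2l; rewrite ?ge0 ?invr_gt0 //; apply: lerXn2r;
  by rewrite ?nnegrE ?nrm_ge0 ?(ltW a0) ?(ltW b0) // lerDl ltW.
Qed.

Lemma zenB F G : X F -> X G -> X (F - G)%R /\ (nrm (F - G)%R <= nrm F + nrm G)%R.
Proof.
move=> XF XG; rewrite -scaleN1r; have [XN hN] := zenZ (-1)%R XG.
have [XD hD] := zenD XF XN; split; first exact: XD.
apply: (le_trans hD); rewrite lerD2l.
by rewrite cmodN cmod1 mul1r in hN.
Qed.

Lemma nrm_triangle F G H : X F -> X G -> X H ->
  (nrm (F - H)%R <= nrm (F - G)%R + nrm (G - H)%R)%R.
Proof.
move=> XF XG XH; have -> : (F - H = (F - G) + (G - H))%R by rewrite addrA subrK.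
by apply: (zenD _ _).2; apply: (zenB _ _).1.
Qed.

Lemma nrmBC F G : X F -> X G -> nrm (F - G)%R = nrm (G - F)%R.
Proof.
have H A B : X A -> X B -> (nrm (A - B)%R <= nrm (B - A)%R)%R.
  move=> XA XB; have [_] := zenZ (-1)%R (zenB XB XA).1.
  by rewrite cmodN cmod1 mul1r scaleN1r opprB.
by move=> XF XG; apply/eqP; rewrite eq_le !H.
Qed.

(** Fatou's lemma in each of the integrals of the supremum. *)
Lemma zen_fatou (u : nat -> V) F (K : R) : (0 <= K)%R -> hol (extend F) ->
  (forall n, X (u n)) -> (forall n, (nrm (u n) <= K)%R) ->
  (forall s, forall e : R, (0 < e)%R -> exists N, forall n, (N <= n)%N ->
     (cmod (u n s - F s) <= e)%R) ->
  X F /\ (nrm F <= K)%R.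
Proof.
move=> K0 hF Xu uK uF; apply: zen_intro => //; apply: zsq_le => e e0.
pose f n (p : mR * mR) : \bar R := ((cmod (extend (u n) ((p.1 + e)%R +i* p.2)) ^+ 2)%R)%:E.
have mf n : measurable_fun rhalf (f n).
  by apply: measurable_funTS; apply: cmod_shift_measurable; exact: zen_hol.
have f0 n p : rhalf p -> 0 <= f n p by move=> _; rewrite lee_fin exprn_ge0 // cmod_ge0.
have := fatou (nu \x leb) rhalf_measurable mf f0.
have -> : \int[nu \x leb]_(x in rhalf) limn_einf (f^~ x) = slice F e.
  apply: eq_integral => p; rewrite inE => p0.
  have cv : f n p @[n --> \oo] --> ((cmod (extend F ((p.1 + e)%R +i* p.2)) ^+ 2)%R)%:E.
    apply: cvg_EFin; first by near=> n.
    have [s [E vs]] := extend_shift F p.2 e0 p0.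
    have -> : fine \o f^~ p = (fun n => (cmod (u n s) ^+ 2)%R).
      by apply/funext => n; rewrite /f /= -vs extendE.
    rewrite -vs extendE; apply/cvgrPdist_le => d d0.
    have [N NP] := uF s (Num.min 1 (d / (2 * cmod (F s) + 1)))%R ltac:(
      by rewrite lt_min ltr01 divr_gt0 // ltr_wpDl // mulr_ge0 // cmod_ge0).
    exists N => // n /= Nn; have := NP n Nn; rewrite le_min => /andP[h1 h2].
    rewrite ler_pdivlMr ?ltr_wpDl ?mulr_ge0 ?cmod_ge0 // in h2.
    have a0 := cmod_ge0 (F s); have b0 := cmod_ge0 (u n s).
    have h3 := cmodB_ge (F s) (u n s); have h4 := cmodB_ge (u n s) (F s).
    rewrite cmodBC in h3; rewrite ler_norml.
    have k0 := cmod_ge0 (u n s - F s)%R.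
    move: (cmod (u n s)) (cmod (F s)) (cmod (u n s - F s)%R) a0 b0 h1 h2 h3 h4 k0.
    by move=> b a k a0 b0 h1 h2 h3 h4 k0; apply/andP; split; nra.
  by rewrite is_cvg_limn_einfE; [exact: cvg_lim cv|apply/cvg_ex; eexists; exact: cv].
move/le_trans; apply.
have B n : \int[nu \x leb]_(x in rhalf) f n x <= ((K ^+ 2)%R)%:E.
  apply: (le_trans (slice_le (u n) e0)); rewrite zsqE // lee_fin.
  by apply: lerXn2r; rewrite ?nnegrE ?nrm_ge0.
rewrite limn_einf_lim; apply: lime_le; first exact: is_cvg_einfs.
near=> n; apply: le_trans (B n); apply: ereal_inf_lbound; exists n => //=.
Unshelve. all: by end_near. Qed.

End Zen.

(** * Planar integrals and the area mean value inequality *)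

Section Tonelli.
Variable R : realType.
Local Notation mR := (measurableTypeR R).
Local Notation leb := (@lebesgue_measure R).
Local Open Scope ereal_scope.

Lemma tonelli_rect1 (m1 m2 : {sigma_finite_measure set mR -> \bar R})
    (A B : set mR) (f : mR * mR -> \bar R) : measurable A -> measurable B ->
  measurable_fun setT f -> (forall p, 0 <= f p) ->
  \int[m1 \x m2]_(p in A `*` B) f p = \int[m1]_(x in A) \int[m2]_(y in B) f (x, y).
Proof.
move=> mA mB mf f0; have mAB := measurableX mA mB.
rewrite integral_mkcond fubini_tonelli1; first last.
- by move=> p; apply: erestrict_ge0.
- by apply/(measurable_restrictT _ _).1 => //; exact: measurable_funTS.
rewrite [RHS]integral_mkcond; apply: eq_integral => x _.
rewrite /fubini_F patchE; case: ifPn => xA.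
  rewrite [RHS]integral_mkcond; apply: eq_integral => y _.
  by rewrite !patchE in_setX xA.
by apply: integral0_eq => y _; rewrite patchE in_setX (negbTE xA).
Qed.

Lemma tonelli_rect2 (m1 m2 : {sigma_finite_measure set mR -> \bar R})
    (A B : set mR) (f : mR * mR -> \bar R) : measurable A -> measurable B ->
  measurable_fun setT f -> (forall p, 0 <= f p) ->
  \int[m1 \x m2]_(p in A `*` B) f p = \int[m2]_(y in B) \int[m1]_(x in A) f (x, y).
Proof.
move=> mA mB mf f0; have mAB := measurableX mA mB.
rewrite integral_mkcond fubini_tonelli2; first last.
- by move=> p; apply: erestrict_ge0.
- by apply/(measurable_restrictT _ _).1 => //; exact: measurable_funTS.
rewrite [RHS]integral_mkcond; apply: eq_integral => y _.
rewrite /fubini_G patchE; case: ifPn => yB.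
  rewrite [RHS]integral_mkcond; apply: eq_integral => x _.
  by rewrite !patchE in_setX yB andbT.
by apply: integral0_eq => x _; rewrite patchE in_setX (negbTE yB) andbF.
Qed.

Lemma measurable_section1 (m : {sigma_finite_measure set mR -> \bar R}) (A : set mR)
    (f : mR * mR -> \bar R) : measurable A -> measurable_fun setT f ->
  (forall p, 0 <= f p) -> measurable_fun setT (fun y => \int[m]_(x in A) f (x, y)).
Proof.
move=> mA mf f0.
have -> : (fun y => \int[m]_(x in A) f (x, y)) = fubini_G m (f \_ (A `*` setT)).
  apply/funext => y; rewrite /fubini_G [LHS]integral_mkcond.
  by apply: eq_integral => x _; rewrite !patchE in_setX in_setT andbT.
apply: measurable_fun_fubini_tonelli_G; last by move=> z; apply: erestrict_ge0.
by apply/(measurable_restrictT _ _).1; [exact: measurableX|exact: measurable_funTS].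
Qed.

Lemma measurable_section2 (m : {sigma_finite_measure set mR -> \bar R}) (A : set mR)
    (f : mR * mR -> \bar R) : measurable A -> measurable_fun setT f ->
  (forall p, 0 <= f p) -> measurable_fun setT (fun x => \int[m]_(y in A) f (x, y)).
Proof.
move=> mA mf f0.
have -> : (fun x => \int[m]_(y in A) f (x, y)) = fubini_F m (f \_ (setT `*` A)).
  apply/funext => x; rewrite /fubini_F [LHS]integral_mkcond.
  by apply: eq_integral => y _; rewrite !patchE in_setX in_setT.
apply: measurable_fun_fubini_tonelli_F; last by move=> z; apply: erestrict_ge0.
by apply/(measurable_restrictT _ _).1; [exact: measurableX|exact: measurable_funTS].
Qed.

Lemma add_measurable (c : R) : measurable_fun setT (fun x : mR => (c + x)%R : mR).
Proof. by apply: measurable_funD. Qed.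

Lemma lebesgue_translate (c : R) (A : set mR) : measurable A ->
  leb ((fun x => (c + x)%R) @^-1` A) = leb A.
Proof.
move=> mA; apply/esym.
pose th : mR -> mR := fun x => (c + x)%R.
have mth : measurable_fun setT th by exact: add_measurable.
have := @lebesgue_measure_unique R (pushforward leb th).
apply => // _ [[a b]] _ <-.
have E : th @^-1` `]a, b]%classic = `](a - c)%R, (b - c)%R]%classic.
  by apply/seteqP; split => x; rewrite /th /= !in_itv /= ltrBlDl lerBrDl.
rewrite /pushforward [X in _ = leb X]E.
rewrite !lebesgue_measure_itv /= !lte_fin ltrD2r.
by case: ifP => // _; rewrite -!EFinD; congr EFin; ring.
Qed.

Lemma integral_translate (c : R) (D : set mR) (f : mR -> \bar R) :
  measurable D -> measurable_fun setT f -> (forall x, 0 <= f x) ->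
  \int[leb]_(x in (fun x => (c + x)%R) @^-1` D) f (c + x)%R = \int[leb]_(x in D) f x.
Proof.
move=> mD mf f0.
have mth : measurable_fun setT (fun x : mR => (c + x)%R : mR) by exact: add_measurable.
rewrite -[LHS](@ge0_integral_pushforward _ _ _ _ _ _ mth leb D f) //; last first.
  exact: measurable_funTS.
apply: eq_measure_integral => A mA AD; exact: lebesgue_translate.
Qed.

Lemma integral_reflect (c : R) (D : set mR) (f : mR -> \bar R) :
  measurable D -> measurable_fun setT f -> (forall x, 0 <= f x) ->
  \int[leb]_(x in (fun x => (c - x)%R) @^-1` D) f (c - x)%R = \int[leb]_(x in D) f x.
Proof.
move=> mD mf f0; rewrite -(integral_translate c mD mf f0).
have mth : measurable_fun setT (-%R : mR -> mR) by apply: oppr_measurable.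
have mD' : measurable ((fun x : mR => (c + x)%R : mR) @^-1` D).
  by rewrite -[X in measurable X]setTI; apply: add_measurable.
have mf' : measurable_fun setT (fun x : mR => f (c + x)%R).
  exact: (measurableT_comp mf (add_measurable c)).
rewrite -[LHS](@ge0_integral_pushforward _ _ _ _ _ _ mth leb
  ((fun x : mR => (c + x)%R : mR) @^-1` D) (fun x : mR => f (c + x)%R)) //; last first.
  exact: measurable_funTS.
apply: eq_measure_integral => A mA AD; exact: lebesgue_measureN.
Qed.

End Tonelli.

Section PointEvaluation.
Variable R : realType.
Local Notation C := R[i].
Local Notation mR := (measurableTypeR R).
Local Notation leb := (@lebesgue_measure R).
Local Open Scope ereal_scope.
Implicit Types (f : C -> C).

Lemma rint_le_integral (h : R -> R) (u v : R) (D : set mR) :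
  segcontR h u v -> measurable D -> `[u, v]%classic `<=` D ->
  measurable_fun setT (EFin \o h : mR -> \bar R) -> (forall x, (0 <= h x)%R) ->
  (rint h u v)%:E <= \int[leb]_(x in D) (h x)%:E.
Proof.
move=> ch mD uvD mh h0; have Ih := segcontR_integrable ch.
rewrite /rint /Rintegral fineK; last exact: integrable_fin_num.
apply: ge0_subset_integral => //; first exact: measurable_funTS.
by move=> x _; rewrite lee_fin.
Qed.

(** The maximum principle in mean over squares of half-side between d/2 and d,
    applied to the square of f, integrates to an area bound. *)
Lemma area_mean_value f (a : C) (d : R) : (0 < d)%R ->
  (forall z, csq a d z -> holat f z) ->
  measurable_fun setT
    (fun p : mR * mR => ((cmod (f (p.1 +i* p.2)) ^+ 2)%R)%:E : \bar R) ->
  ((cmod (f a) ^+ 2)%R)%:E <= ((16 / d ^+ 2)%R)%:E *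
    \int[leb \x leb]_(p in `[(complex.Re a - d)%R, (complex.Re a + d)%R]%classic `*`
       `[(complex.Im a - d)%R, (complex.Im a + d)%R]%classic)
      ((cmod (f (p.1 +i* p.2)) ^+ 2)%R)%:E.
Proof.
case: a => p q d0 df mH /=.
pose H (z : mR * mR) : \bar R := ((cmod (f (z.1 +i* z.2)) ^+ 2)%R)%:E.
rewrite -/H.
have H0 z : 0 <= H z by rewrite lee_fin exprn_ge0 // cmod_ge0.
pose I : set mR := `[(p - d)%R, (p + d)%R]%classic.
pose J : set mR := `[(q - d)%R, (q + d)%R]%classic.
have mI : measurable I by exact: measurable_itv.
have mJ : measurable J by exact: measurable_itv.
pose S1 (y : mR) : \bar R := \int[leb]_(x in I) H (x, y).
pose S2 (x : mR) : \bar R := \int[leb]_(y in J) H (x, y).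
have S10 y : 0 <= S1 y by apply: integral_ge0.
have S20 x : 0 <= S2 x by apply: integral_ge0.
have mHx x : measurable_fun setT (fun y : mR => H (x, y)) by apply: measurableT_comp.
have mHy y : measurable_fun setT (fun x : mR => H (x, y)) by apply: measurableT_comp.
pose M := \int[leb \x leb]_(z in I `*` J) H z.
have M1 : M = \int[leb]_(y in J) S1 y by exact: tonelli_rect2.
have M2 : M = \int[leb]_(x in I) S2 x by exact: tonelli_rect1.
have mS1 : measurable_fun setT S1 by exact: measurable_section1.
have mS2 : measurable_fun setT S2 by exact: measurable_section2.
pose K : set mR := `[(d / 2)%R, d]%classic.
have mK : measurable K by exact: measurable_itv.
have side (r : R) : K r -> ((cmod (f (p +i* q)) ^+ 2)%R)%:E <=
    ((2 / d)%R)%:E * (S1 (q - r)%R + S1 (q + r)%R + S2 (p - r)%R + S2 (p + r)%R).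
  rewrite /K /= in_itv /= => /andP[r1 r2].
  have r0 : (0 < r)%R by apply: lt_le_trans r1; rewrite divr_gt0.
  have dg z : csq (p +i* q) r z -> holat (fun z => f z ^+ 2)%R z.
    by move=> zr; apply: holatX; apply: df; apply: csq_sub zr.
  have := cauchy_mean r0 (holat_csq dg); rewrite /= cmodX => h.
  have sc1 (y : R) : (q - r <= y <= q + r)%R ->
      (rint (fun x => cmod (f (x +i* y) ^+ 2)%R) (p - r) (p + r))%:E <= S1 y.
    move=> yr; have -> : (fun x => cmod (f (x +i* y) ^+ 2)%R) =
      (fun x => cmod (f (x +i* y)) ^+ 2)%R by apply/funext => x; rewrite cmodX.
    apply: rint_le_integral => //.
    - have := @segcont_cmod R (fun x => (f (x +i* y) ^+ 2)%R) (p - r)%R (p + r)%R.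
      have -> : (fun x => cmod (f (x +i* y) ^+ 2)%R) =
        (fun x => cmod (f (x +i* y)) ^+ 2)%R by apply/funext => x; rewrite cmodX.
      apply; apply: (@ccont_hseg R setT (fun z => f z ^+ 2)%R) => // x xr.
      by apply: holat_ccont; apply: dg; split => /=; lra.
    - by move=> x; rewrite /I /= !in_itv /=; lra.
    - exact: mHy.
    - by move=> x; rewrite exprn_ge0 // cmod_ge0.
  have sc2 (x : R) : (p - r <= x <= p + r)%R ->
      (rint (fun y => cmod (f (x +i* y) ^+ 2)%R) (q - r) (q + r))%:E <= S2 x.
    move=> xr; have -> : (fun y => cmod (f (x +i* y) ^+ 2)%R) =
      (fun y => cmod (f (x +i* y)) ^+ 2)%R by apply/funext => y; rewrite cmodX.
    apply: rint_le_integral => //.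
    - have := @segcont_cmod R (fun y => (f (x +i* y) ^+ 2)%R) (q - r)%R (q + r)%R.
      have -> : (fun y => cmod (f (x +i* y) ^+ 2)%R) =
        (fun y => cmod (f (x +i* y)) ^+ 2)%R by apply/funext => y; rewrite cmodX.
      apply; apply: (@ccont_vseg R setT (fun z => f z ^+ 2)%R) => // y yr.
      by apply: holat_ccont; apply: dg; split => /=; lra.
    - by move=> y; rewrite /J /= !in_itv /=; lra.
    - exact: mHx.
    - by move=> y; rewrite exprn_ge0 // cmod_ge0.
  rewrite -lee_fin in h; apply: (le_trans h); rewrite EFinM !EFinD.
  apply: lee_pmul.
  - by rewrite lee_fin invr_ge0 ltW.
  - by rewrite !adde_ge0 // lee_fin; apply: Rintegral_ge0 => t _; exact: cmod_ge0.
  - by rewrite lee_fin -[(2 / d)%R]invf_div lef_pV2 ?posrE // divr_gt0.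
  - by rewrite !leeD // ?sc1 ?sc2 //; lra.
have back (S : mR -> \bar R) (D : set mR) c : measurable D -> measurable_fun setT S ->
    (forall x, 0 <= S x) -> (forall r, K r -> D (c - r)%R) ->
    measurable_fun K (fun r : mR => S (c - r)%R) /\
    \int[leb]_(r in K) S (c - r)%R <= \int[leb]_(r in D) S r.
  move=> mD mS S0 KD; have mc : measurable_fun setT (fun r : mR => (c - r)%R : mR).
    by apply: measurable_funB.
  have mSc := measurableT_comp mS mc; split; first exact: measurable_funTS.
  rewrite -(integral_reflect c mD mS S0); apply: ge0_subset_integral => //.
    by rewrite -[X in measurable X]setTI; apply: mc.
  exact: measurable_funTS.
have forth (S : mR -> \bar R) (D : set mR) c : measurable D -> measurable_fun setT S ->
    (forall x, 0 <= S x) -> (forall r, K r -> D (c + r)%R) ->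
    measurable_fun K (fun r : mR => S (c + r)%R) /\
    \int[leb]_(r in K) S (c + r)%R <= \int[leb]_(r in D) S r.
  move=> mD mS S0 KD; have mc := add_measurable c.
  have mSc := measurableT_comp mS mc; split; first exact: measurable_funTS.
  rewrite -(integral_translate c mD mS S0); apply: ge0_subset_integral => //.
    by rewrite -[X in measurable X]setTI; apply: mc.
  exact: measurable_funTS.
have [m1 T1] := back S1 J q mJ mS1 S10 ltac:(by move=> r; rewrite /K /J /= !in_itv /=; lra).
have [m2 T2] := forth S1 J q mJ mS1 S10 ltac:(by move=> r; rewrite /K /J /= !in_itv /=; lra).
have [m3 T3] := back S2 I p mI mS2 S20 ltac:(by move=> r; rewrite /K /I /= !in_itv /=; lra).
have [m4 T4] := forth S2 I p mI mS2 S20 ltac:(by move=> r; rewrite /K /I /= !in_itv /=; lra).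
rewrite -M1 in T1 T2; rewrite -M2 in T3 T4.
have m12 := emeasurable_funD m1 m2.
have m123 := emeasurable_funD m12 m3.
have m1234 := emeasurable_funD m123 m4.
clearbody S1 S2.
have L : \int[leb]_(r in K) ((cmod (f (p +i* q)) ^+ 2)%R)%:E <=
    \int[leb]_(r in K) (((2 / d)%R)%:E *
       (S1 (q - r)%R + S1 (q + r)%R + S2 (p - r)%R + S2 (p + r)%R)).
  apply: ge0_le_integral => //.
  - by move=> r _; rewrite lee_fin exprn_ge0 // cmod_ge0.
  - exact: measurable_funeM.
have KE : leb K = (d / 2)%:E.
  rewrite /K lebesgue_measure_itv /= lte_fin; case: ltP => h; rewrite -?EFinB.
    by congr EFin; lra.
  by exfalso; lra.
rewrite integral_cst // [X in _ * X <= _](_ : _ = (d / 2)%:E) in L; last exact: KE.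
rewrite ge0_integralZl // in L; try (by move=> r _; rewrite !adde_ge0);
  try (by rewrite lee_fin divr_ge0 // ltW).
rewrite !ge0_integralD // in L; try by [move=> r _; rewrite !adde_ge0].
have L2 := le_trans L (lee_wpmul2l _ (leeD (leeD (leeD T1 T2) T3) T4)).
have {L2}L2 := L2 ltac:(by rewrite lee_fin divr_ge0 // ltW).
rewrite -/M; have M0 : 0 <= M by apply: integral_ge0.
have [Moo|Mfin] := eqVneq M +oo.
  by rewrite Moo gt0_muley ?leey // lte_fin divr_gt0 // exprn_gt0.
have ME : M = (fine M)%:E.
  by rewrite fineK // ge0_fin_numE // lt_neqAle Mfin leey.
rewrite ME -!EFinD -!EFinM !lee_fin in L2 *.
rewrite -(@ler_pM2r _ (d / 2)) ?divr_gt0 //.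
have -> : (16 / d ^+ 2 * fine M * (d / 2) = 2 / d * (fine M + fine M + fine M + fine M))%R.
  by field; rewrite gt_eqF.
by apply: le_trans L2; rewrite le_eqVlt; apply/orP; left; apply/eqP; field.
Qed.

End PointEvaluation.

(** * Point evaluations, completeness and powers of 1/(s+1) *)

Section ZenEvaluation.
Variable R : realType.
Local Notation C := R[i].
Local Notation mR := (measurableTypeR R).
Local Notation leb := (@lebesgue_measure R).
Local Notation V := (Cplus R -> R[i]).
Variable nu : {sigma_finite_measure set mR -> \bar R}.
Implicit Types (F G : V) (s : Cplus R).
Local Open Scope ereal_scope.

(** Averaging the slices over e in an interval of positive length controls the
    Lebesgue measure of a strip: for each x near 0 the translates x + e cover
    the strip. *)
Lemma strip_integral F (a rho : R) (J : set mR) : (0 < rho)%R -> (rho <= a)%R ->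
  hol (extend F) -> measurable J ->
  nu `[0%R, (rho / 4)%R[%classic *
    \int[leb \x leb]_(p in `[(a - rho / 4)%R, (a + rho / 4)%R]%classic `*` J)
      ((cmod (extend F (p.1 +i* p.2)) ^+ 2)%R)%:E <=
  (rho%:E * zsq nu F).
Proof.
move=> r0 ra hF mJ.
pose H (z : mR * mR) : \bar R := ((cmod (extend F (z.1 +i* z.2)) ^+ 2)%R)%:E.
rewrite -/H.
have H0 z : 0 <= H z by rewrite lee_fin exprn_ge0 // cmod_ge0.
have mH : measurable_fun setT H by exact: cmod_extend_measurable.
pose I : set mR := `[(a - rho / 4)%R, (a + rho / 4)%R]%classic.
pose X0 : set mR := `[0%R, (rho / 4)%R[%classic.
pose E : set mR := `[(a - rho / 2)%R, (a + rho / 4)%R]%classic.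
have mI : measurable I by exact: measurable_itv.
have mX : measurable X0 by exact: measurable_itv.
have mE : measurable E by exact: measurable_itv.
pose Hb (u : mR) : \bar R := \int[leb]_(y in setT) H (u, y).
have Hb0 u : 0 <= Hb u by apply: integral_ge0.
have mHb : measurable_fun setT Hb by exact: measurable_section2.
have mHu u : measurable_fun setT (fun y : mR => H (u, y)) by apply: measurableT_comp.
have M1 : \int[leb \x leb]_(p in I `*` J) H p <= \int[leb]_(u in I) Hb u.
  rewrite (tonelli_rect1 leb leb mI mJ mH H0); apply: ge0_le_integral => //.
  - by move=> u _; apply: integral_ge0.
  - by apply: measurable_funTS; exact: measurable_section2.
  - exact: measurable_funTS.
  by move=> u _; apply: ge0_subset_integral.
have madd : measurable_fun setT (fun p : mR * mR => Hb (p.1 + p.2)%R).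
  apply: (measurableT_comp mHb); apply: measurable_funD; [exact: measurable_fst|exact: measurable_snd].
have M2 x : X0 x -> \int[leb]_(u in I) Hb u <= \int[leb]_(e in E) Hb (x + e)%R.
  rewrite /X0 /= in_itv /= => /andP[x0 x1].
  rewrite -(integral_translate x mI mHb Hb0); apply: ge0_subset_integral => //.
  - by rewrite -[X in measurable X]setTI; apply: add_measurable.
  - by apply: measurable_funTS; apply: (measurableT_comp mHb); apply: add_measurable.
  - by move=> e; rewrite /I /E /= !in_itv /=; lra.
have M3 : nu X0 * \int[leb]_(u in I) Hb u <=
    \int[leb]_(e in E) \int[nu]_(x in X0) Hb (x + e)%R.
  have T1 := tonelli_rect1 nu leb mX mE madd (fun p => Hb0 _).
  have T2 := tonelli_rect2 nu leb mX mE madd (fun p => Hb0 _).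
  rewrite muleC -integral_cst // -T2 T1; apply: ge0_le_integral.
  - exact: mX.
  - by move=> x _; apply: integral_ge0.
  - exact: measurable_cst.
  - by apply: measurable_funTS; exact: (measurable_section2 leb (f := fun p => Hb (p.1 + p.2)%R)).
  - exact: M2.
apply: (@le_trans _ _ (nu X0 * \int[leb]_(u in I) Hb u)).
  by apply: lee_wpmul2l.
apply: (le_trans M3).
have M4 e : E e -> \int[nu]_(x in X0) Hb (x + e)%R <= zsq nu F.
  rewrite /E /= in_itv /= => /andP[e1 e2].
  have e0 : (0 < e)%R by lra.
  apply: le_trans (slice_le nu F e0); rewrite /slice.
  have sub : X0 `*` setT `<=` @rhalf R.
    by move=> p [] /=; rewrite /X0 /= in_itv /= => /andP[].
  have ms := cmod_shift_measurable e hF.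
  apply: (@le_trans _ _ (\int[nu \x leb]_(p in X0 `*` setT)
     ((cmod (extend F ((p.1 + e)%R +i* p.2)) ^+ 2)%R)%:E)); last first.
    apply: ge0_subset_integral => //.
    - exact: measurableX.
    - exact: rhalf_measurable.
    - exact: measurable_funTS.
    - by move=> p _; rewrite lee_fin exprn_ge0 // cmod_ge0.
  have T := tonelli_rect1 nu leb mX (@measurableT _ mR) ms.
  by rewrite T // => p; rewrite lee_fin exprn_ge0 // cmod_ge0.
apply: (@le_trans _ _ (\int[leb]_(e in E) zsq nu F)).
  apply: ge0_le_integral => //.
  - by move=> e _; apply: integral_ge0.
  - apply: measurable_funTS.
    exact: (measurable_section1 nu (f := fun p => Hb (p.1 + p.2)%R)).
rewrite integral_cst // muleC; apply: lee_wpmul2r; first exact: zsq_ge0.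
have EE : leb E = (3 * rho / 4)%:E.
  rewrite /E lebesgue_measure_itv /= lte_fin; case: ltP => h; rewrite -?EFinB.
    by congr EFin; lra.
  by exfalso; lra.
rewrite [leLHS](_ : _ = (3 * rho / 4)%:E); last exact: EE.
by rewrite lee_fin; lra.
Qed.

(** A value is bounded by the integral over a square, the square lies in a
    strip, and the strip is controlled by the norm. *)
Lemma point_evaluation (rho : R) : (0 < rho)%R ->
  0 < nu `[0%R, (rho / 4)%R[%classic < +oo ->
  exists2 c : R, (0 <= c)%R & forall F s, zen_space nu F ->
    (rho <= complex.Re (val s))%R -> (cmod (F s) <= c * nrm nu F)%R.
Proof.
move=> r0 /andP[n0 noo].
set v := nu _ in n0 noo.
have vE : v = (fine v)%:E by rewrite fineK // ge0_fin_numE // ltW.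
have v0 : (0 < fine v)%R by rewrite -lte_fin -vE.
pose k : R := (256 / rho / fine v)%R.
have k0 : (0 <= k)%R by rewrite !divr_ge0 // ltW.
exists (Num.sqrt k) => [|F s XF rs]; first exact: sqrtr_ge0.
have hF := zen_hol XF.
have d0 : (0 < rho / 4)%R by rewrite divr_gt0.
have hs z : csq (val s) (rho / 4) z -> holat (extend F) z.
  by move=> zr; apply: hF; apply: csq_hp zr; lra.
have := area_mean_value d0 hs (cmod_extend_measurable hF).
set M := \int[_]_(p in _) _ => h1.
have h2 := strip_integral r0 rs hF (measurable_itv `[(complex.Im (val s) - rho / 4)%R, (complex.Im (val s) + rho / 4)%R]).
rewrite -/M -/v (zsqE XF) in h2.
have M0 : 0 <= M by apply: integral_ge0 => p _; rewrite lee_fin exprn_ge0 // cmod_ge0.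
have Mfin : M < +oo.
  rewrite ltNge; apply/negP; rewrite leye_eq => /eqP ME; move: h2.
  by rewrite ME gt0_muley // -EFinM leye_eq.
have ME : M = (fine M)%:E by rewrite fineK // ge0_fin_numE.
rewrite ME vE -!EFinM !lee_fin in h1 h2.
rewrite extendE in h1.
rewrite -(@ler_pXn2r _ 2) ?nnegrE ?cmod_ge0 ?mulr_ge0 ?sqrtr_ge0 ?nrm_ge0 //.
rewrite exprMn sqr_sqrtr //; apply: (le_trans h1).
have -> : (k * nrm nu F ^+ 2 = 16 / (rho / 4) ^+ 2 * (rho * nrm nu F ^+ 2 / fine v))%R.
  by rewrite /k; field; rewrite !gt_eqF.
apply: ler_wpM2l; first by rewrite divr_ge0 // exprn_ge0 // ltW.
by rewrite ler_pdivlMr // mulrC.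
Qed.

End ZenEvaluation.

Section SigmaFiniteView.
Variables (R : realType) (nu : {measure set (measurableTypeR R) -> \bar R}).
Hypothesis sf : sigma_finite setT nu.

(** A copy of the measure that carries the sigma-finiteness on which Tonelli's theorem
    depends. *)
Definition sigma_finite_view (_ : sigma_finite setT nu) :
  set (measurableTypeR R) -> \bar R := nu.

HB.instance Definition _ := Measure.on (sigma_finite_view sf).
HB.instance Definition _ :=
  Measure_isSigmaFinite.Build _ _ _ (sigma_finite_view sf) sf.

End SigmaFiniteView.

Section ZenSpace.
Variable R : realType.
Local Notation C := R[i].
Local Notation mR := (measurableTypeR R).
Local Notation leb := (@lebesgue_measure R).
Local Notation V := (Cplus R -> R[i]).
Variable nu : {measure set mR -> \bar R}.
Implicit Types (F G : V) (s : Cplus R).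
Hypothesis nu_supp : supported_nneg nu.
Hypothesis nu_doubling : doubling nu.
Local Open Scope ereal_scope.
Local Notation X := (zen_space nu).
Local Notation N := (nrm nu).

Lemma nu_fin (t : R) : (0 < t)%R -> nu `[0%R, t[%classic = (fine (nu `[0%R, t[%classic))%:E.
Proof.
by move=> t0; have [/(_ t t0)/andP[h1 h2] _] := nu_doubling;
  rewrite fineK // ge0_fin_numE // ltW.
Qed.

Lemma nu_sigma_finite : sigma_finite setT nu.
Proof.
exists (fun n => `]-oo, 0%R[%classic `|` `[0%R, n.+1%:R[%classic).
  apply/seteqP; split=> // x _.
  exists (Num.bound `|x|) => //=; rewrite !in_itv /=.
  have [x0|x0] := ltP x 0%R; [by left|right].
  apply: (le_lt_trans (ler_norm x)); apply: (lt_le_trans (archi_boundP (normr_ge0 x))).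
  by rewrite ler_nat.
move=> n; split; first by apply: measurableU.
apply: (@le_lt_trans _ _ (nu `]-oo, 0%R[%classic + nu `[0%R, n.+1%:R[%classic)).
  by apply: measureU2.
have -> : nu `]-oo, 0%R[%classic = 0 by exact: nu_supp.
rewrite add0e; have [/(_ n.+1%:R (ltr0Sn _ _))/andP[]] := nu_doubling.
by [].
Qed.

Lemma zen_point_evaluation (rho : R) : (0 < rho)%R ->
  exists2 c : R, (0 <= c)%R & forall F s, X F ->
    (rho <= complex.Re (val s))%R -> (cmod (F s) <= c * N F)%R.
Proof.
move=> r0.
pose nu' : {sigma_finite_measure set mR -> \bar R} :=
  sigma_finite_view nu_sigma_finite.
have := @point_evaluation R nu' rho r0; apply.
by have [h _] := nu_doubling; apply: h; rewrite divr_gt0.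
Qed.

Definition restrict (f : C -> C) : V := fun s => f (val s).

Lemma extend_restrict f z : hp z -> extend (restrict f) z = f z.
Proof. by move=> hz; rewrite (extend_val _ hz). Qed.

Lemma hol_ext (f g : C -> C) : (forall z, hp z -> f z = g z) -> hol f -> hol g.
Proof.
move=> fg hf z hz; apply: (@holat_near _ f g z (complex.Re z)) => //; last exact: hf.
move=> w wz; rewrite fg // /hp /=.
by have := le_lt_trans (Re_le_cmod _) wz; rewrite ReD ReN ltr_norml; lra.
Qed.

Lemma hol_restrict f : hol f -> hol (extend (restrict f)).
Proof. by apply: hol_ext => z hz; rewrite extend_restrict. Qed.

Lemma extendB F G z : extend (F - G)%R z = (extend F z - extend G z)%R.
Proof. by rewrite -scaleN1r extendD extendZ mulN1r. Qed.

(** Cauchy sequences converge uniformly on every half-plane Re z >= rho, to an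
    analytic limit; Fatou's lemma turns this into convergence in norm. *)
Lemma zen_complete (u : nat -> V) : (forall n, X (u n)) ->
  (forall e : R, (0 < e)%R -> exists n0, forall n m, (n0 <= n)%N -> (n0 <= m)%N ->
     (N (u n - u m)%R <= e)%R) ->
  exists F, [/\ X F,
    (forall e : R, (0 < e)%R -> exists n0, forall n, (n0 <= n)%N -> (N (u n - F)%R <= e)%R) &
    (forall s (e : R), (0 < e)%R -> exists n0, forall n, (n0 <= n)%N ->
       (cmod (u n s - F s) <= e)%R)].
Proof.
move=> Xu cu.
have uc : unif_cauchy (fun n => extend (u n)).
  move=> rho e r0 e0; have [c c0 cP] := zen_point_evaluation r0.
  have c1 : (0 < c + 1)%R by rewrite ltr_wpDl.
  have [n0 nP] := cu _ (divr_gt0 e0 c1); exists n0 => n m nn nm z rz.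
  have hz : hp z by apply: lt_le_trans rz.
  have := cP _ (exist _ z hz) (zenB (Xu n) (Xu m)).1 rz.
  rewrite !(extend_val _ hz) => /le_trans; apply.
  apply: (@le_trans _ _ (c * (e / (c + 1)))%R); first by rewrite ler_wpM2l // nP.
  by rewrite mulrA ler_pdivrMr // mulrC ler_pM2l // lerDl.
have [f fP] := unif_cauchy_lim uc.
have hf : hol f by apply: (weierstrass _ fP) => n; exact: zen_hol.
pose F := restrict f.
have hF := hol_restrict hf.
have uF s (e : R) : (0 < e)%R -> exists n0, forall n, (n0 <= n)%N ->
    (cmod (u n s - F s) <= e)%R.
  move=> e0; have [n0 nP] := fP (complex.Re (val s)) e (valP s) e0.
  by exists n0 => n /nP/(_ (val s) (lexx _)); rewrite extendE.
have fat n (e : R) n0 : (0 <= e)%R -> (forall m, (n0 <= m)%N -> (N (u n - u m)%R <= e)%R) ->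
    X (u n - F)%R /\ (N (u n - F)%R <= e)%R.
  move=> e0 ne; apply: (@zen_fatou _ nu (fun m => u n - u (n0 + m)%N)%R) => //.
  - have -> : extend (u n - F)%R = (fun z => extend (u n) z - extend F z)%R.
      by apply/funext => z; exact: extendB.
    by move=> z hz; apply: holatB; [exact: (zen_hol (Xu n))|exact: hF].
  - by move=> m; apply: (zenB _ _).1.
  - by move=> m; apply: ne; exact: leq_addr.
  move=> s d d0; have [n1 nP] := uF s d d0; exists n1 => m n1m.
  have -> : ((u n - u (n0 + m)%N) s - (u n - F) s = F s - u (n0 + m)%N s)%R.
    have E1 : ((u n - u (n0 + m)%N) s = u n s - u (n0 + m)%N s)%R by [].
    have E2 : ((u n - F) s = u n s - F s)%R by [].
    by rewrite E1 E2; ring.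
  by rewrite cmodBC; apply: nP; apply: leq_trans n1m _; exact: leq_addl.
exists F; split => //.
  have [n0 nP] := cu _ ltr01.
  have [XD _] := fat n0 1%R n0 ler01 (fun m => nP n0 m (leqnn _)).
  have -> : F = (u n0 - (u n0 - F))%R by rewrite opprB addrC subrK.
  by apply: (zenB _ _).1.
move=> e e0; have [n0 nP] := cu e e0; exists n0 => n nn.
by have [] := fat n e n0 (ltW e0) (fun m => nP n m nn).
Qed.

Lemma doubling_const : exists2 Q : R, (1 <= Q)%R & forall t : R, (0 < t)%R ->
  nu `[0%R, (2 * t)%R[%classic <= Q%:E * nu `[0%R, t[%classic.
Proof.
have [pos sfin] := nu_doubling; move: sfin; set S := ereal_sup _ => sfin.
exists (`|fine S| + 1)%R; first by rewrite lerDr.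
move=> t t0; have t20 : (0 < 2 * t)%R by rewrite mulr_gt0.
have S1 : nu `[0%R, (2 * t)%R[%classic / nu `[0%R, t[%classic <= S.
  by apply: ereal_sup_ubound; exists t.
move: S1; rewrite (nu_fin t0) (nu_fin t20) inver.
have v0 : (0 < fine (nu `[0%R, t[%classic))%R.
  by rewrite -lte_fin -nu_fin //; have /andP[] := pos t t0.
rewrite gt_eqF // -EFinM => S1.
have SE : S = (fine S)%:E.
  rewrite fineK // fin_numE gt_eqF ?lt_eqF //.
  by apply: lt_le_trans S1; rewrite ltNyr.
move: S1; rewrite SE -EFinM !lee_fin ler_pdivrMr // => /le_trans; apply.
by rewrite ler_wpM2r ?(ltW v0) // (le_trans (ler_norm _)) // lerDl.
Qed.

Lemma nu_dyadic (Q : R) : (1 <= Q)%R -> (forall t : R, (0 < t)%R ->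
  nu `[0%R, (2 * t)%R[%classic <= Q%:E * nu `[0%R, t[%classic) ->
  forall k, nu `[0%R, (2 ^+ k)%R[%classic <= ((Q ^+ k)%R)%:E * nu `[0%R, 1%R[%classic.
Proof.
move=> Q1 hQ; elim=> [|k IH]; first by rewrite !expr0 mul1e.
rewrite exprS; apply: (le_trans (hQ _ _)); first by rewrite exprn_gt0.
rewrite exprS EFinM -muleA; apply: lee_wpmul2l => //.
by rewrite lee_fin (le_trans ler01).
Qed.

Definition cauchy_kernel (n : nat) : V := fun s => ((val s + 1)^-1 ^+ n)%R.

Lemma hp_add1 (z : C) : hp z -> (z + 1 != 0)%R.
Proof.
move=> hz; apply/eqP => /(congr1 (@complex.Re R)); rewrite ReD /= => /eqP.
by rewrite gt_eqF // addr_gt0.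
Qed.

Lemma cmod_add1_ge1 (z : C) : hp z -> (1 <= cmod (z + 1))%R.
Proof.
move=> hz; apply: le_trans (Re_le_cmod _); rewrite ReD /=.
by apply: le_trans (ler_norm _); rewrite lerDr ltW.
Qed.

Lemma cauchy_kernel_hol n : hol (extend (cauchy_kernel n)).
Proof.
apply: (@hol_ext (fun z => (z + 1)^-1 ^+ n)%R) => z hz.
  by rewrite (extend_val _ hz).
apply: holatX; apply: holatV; first exact: hp_add1.
by apply: holatD; [exact: holat_id|exact: holat_cst].
Qed.

(** Dyadic boxes: outside the box of size 2^k the square of the kernel is at most
    4^(-kn), and by doubling the next box has measure at most a constant times (2Q)^k;
    the resulting series converges once 4 Q <= 4^n. *)
Lemma cauchy_kernel_in n : (exists2 Q : R, (1 <= Q)%R & (4 * Q <= 4 ^+ n)%R /\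
   forall k, nu `[0%R, (2 ^+ k)%R[%classic <= ((Q ^+ k)%R)%:E * nu `[0%R, 1%R[%classic) ->
  X (cauchy_kernel n).
Proof.
move=> [Q Q1 [Qn hQ]].
have hK := cauchy_kernel_hol n.
pose v := fine (nu `[0%R, 1%R[%classic).
have v0 : (0 <= v)%R by rewrite fine_ge0.
pose B k : set (mR * mR) := `[0%R, (2 ^+ k)%R[%classic `*` `](- 2 ^+ k)%R, (2 ^+ k)%R[%classic.
have mB k : measurable (B k) by apply: measurableX.
pose c k : R := (4 ^+ n * (4^-1 ^+ n) ^+ k)%R.
have c0 k : (0 <= c k)%R by rewrite mulr_ge0 // !exprn_ge0 // invr_ge0.
suff H : zsq nu (cauchy_kernel n) <= (4 * 4 ^+ n * v)%:E.
  split; first exact/analyticP.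
  by rewrite zen_norm_fin; apply: le_lt_trans H _; rewrite ltry.
apply: zsq_le => e e0; rewrite /slice.
pose h k (p : mR * mR) : \bar R := (c k)%:E * (\1_(B k) p)%:E.
have h0 k p : 0 <= h k p by rewrite mule_ge0 // lee_fin.
have mh k : measurable_fun (@rhalf R) (h k).
  apply: measurable_funeM; apply/measurable_EFinP; exact: measurable_indic.
apply: (@le_trans _ _ (\int[nu \x leb]_(p in @rhalf R) \sum_(k <oo) h k p)).
  apply: ge0_le_integral => //.
  - exact: rhalf_measurable.
  - by move=> p _; rewrite lee_fin exprn_ge0 // cmod_ge0.
  - by apply: measurable_funTS; exact: cmod_shift_measurable.
  - by apply: ge0_emeasurable_sum => // k p _; exact: h0.
  move=> [x y] /= x0; rewrite /rhalf /= in x0.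
  have [s [-> vs]] := extend_shift (cauchy_kernel n) y e0 x0.
  rewrite /cauchy_kernel vs cmodX cmodV.
  set r := cmod _.
  have hs : hp ((x + e)%R +i* y) by rewrite /hp /= ltr_wpDl.
  have r1 : (1 <= r)%R by exact: cmod_add1_ge1.
  have rx : (x <= r)%R.
    apply: le_trans (Re_le_cmod _); rewrite ReD /= (le_trans _ (ler_norm _)) //.
    by rewrite -addrA lerDl addr_ge0 // ltW.
  have ry : (`|y| <= r)%R.
    by apply: le_trans (Im_le_cmod _); rewrite ImD /= addr0.
  have r0 : (0 < r)%R by apply: lt_le_trans r1.
  suff [k Bk ck] : exists2 k, B k (x, y) & ((r^-1 ^+ n) ^+ 2 <= c k)%R.
    apply: (@le_trans _ _ (h k (x, y))).
      by rewrite /h indicE mem_set // mule1 lee_fin.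
    apply: (@le_trans _ _ (\sum_(0 <= j < k.+1) h j (x, y))).
      by rewrite big_nat_recr //= leeDr // sume_ge0.
    by apply: nneseries_lim_ge => j _ _; exact: h0.
  have [k0 Bk0] : exists k, B k (x, y).
    have := archi_boundP (ltW r0); set k := Num.bound _ => rk; exists k.
    have rk2 : (r < 2 ^+ k)%R.
      by apply: lt_le_trans rk _; rewrite -natrX ler_nat ltnW // ltn_expl.
    rewrite /B /= !in_itv /= x0 (le_lt_trans rx rk2); split => //.
    by move: (le_lt_trans ry rk2); rewrite ltr_norml.
  have ex : exists k, `[< B k (x, y) >] by exists k0; apply/asboolP.
  case: (ex_minnP ex) => k /asboolP Bk kmin; exists k => //.
  case: k Bk kmin => [|k] Bk kmin.
    rewrite /c expr0 mulr1 -exprM; apply: (@le_trans _ _ 1%R).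
      by rewrite exprn_ile1 ?invr_ge0 ?(ltW r0) // invf_le1.
    by rewrite exprn_ege1 // ler1n.
  have rk : (2 ^+ k <= r)%R.
    rewrite leNgt; apply/negP => rk.
    have : B k (x, y).
      rewrite /B /= !in_itv /= x0 (le_lt_trans rx rk); split => //.
      by move: (le_lt_trans ry rk); rewrite ltr_norml.
    by move=> /asboolP/kmin; rewrite ltnn.
  have -> : c k.+1 = ((2 ^+ k)^-1 ^+ n ^+ 2)%R.
    have E4 : (4 = 2 ^+ 2 :> R)%R by rewrite -natrX.
    rewrite /c exprS mulrA -exprMn divff // expr1n mul1r E4.
    by rewrite !exprVn -!exprM mulnC; congr (_^-1)%R; congr (_ ^+ _)%R; rewrite mulnCA mulnA.
  apply: lerXn2r; rewrite ?nnegrE ?exprn_ge0 ?invr_ge0 ?exprn_ge0 ?(ltW r0) //.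
  apply: lerXn2r; rewrite ?nnegrE ?invr_ge0 ?exprn_ge0 ?(ltW r0) //.
  by rewrite lef_pV2 // posrE ?exprn_gt0.
rewrite integral_nneseries //; last exact: rhalf_measurable.
apply: lime_le; first by apply: is_cvg_nneseries => k _ _; apply: integral_ge0.
apply: nearW => m.
apply: (@le_trans _ _ (\sum_(0 <= k < m) ((2 * 4 ^+ n * v) * 2^-1 ^+ k)%R%:E)); last first.
  rewrite sumEFin lee_fin -mulr_sumr.
  have -> : (4 * 4 ^+ n * v = (2 * 4 ^+ n * v) * 2)%R by ring.
  apply: ler_wpM2l; first by rewrite !mulr_ge0 // exprn_ge0.
  have -> : (\sum_(0 <= k < m) 2^-1 ^+ k = 2 - 2 * 2^-1 ^+ m :> R)%R.
    elim: m => [|m IH]; first by rewrite big_geq // expr0; ring.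
    by rewrite big_nat_recr //= IH exprS; field.
  by rewrite gerBl mulr_ge0 // exprn_ge0 // invr_ge0.
apply: lee_sum => k _.
have -> : \int[nu \x leb]_(p in @rhalf R) h k p = (c k)%:E * (nu \x leb) (B k).
  rewrite ge0_integralZl //; try exact: (c0 k); try exact: rhalf_measurable;
    try (by apply/measurable_EFinP; exact: measurable_indic).
  rewrite integral_indic; [|exact: rhalf_measurable|exact: mB].
  congr (_ * _); congr (product_measure1 _ _ _); apply/setIidl.
  by move=> p [] /=; rewrite in_itv /= => /andP[].
have -> : (nu \x leb) (B k) = nu `[0%R, (2 ^+ k)%R[%classic * (2 * 2 ^+ k)%:E.
  have LE : leb `](- 2 ^+ k)%R, (2 ^+ k)%R[%classic = (2 * 2 ^+ k)%:E.
    by rewrite lebesgue_measure_itv /= lte_fin gtrN ?exprn_gt0 // -EFinD; congr EFin; ring.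
  by rewrite product_measure1E //; congr (_ * _); exact: LE.
apply: (@le_trans _ _ ((c k)%:E * ((((Q ^+ k)%R)%:E * v%:E) * (2 * 2 ^+ k)%:E))).
  apply: lee_wpmul2l; first by rewrite lee_fin.
  apply: lee_wpmul2r; first by rewrite lee_fin mulr_ge0 // exprn_ge0.
  by rewrite /v -nu_fin // hQ.
rewrite -!EFinM lee_fin /c.
have -> : (4 ^+ n * 4^-1 ^+ n ^+ k * (Q ^+ k * v * (2 * 2 ^+ k)) =
   2 * 4 ^+ n * v * (2 * Q / 4 ^+ n) ^+ k)%R.
  by rewrite !exprMn !exprVn -!exprM; ring.
apply: ler_wpM2l; first by rewrite !mulr_ge0 // exprn_ge0.
have Q0 : (0 <= Q)%R by apply: le_trans Q1.
apply: lerXn2r; rewrite ?nnegrE ?invr_ge0 ?divr_ge0 ?mulr_ge0 ?exprn_ge0 //.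
by rewrite ler_pdivrMr ?exprn_gt0 //; lra.
Qed.

Lemma cauchy_kernel_zen : exists n0, forall n, (n0 <= n)%N -> X (cauchy_kernel n).
Proof.
have [Q Q1 hQ] := doubling_const.
have Q0 : (0 <= Q)%R by apply: le_trans Q1.
have := archi_boundP Q0; set m := Num.bound _ => Qm; exists m.+1 => n mn.
apply: cauchy_kernel_in; exists Q => //; split; last exact: nu_dyadic.
apply: (@le_trans _ _ (4 * 4 ^+ m)%R).
  rewrite ler_pM2l //; apply: ltW; apply: lt_le_trans Qm _.
  by rewrite -natrX ler_nat ltnW // ltn_expl.
by rewrite -exprS; apply: ler_weXn2l => //; rewrite ler1n.
Qed.

End ZenSpace.

(** * Auxiliary limits and the calculus of the transport equation *)

Section SmallParameters.
Variable R : realType.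
Implicit Types e : R.

Lemma inv_small e : 0 < e -> exists n0, forall n, (n0 <= n)%N -> n.+1%:R^-1 <= e.
Proof.
move=> e0; exists (Num.bound e^-1) => n nn; rewrite invf_ple ?posrE ?ltr0Sn //.
apply: ltW; apply: (lt_le_trans (archi_boundP _)); first by rewrite invr_ge0 ltW.
by rewrite ler_nat (leq_trans nn).
Qed.

Lemma cvg_at_right0 (q : R -> \bar R) : (forall t, 0 < t -> exists2 r, 0 <= r & q t = r%:E) ->
  (q t @[t --> 0^'+] --> 0%E) <->
  (forall e, 0 < e -> exists2 k : R, 0 < k & forall t, 0 < t < k -> (q t <= e%:E)%E).
Proof.
move=> qE; split=> [/fine_cvgP[_ /cvgrPdist_le qc] e e0|qk].
  have [/= k k0 kP] := qc e e0; exists k => // t /andP[t0 tk].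
  have := kP t; rewrite /= sub0r normrN gtr0_norm // => /(_ tk t0).
  have [r r0 ->] := qE t t0; rewrite /= sub0r normrN ger0_norm //.
apply/fine_cvgP; split.
  exists 1 => //= t _ t0; have [r _ ->] := qE t t0; exact: fin_numE.
apply/cvgrPdist_le => e e0; have [k k0 kP] := qk e e0.
exists k => //= t; rewrite /= sub0r normrN => tk t0; rewrite gtr0_norm // in tk.
have := kP t; rewrite t0 tk => /(_ isT); have [r r0 ->] := qE t t0.
by rewrite /= sub0r normrN ger0_norm // lee_fin.
Qed.

End SmallParameters.

Section Subdivision.
Variable R : realType.

(** What is additive in the interval and true for short intervals is true for all of
    them; this replaces explicit subdivisions and their Riemann sums. *)
Lemma interval_subdivision (P : R -> R -> Prop) (d k : R) : 0 < k ->
  (forall a m b, 0 <= a -> a <= m -> m <= b -> b <= d -> P a m -> P m b -> P a b) ->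
  (forall a b, 0 <= a -> a <= b -> b <= d -> b - a <= k -> P a b) ->
  forall a b, 0 <= a -> a <= b -> b <= d -> P a b.
Proof.
move=> k0 PD Pk a b a0 ab bd.
have H n : forall a, 0 <= a -> a <= b -> b - a <= k *+ n.+1 -> P a b.
  elim: n => [|n IH] {}a {}a0 {}ab h; first exact: Pk.
  have [h1|h1] := leP (b - a) k; first exact: Pk.
  apply: (PD a (a + k) b) => //; try lra.
    by apply: Pk; lra.
  by apply: IH; rewrite ?mulrS in h *; lra.
apply: (H (Num.bound ((b - a) / k))) => //.
have := archi_boundP (divr_ge0 (_ : 0 <= b - a) (ltW k0)); rewrite subr_ge0 => /(_ ab).
rewrite ltr_pdivrMr // => /ltW h; apply: (le_trans h); rewrite mulrC mulr_natr.
by apply: ler_wpMn2l; [exact: ltW|].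
Qed.

End Subdivision.

Section Transport.
Variable R : realType.
Local Notation C := R[i].
Implicit Types (u v : R -> C -> C) (z w l : C) (s t a b : R).

(** Time is embedded in the complex numbers so that derivatives in time obey the rules
    already proved for complex derivatives along a set. *)
Definition tset a b : set C := [set w | exists2 t, a <= t <= b & w = t%:C].

Lemma tset_ccont (c : R -> C) a b s : a <= s <= b -> segcont c a b ->
  ccont (tset a b) (fun w => c (complex.Re w)) s%:C.
Proof.
move=> sab cc e e0; have [k k0 kP] := cc s sab e e0; exists k => // _ [t tab ->].
by rewrite -rmorphB cmodR => h; apply: kP.
Qed.

Lemma ccont_segcont (c : R -> C) a b :
  (forall s, a <= s <= b -> ccont (tset a b) (fun w => c (complex.Re w)) s%:C) ->
  segcont c a b.
Proof.
move=> cc s sab e e0; have [k k0 kP] := cc s sab e e0; exists k => // t tab h.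
by have := kP t%:C; rewrite -rmorphB cmodR; apply=> //; exists t.
Qed.

Variables (G : C -> C) (d : R).

(** The transport equation du/dt = G du/dz with the derivative from the right
    in time; its solutions are closed under all holomorphic operations, by the
    chain rule in both variables. *)
Definition transp u s z := exists l, cdiff setT (u s) z l /\
  cdiff (tset s d) (fun w => u (complex.Re w) z) s%:C (G z * l).

Lemma transp_cst (k : C) s z : transp (fun _ _ => k) s z.
Proof. by exists 0; rewrite mulr0; split; exact: cdiff_cst. Qed.

Lemma transpD u v s z : transp u s z -> transp v s z ->
  transp (fun t w => u t w + v t w) s z.
Proof.
move=> [l [a1 a2]] [m [b1 b2]]; exists (l + m); split; first exact: cdiffD.
by rewrite mulrDr; exact: cdiffD.
Qed.

Lemma transpM u v s z : transp u s z -> transp v s z ->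
  transp (fun t w => u t w * v t w) s z.
Proof.
move=> [l [a1 a2]] [m [b1 b2]]; exists (l * v s z + u s z * m); split; first exact: cdiffM.
have := cdiffM a2 b2; rewrite /= => H.
rewrite (_ : G z * (l * v s z + u s z * m) = G z * l * v s z + u s z * (G z * m)) //.
by ring.
Qed.

Lemma transpV u s z : u s z != 0 -> transp u s z ->
  transp (fun t w => (u t w)^-1) s z.
Proof.
move=> u0 [l [a1 a2]]; exists (- l / u s z ^+ 2); split; first exact: cdiffV.
have := @cdiffV _ (tset s d) (fun w => u (complex.Re w) z) s%:C _ u0 a2.
by rewrite /= mulrA mulrN.
Qed.

Lemma transp_comp (f : C -> C) u s z : holat f (u s z) -> transp u s z ->
  transp (fun t w => f (u t w)) s z.
Proof.
move=> [m df] [l [a1 a2]]; exists (m * l); split.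
  exact: (@cdiff_comp _ setT setT (u s) f z l m a1 df (fun _ _ => I)).
rewrite mulrCA.
exact: (@cdiff_comp _ (tset s d) setT (fun w => u (complex.Re w) z) f s%:C _ m a2 df (fun _ _ => I)).
Qed.

Lemma transp_increment u s z l b : b <= d -> transp u s z -> cdiff setT (u s) z l ->
  forall eta : R, 0 < eta -> exists2 k : R, 0 < k &
      forall t, s < t < s + k -> t <= b ->
        cmod (u t z - u s z - (t - s)%:C * (G z * l)) <= eta * (t - s).
Proof.
move=> bd [m [a1 a2]] dl eta e0; rewrite (cdiff_unique dl a1).
have [k k0 kP] := a2 eta e0; exists k => // t /andP[st tk] tb.
have := kP t%:C; rewrite -rmorphB cmodR gtr0_norm ?subr_gt0 // [_%:C * _]mulrC.
by apply; [exists t => //; rewrite ltW //= (le_trans tb)|lra].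
Qed.

End Transport.

(** * Strongly continuous semigroups on a Zen space *)

Section Semigroup.
Variable R : realType.
Local Notation C := R[i].
Local Notation mR := (measurableTypeR R).
Local Notation V := (Cplus R -> R[i]).
Variable nu : {measure set mR -> \bar R}.
Hypothesis nu_supp : supported_nneg nu.
Hypothesis nu_doubling : doubling nu.
Variable T : R -> V -> V.
Hypothesis T_C0 : C0_semigroup (zen_space nu) (zen_norm nu) T.
Implicit Types (f g : V) (s : Cplus R) (t u a b e h : R) (z : C).
Local Notation X := (zen_space nu).
Local Notation N := (nrm nu).

Lemma zen_sg_in t f : 0 <= t -> X f -> X (T t f).
Proof. by move=> t0; have [H _ _ _] := T_C0; have [h _ _] := H t t0; exact: h. Qed.

Lemma zen_sg_lin t (a : C) f g : 0 <= t -> X f -> X g ->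
  T t (a *: f + g) = a *: T t f + T t g.
Proof. by move=> t0; have [H _ _ _] := T_C0; have [_ h _] := H t t0 => ? ?; exact: h. Qed.

Lemma zen_sg0 f : X f -> T 0 f = f.
Proof. by have [_ h _ _] := T_C0 => ?; exact: h. Qed.

Lemma zen_sg_add t u f : 0 <= t -> 0 <= u -> X f -> T (t + u) f = T t (T u f).
Proof. by have [_ _ h _] := T_C0 => *; exact: h. Qed.

Lemma zen0 : X (0 : V) /\ N (0 : V) = 0.
Proof.
have [n0 n0P] := cauchy_kernel_zen nu_doubling.
have [X0 h0] := zenZ 0 (n0P n0 (leqnn _)).
rewrite scale0r in X0 h0; split=> //; apply/eqP; rewrite eq_le nrm_ge0 andbT.
by rewrite cmod0 mul0r in h0.
Qed.

Lemma zen_sg_bounded t : 0 <= t ->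
  exists2 M : R, 0 <= M & forall f, X f -> N (T t f) <= M * N f.
Proof.
move=> t0; have [H _ _ _] := T_C0; have [zen_sg_in _ [M MP]] := H t t0.
exists `|M| => // f Xf; have := MP f Xf.
rewrite (zen_normK Xf) (zen_normK (zen_sg_in f Xf)) -EFinM lee_fin => /le_trans; apply.
by rewrite ler_wpM2r ?nrm_ge0 // ler_norm.
Qed.

Lemma zen_sgZ t (a : C) f : 0 <= t -> X f -> T t (a *: f) = a *: T t f.
Proof.
move=> t0 Xf; have := zen_sg_lin (-1) t0 Xf Xf; rewrite !scaleN1r !addNr => T0.
by have := zen_sg_lin a t0 Xf zen0.1; rewrite T0 !addr0.
Qed.

Lemma zen_sgD t f g : 0 <= t -> X f -> X g -> T t (f + g) = T t f + T t g.
Proof. by move=> t0 Xf Xg; have := zen_sg_lin 1 t0 Xf Xg; rewrite !scale1r. Qed.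

Lemma zen_sgB t f g : 0 <= t -> X f -> X g -> T t (f - g) = T t f - T t g.
Proof.
move=> t0 Xf Xg; have [XN _] := zenZ (-1) Xg.
by rewrite -(scaleN1r g) -(scaleN1r (T t g)) (zen_sgD t0 Xf XN) (zen_sgZ _ t0 Xg).
Qed.

Lemma zen_sg_continuous f e : X f -> 0 < e ->
  exists2 k : R, 0 < k & forall t, 0 <= t < k -> N (T t f - f) <= e.
Proof.
move=> Xf e0; have [_ _ _ /(_ f Xf)] := T_C0.
have XD t : 0 <= t -> X (T t f - f).
  by move=> t0; exact: (zenB (zen_sg_in t0 Xf) Xf).1.
have qE t : 0 < t -> exists2 r, 0 <= r & zen_norm nu (T t f - f) = r%:E.
  by move=> /ltW t0; exists (N (T t f - f)); [exact: nrm_ge0|exact: zen_normK (XD t t0)].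
have [H _] := cvg_at_right0 qE.
move=> /H/(_ e e0)[k k0 kP]; exists k => // t /andP[t0 tk].
have [->|tn0] := eqVneq t 0.
  by rewrite zen_sg0 // subrr zen0.2 ltW.
have t0' : 0 < t by rewrite lt_def tn0.
have := kP t; rewrite t0' tk => /(_ isT).
by rewrite (zen_normK (XD t t0)) lee_fin.
Qed.

(** The uniform boundedness principle near t = 0, by a gliding hump: were it false,
    a norm convergent sum could be built at whose value the operators T_t are
    unbounded as t tends to 0, against the strong continuity. *)
Lemma zen_sg_locally_bounded : exists d M : R, [/\ 0 < d, 0 <= M &
  forall t f, 0 <= t <= d -> X f -> N (T t f) <= M * N f].
Proof.
apply: contrapT => nb.
have big (n : nat) (eta : R) : 0 < eta -> exists t g, [/\ 0 <= t <= n.+1%:R^-1, X g,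
    N g <= eta & n%:R <= N (T t g)].
  move=> eta0; apply: contrapT => H; apply: nb.
  exists n.+1%:R^-1, (n%:R / eta); split=> //; first by rewrite divr_ge0 // ltW.
  move=> t f tn Xf; rewrite leNgt; apply/negP => lt; apply: H.
  have /andP[t0 _] := tn.
  have Nf0 : 0 < N f.
    rewrite lt_def nrm_ge0 andbT; apply/eqP => Nf; move: lt.
    have [M _ MP] := zen_sg_bounded t0.
    by rewrite Nf mulr0 ltNge (le_trans (MP f Xf)) // Nf mulr0.
  pose c : C := (eta / N f)%:C.
  have cE : cmod c = eta / N f by rewrite cmodR ger0_norm // divr_ge0 // ltW.
  have [Xc hc] := zenZ c Xf.
  exists t, (c *: f); split; [exact: tn|exact: Xc| |].
    by apply: (le_trans hc); rewrite cE divfK ?gt_eqF.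
  rewrite (zen_sgZ c t0 Xf).
  have [_] := zenZ (c^-1) (zenZ c (zen_sg_in t0 Xf)).1.
  have c0 : c != 0 by rewrite -cmod_gt0 cE divr_gt0.
  rewrite scalerA (mulVf c0) scale1r cmodV cE invf_div => h.
  have := lt_le_trans lt h.
  have d0 : 0 < N f / eta by rewrite divr_gt0.
  rewrite mulrAC -mulrA [_ * N (c *: _)]mulrC -[n%:R * _]/(n%:R * (N f / eta)).
  by rewrite (ltr_pM2r d0) => /ltW.
have step (w : nat * (V * R)) : exists w' : V * R * R,
    X w.2.1 -> 0 < w.2.2 -> [/\ X w'.1.1 /\ N (w'.1.1 - w.2.1) <= w.2.2,
      0 <= w'.2 <= w.1.+1%:R^-1, w.1%:R <= N (T w'.2 w'.1.1),
      0 < w'.1.2 <= w.2.2 / 2 & forall h : V, X h -> N h <= 2 * w'.1.2 -> N (T w'.2 h) <= 1].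
  case: w => n [x eta] /=.
  have [Xx|] := pselect (X x); last by exists (x, eta, 0).
  have [eta0|] := pselect (0 < eta); last by exists (x, eta, 0).
  have [t [g [tn Xg gn gT]]] := big n eta eta0; have /andP[t0 _] := tn.
  have [M M0 MP] := zen_sg_bounded t0.
  have XTg := zen_sg_in t0 Xg; have XTx := zen_sg_in t0 Xx.
  have [x' [Xx' x'x x'T]] : exists x', [/\ X x', N (x' - x) <= eta & n%:R <= N (T t x')].
    (* T g is half the difference of T (x + g) and T (x - g), so one of them is large. *)
    have [h1|h1] := leP n%:R (N (T t (x + g))).
      exists (x + g); split; [exact: (zenD Xx Xg).1| |exact: h1].
      by rewrite addrC addKr.
    have [XN1 XN2] := zenZ (-1) Xg; rewrite cmodN cmod1 mul1r scaleN1r in XN1 XN2.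
    exists (x - g); split; first exact: (zenB Xx Xg).1.
      by rewrite addrC addKr (le_trans XN2).
    rewrite leNgt; apply/negP => h2.
    rewrite (zen_sgD t0 Xx Xg) in h1; rewrite (zen_sgB t0 Xx Xg) in h2.
    have E : T t g = (2^-1 : C) *: ((T t x + T t g) - (T t x - T t g)).
      rewrite opprB addrC addrA subrK -mulr2n -[X in _ = _ *: X]scaler_nat scalerA.
      by rewrite mulVf ?scale1r.
    have Z := zenB (zenD XTx XTg).1 (zenB XTx XTg).1.
    have := (zenZ (2^-1) Z.1).2; rewrite -E cmodV.
    have -> : cmod (2 : C) = 2 by rewrite -[2 : C](rmorph_nat (@real_complex R)) cmodR ger0_norm.
    move: Z.2 h1 h2 gT; move: (N _) (N _) (N _) (N _) => p q r u; lra.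
  have M1 : 0 < M + 1 by rewrite ltr_wpDl.
  (* Later increments are so small that T_t cannot enlarge their sum beyond 1. *)
  exists (x', Num.min (eta / 2) (1 / (2 * (M + 1))), t) => _ _ /=; split=> //.
    by rewrite lt_min !divr_gt0 ?mulr_gt0 //= ge_min lexx.
  move=> h Xh; rewrite minr_pMr // le_min => /andP[_ Nh].
  apply: (le_trans (MP h Xh)); apply: (@le_trans _ _ ((M + 1) * N h)).
    by rewrite ler_wpM2r ?nrm_ge0 // lerDl.
  rewrite mulrA ler_pdivlMr ?mulr_gt0 // in Nh.
  move: (nrm_ge0 nu h) Nh M0; move: (N h) => p; lra.
have [S SP] := choice step.
pose w := fix w n : V * R * R := if n is k.+1 then S (k, (w k).1) else (0, 1, 0).
have wP n : X (w n).1.1 /\ 0 < (w n).1.2 <= 2^-1 ^+ n.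
  elim: n => [|n [Xn /andP[en eb]]] /=; first by rewrite expr0 ltr01 lexx; split=> //; exact: zen0.1.
  have [[h1 _] _ _ /andP[h2 h3] _] := SP (n, (w n).1) Xn en; split=> //; rewrite h2 /=.
  by apply: (le_trans h3); rewrite exprSr ler_wpM2r.
have wS n := SP (n, (w n).1) (wP n).1 (proj1 (andP (wP n).2)).
pose x n := (w n).1.1; pose eta n := (w n).1.2.
have Xx n : X (x n) := (wP n).1.
have etaS n : eta n.+1 <= eta n / 2 by have [_ _ _ /andP[]] := wS n.
have eta0 n : 0 < eta n by have [_ /andP[]] := wP n.
have xd n k : N (x (n + k)%N - x n) <= 2 * (eta n - eta (n + k)%N).
  elim: k => [|k IH]; first by rewrite addn0 !subrr zen0.2 mulr0.
  have [[_ h] _ _ _ _] := wS (n + k)%N.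
  rewrite addnS; apply: (le_trans (nrm_triangle (Xx _) (Xx (n + k)%N) (Xx _))).
  have := etaS (n + k)%N; rewrite -/(x _) -/(eta _) in h *; move: h IH; move: (N _) (N _) (eta _) (eta _) (eta _) => p q r u v; lra.
have xd2 n k : N (x (n + k)%N - x n) <= 2 * eta n.
  by apply: (le_trans (xd n k)); have := eta0 (n + k)%N; lra.
have etas e : 0 < e -> exists n, eta n <= e.
  move=> e0; have h2 : 0 <= (2^-1 : R) < 1 by apply/andP; split; lra.
  have [n ne] := geo_small h2 e0; exists n.
  by apply: le_trans (ltW ne); have [_ /andP[]] := wP n.
have [|y [Xy yN _]] := zen_complete nu_supp nu_doubling Xx.
  move=> e e0; have e4 : 0 < e / 4 by rewrite divr_gt0.
  have [n0 ne] := etas _ e4; exists n0 => n m /subnKC <- /subnKC <-.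
  apply: (le_trans (nrm_triangle (Xx _) (Xx n0) (Xx _))).
  rewrite (nrmBC (Xx n0) (Xx _)).
  move: (xd2 n0 (n - n0)%N) (xd2 n0 (m - n0)%N) ne; move: (N _) (N _) (eta _) => p q r; lra.
have xy n : N (x n - y) <= 2 * eta n.
  apply/ler_addgt0Pr => e e0; have [k kP] := yN e e0.
  apply: (le_trans (nrm_triangle (Xx n) (Xx (n + k)%N) Xy)).
  rewrite (nrmBC (Xx n) (Xx (n + k)%N)).
  move: (kP (n + k)%N (leq_addl _ _)) (xd2 n k); move: (N _) (N _) (eta n) => p q r; lra.
have [k k0 kP] := zen_sg_continuous Xy ltr01.
pose n := maxn (Num.bound (k^-1)) (Num.bound (N y + 2)).
have [_ /andP[t0 tn] Tn _ Ts] := wS n.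
have tk : (w n.+1).2 < k.
  apply: (le_lt_trans tn); rewrite invf_plt ?posrE ?ltr0Sn //.
  apply: (lt_le_trans (archi_boundP _)); first by rewrite invr_ge0 ltW.
  by rewrite ler_nat; apply: leq_trans (leqnSn _); exact: leq_maxl.
have h1 := kP (w n.+1).2; rewrite t0 tk in h1; have {}h1 := h1 isT.
have XB : X (x n.+1 - y) := (zenB (Xx n.+1) Xy).1.
have h2 := Ts _ XB (xy n.+1).
rewrite -/(w n.+1) in h2 Tn; rewrite zen_sgB // in h2.
have XTx := zen_sg_in t0 (Xx n.+1); have XTy := zen_sg_in t0 Xy.
have h3 : N (T (w n.+1).2 (x n.+1)) <= 1 + (1 + N y).
  have -> : T (w n.+1).2 (x n.+1) = (T (w n.+1).2 (x n.+1) - T (w n.+1).2 y) +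
      ((T (w n.+1).2 y - y) + y) by rewrite !subrK.
  have XB1 := zenB XTx XTy; have XB2 := zenB XTy Xy; have XB3 := zenD XB2.1 Xy.
  apply: (le_trans (zenD XB1.1 XB3.1).2); apply: lerD => //.
    by apply: (le_trans XB3.2); rewrite lerD2r.
have h4 : N y + 2 < n%:R.
  apply: (lt_le_trans (archi_boundP _)); first by rewrite addr_ge0 ?nrm_ge0.
  by rewrite ler_nat leq_maxr.
have : n%:R <= N (T (w n.+1).2 (x n.+1)) by exact: Tn.
by move: h3 h4; move: (N _) (N _) => p q; lra.
Qed.

Variables d M : R.
Hypothesis d0 : 0 < d.
Hypothesis M0 : 0 <= M.
Hypothesis T_bd : forall t f, 0 <= t <= d -> X f -> N (T t f) <= M * N f.

Lemma nrmZR (x : R) f : 0 <= x -> X f -> N (x%:C *: f) <= x * N f.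
Proof. by move=> x0 Xf; have := (zenZ x%:C Xf).2; rewrite cmodR ger0_norm. Qed.

(** The increment from a to b is the image under T_a of an increment that starts at
    time 0. *)
Lemma orbit_modulus f a b : 0 <= a -> a <= b -> b <= d -> X f ->
  N (T b f - T a f) <= M * N (T (b - a) f - f).
Proof.
move=> a0 ab bd Xf; have ba0 : 0 <= b - a by rewrite subr_ge0.
have XT := zen_sg_in ba0 Xf.
have -> : T b f - T a f = T a (T (b - a) f - f).
  rewrite (zen_sgB a0 XT Xf) -(zen_sg_add a0 ba0 Xf).
  by rewrite [a + _]addrC subrK.
by apply: T_bd; [rewrite a0 (le_trans ab)|exact: (zenB XT Xf).1].
Qed.

Lemma orbit_unif f e : X f -> 0 < e -> exists2 k, 0 < k & forall a b,
  0 <= a <= d -> 0 <= b <= d -> `|b - a| < k -> N (T b f - T a f) <= e.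
Proof.
move=> Xf e0; have M1 : 0 < M + 1 by rewrite ltr_wpDl.
have [k k0 kP] := zen_sg_continuous Xf (divr_gt0 e0 M1).
exists k => // a b abd bbd bak.
wlog ab : a b abd bbd bak / a <= b.
  move=> H; have [ab|/ltW ba] := leP a b; first exact: H.
  move: (abd) (bbd) => /andP[a0 _] /andP[b0 _].
  by rewrite (nrmBC (zen_sg_in b0 Xf) (zen_sg_in a0 Xf)); apply: H => //; rewrite distrC.
move: (abd) (bbd) => /andP[a0 _] /andP[b0 bd].
apply: (le_trans (orbit_modulus a0 ab bd Xf)).
have /kP : 0 <= b - a < k.
  by rewrite subr_ge0 ab; apply: le_lt_trans bak; exact: ler_norm.
rewrite ler_pdivlMr //; have := nrm_ge0 nu (T (b - a) f - f).
by move: (N _) => p p0 h; apply: le_trans h; rewrite mulrDr mulr1 mulrC lerDl.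
Qed.

Lemma orbit_segcont f s : X f -> segcont (fun t => T t f s) 0 d.
Proof.
move=> Xf a ad e e0.
have [c c0 cP] := zen_point_evaluation nu_supp nu_doubling (valP s).
have c1 : 0 < c + 1 by rewrite ltr_wpDl.
have [k k0 kP] := orbit_unif Xf (divr_gt0 e0 c1); exists k => // b bd bak.
move: (ad) (bd) => /andP[a0 _] /andP[b0 _].
have XB := (zenB (zen_sg_in b0 Xf) (zen_sg_in a0 Xf)).1.
apply: (le_trans (cP _ s XB (lexx _))).
have := kP a b ad bd bak; rewrite ler_pdivlMr //.
have := nrm_ge0 nu (T b f - T a f); move: (N _) => p p0 h.
by apply: le_trans h; rewrite mulrDr mulr1 mulrC lerDl.
Qed.

Lemma orbit_segcont_sub f s a b : 0 <= a -> b <= d -> X f ->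
  segcont (fun t => T t f s) a b.
Proof. by move=> a0 bd Xf; exact: segcont_sub a0 bd (orbit_segcont s Xf). Qed.

Definition orb f a b : V := fun s => cint (fun t => T t f s) a b.

Lemma orb_split f a m b : 0 <= a -> a <= m -> m <= b -> b <= d -> X f ->
  orb f a b = orb f a m + orb f m b.
Proof.
move=> a0 am mb bd Xf; apply/funext => s; rewrite /orb; apply: cint_split.
  by rewrite am.
exact: orbit_segcont_sub.
Qed.

Lemma orb_point f a b c e s : 0 <= a -> a <= b -> b <= d -> X f -> 0 <= c ->
  (forall g, X g -> cmod (g s) <= c * N g) ->
  (forall t, a <= t <= b -> N (T t f - T a f) <= e) ->
  cmod (orb f a b s - (b - a)%:C * T a f s) <= 2 * (c * e) * (b - a).
Proof.
move=> a0 ab bd Xf c0 cP h.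
have h1 := orbit_segcont_sub s a0 bd Xf.
have h2 := segcont_cst (T a f s) (a:=a) (b:=b).
rewrite mulrC -cint_cst // /orb -(cintB h1 h2); apply: cint_bound => //.
  have h3 := segcontD h1 (segcontZ (-1) h2).
  by apply: segcont_ext h3 => t _; rewrite mulN1r.
move=> t atb; have /andP[ta _] := atb; have t0 := le_trans a0 ta.
have XB := (zenB (zen_sg_in t0 Xf) (zen_sg_in a0 Xf)).1.
by apply: (le_trans (cP _ XB)); rewrite ler_wpM2l //; exact: h.
Qed.

(** Elements of the space that play the role of Riemann sums: they are close to the
    integral at every point, and as close as the orbit to a constant. *)
Lemma orb_approx f e a b : X f -> 0 < e -> 0 <= a -> a <= b -> b <= d ->
  exists S, [/\ X S,
   (forall s c, 0 <= c -> (forall g, X g -> cmod (g s) <= c * N g) ->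
      cmod (orb f a b s - S s) <= 2 * (c * e) * (b - a)) &
   forall g e', X g -> (forall t, a <= t <= b -> N (T t f - g) <= e') ->
      N (S - (b - a)%:C *: g) <= (b - a) * e'].
Proof.
move=> Xf e0; have [k k0 kP] := orbit_unif Xf e0.
have k2 : 0 < k / 2 by rewrite divr_gt0.
move: a b; apply: (interval_subdivision k2) => a.
  move=> m b a0 am mb bd [S [XS pS nS]] [S' [XS' pS' nS']].
  exists (S + S'); split; first exact: (zenD XS XS').1.
    move=> s c c0 cP; rewrite (orb_split a0 am mb bd Xf).
    rewrite -[(orb f a m + _) s]/(orb f a m s + orb f m b s) -[(S + S') s]/(S s + S' s).
    have -> : orb f a m s + orb f m b s - (S s + S' s) =
      (orb f a m s - S s) + (orb f m b s - S' s) by ring.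
    apply: (le_trans (cmodD _ _)).
    by have := pS s c c0 cP; have := pS' s c c0 cP; move: (cmod _) (cmod _) => p q; lra.
  move=> g e' Xg h.
  have h1 : N (S - (m - a)%:C *: g) <= (m - a) * e'.
    by apply: nS => // t /andP[t1 t2]; apply: h; rewrite t1 (le_trans t2).
  have h2 : N (S' - (b - m)%:C *: g) <= (b - m) * e'.
    by apply: nS' => // t /andP[t1 t2]; apply: h; rewrite t2 andbT (le_trans am).
  have -> : S + S' - (b - a)%:C *: g =
      (S - (m - a)%:C *: g) + (S' - (b - m)%:C *: g).
    have -> : b - a = (m - a) + (b - m) by ring.
    by rewrite rmorphD scalerDl opprD addrACA.
  have X1 := (zenB XS (zenZ (m - a)%:C Xg).1).1.
  have X2 := (zenB XS' (zenZ (b - m)%:C Xg).1).1.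
  apply: (le_trans (zenD X1 X2).2); apply: (le_trans (lerD h1 h2)).
  by rewrite -mulrDl addrC addrA subrK.
move=> b a0 ab bd bak; exists ((b - a)%:C *: T a f).
have XT := zen_sg_in a0 Xf; split; first exact: (zenZ _ XT).1.
  move=> s c c0 cP; apply: orb_point => // t /andP[t1 t2]; apply: kP.
  - by rewrite a0 (le_trans ab).
  - by rewrite (le_trans a0) // (le_trans t2).
  by rewrite ger0_norm ?subr_ge0 //; lra.
move=> g e' Xg h; rewrite -scalerBr; apply: (le_trans (nrmZR _ (zenB XT Xg).1)).
  by rewrite subr_ge0.
by rewrite ler_wpM2l ?subr_ge0 //; apply: h; rewrite lexx.
Qed.

(** The approximations converge uniformly on every half-plane Re z >= rho, so that the
    integral is analytic; Fatou's lemma puts it into the space and keeps the bound. *)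
Lemma orb_zen f a b : X f -> 0 <= a -> a <= b -> b <= d -> X (orb f a b) /\
  forall g e', X g -> 0 <= e' -> (forall t, a <= t <= b -> N (T t f - g) <= e') ->
  N (orb f a b - (b - a)%:C *: g) <= (b - a) * e'.
Proof.
move=> Xf a0 ab bd; have ba0 : 0 <= b - a by rewrite subr_ge0.
have e0 (n : nat) : 0 < n.+1%:R^-1 :> R by rewrite invr_gt0.
have [S SP] := choice (fun n => orb_approx Xf (e0 n) a0 ab bd).
have XS n : X (S n) by have [] := SP n.
have pe rho : 0 < rho -> forall e, 0 < e -> exists n0, forall n, (n0 <= n)%N ->
    forall s, rho <= complex.Re (val s) -> cmod (S n s - orb f a b s) <= e.
  move=> r0 e e1; have [c c0 cP] := zen_point_evaluation nu_supp nu_doubling r0.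
  have q0 : 0 < 2 * c * (b - a) + 1 by rewrite ltr_wpDl // !mulr_ge0.
  have [n0 nP] := inv_small (divr_gt0 e1 q0); exists n0 => n /nP; rewrite ler_pdivlMr //.
  move=> h s rs; rewrite cmodBC; have [_ /(_ s c c0) H _] := SP n.
  apply: (le_trans (H _)); first by move=> g Xg; exact: cP.
  apply: le_trans h; have := e0 n; move: (n.+1%:R^-1) => p p0.
  have -> : p * (2 * c * (b - a) + 1) = 2 * (c * p) * (b - a) + p by ring.
  by rewrite lerDl ltW.
have hO : hol (extend (orb f a b)).
  apply: (@weierstrass _ (fun n => extend (S n))) => [n|rho e r0 e1].
    exact: zen_hol (XS n).
  have [n0 nP] := pe rho r0 e e1; exists n0 => n /nP H z rz.
  have hz : hp z by apply: lt_le_trans rz.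
  by rewrite !(extend_val _ hz); apply: H.
have fat g e' : X g -> 0 <= e' -> (forall t, a <= t <= b -> N (T t f - g) <= e') ->
    X (orb f a b - (b - a)%:C *: g) /\ N (orb f a b - (b - a)%:C *: g) <= (b - a) * e'.
  move=> Xg e1 h; have XZ := (zenZ (b - a)%:C Xg).1.
  apply: (@zen_fatou _ nu (fun n => S n - (b - a)%:C *: g)).
  - exact: mulr_ge0.
  - have -> : extend (orb f a b - (b - a)%:C *: g) =
       (fun z => extend (orb f a b) z - extend ((b - a)%:C *: g) z).
      by apply/funext => z; exact: extendB.
    by move=> z hz; apply: holatB; [exact: hO|exact: (zen_hol XZ)].
  - by move=> n; exact: (zenB (XS n) XZ).1.
  - by move=> n; have [_ _ H] := SP n; exact: H.
  move=> s e e2; have [n0 nP] := pe _ (valP s) e e2; exists n0 => n /nP/(_ s (lexx _)).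
  congr (cmod _ <= _).
  rewrite -[(S n - _) s]/(S n s - ((b - a)%:C *: g) s).
  by rewrite -[(orb f a b - _) s]/(orb f a b s - ((b - a)%:C *: g) s); ring.
split; last by move=> g e' Xg e1 /(fat g e' Xg e1)[].
have XT := zen_sg_in a0 Xf.
have B0 : 0 <= 2 * (M * N f) by rewrite !mulr_ge0 // nrm_ge0.
have [|XD _] := fat (T a f) _ XT B0.
  move=> t /andP[t1 t2]; have t0 := le_trans a0 t1.
  apply: (le_trans (zenB (zen_sg_in t0 Xf) XT).2).
  have h1 : N (T t f) <= M * N f by apply: T_bd; rewrite ?t0 //= (le_trans t2).
  have h2 : N (T a f) <= M * N f by apply: T_bd; rewrite ?a0 //= (le_trans ab).
  by move: h1 h2; move: (N _) (N _) (M * _) => p q r; lra.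
have -> : orb f a b = (orb f a b - (b - a)%:C *: T a f) + (b - a)%:C *: T a f.
  by rewrite subrK.
exact: (zenD XD (zenZ _ XT).1).1.
Qed.

Variable G : V.
Hypothesis G_analytic : analytic G.
Hypothesis T_gen : forall f g : V,
  generator (zen_space nu) (zen_norm nu) T f g ->
  forall s : Cplus R, g s = G s * cderiv f s.

Lemma nrm_eq0 f : X f -> (forall e, 0 < e -> N f <= e) -> f = 0.
Proof.
move=> Xf h; have Nf : N f = 0.
  by apply/eqP; rewrite eq_le nrm_ge0 andbT; apply/ler_addgt0Pr => e /h; rewrite add0r.
apply/funext => s; have [c c0 cP] := zen_point_evaluation nu_supp nu_doubling (valP s).
have := cP f s Xf (lexx _); rewrite Nf mulr0 => h1.
by apply: ComplexField.Normc.eq0_normc; apply/eqP; rewrite eq_le h1 cmod_ge0.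
Qed.

(** Both sides are additive in the interval, and on a short interval both are close to
    its length times T (a + u) f. *)
Lemma orb_translate f u a b : X f -> 0 <= u -> 0 <= a -> a <= b -> b + u <= d ->
  T u (orb f a b) = orb f (a + u) (b + u).
Proof.
move=> Xf u0 a0 ab bud.
have ud : 0 <= u <= d by rewrite u0 /=; lra.
have sh x y : x + u - (y + u) = x - y by ring.
have H e : 0 < e -> forall a b, 0 <= a -> a <= b -> b <= d - u ->
    N (T u (orb f a b) - orb f (a + u) (b + u)) <= (b - a) * (M * e + e).
  move=> e0; have [k k0 kP] := orbit_unif Xf e0.
  have k2 : 0 < k / 2 by rewrite divr_gt0.
  move=> {a0 ab bud}a {}b; move: a b; apply: (interval_subdivision k2) => a.
    move=> m b a0 am mb bd.
    have ab := le_trans am mb; have m0 := le_trans a0 am.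
    have bd' : b <= d by lra.
    have md : m <= d by lra.
    have [q1 q2 q3] : [/\ 0 <= a + u, a + u <= m + u & m + u <= b + u] by split; lra.
    have [q4 q5 q6] : [/\ m + u <= d, b + u <= d & 0 <= m + u] by split; lra.
    move=> h1 h2.
    have X1 := (orb_zen Xf a0 am md).1; have X2 := (orb_zen Xf m0 mb bd').1.
    have X3 := (orb_zen Xf q1 q2 q4).1; have X4 := (orb_zen Xf q6 q3 q5).1.
    rewrite (orb_split a0 am mb bd' Xf) (orb_split q1 q2 q3 q5 Xf).
    rewrite (zen_sgD u0 X1 X2) opprD addrACA.
    have XA := (zenB (zen_sg_in u0 X1) X3).1; have XB := (zenB (zen_sg_in u0 X2) X4).1.
    apply: (le_trans (zenD XA XB).2); apply: (le_trans (lerD h1 h2)).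
    by rewrite -mulrDl addrC addrA subrK.
  move=> b a0 ab bd bak.
  have bd' : b <= d by lra.
  have [q1 q2 q3] : [/\ 0 <= a + u, a + u <= b + u & b + u <= d] by split; lra.
  have XT := zen_sg_in a0 Xf; have XT' := zen_sg_in q1 Xf.
  have X1 := (orb_zen Xf a0 ab bd').1; have X2 := (orb_zen Xf q1 q2 q3).1.
  have XZ := (zenZ (b - a)%:C XT).1.
  have h1 : N (orb f a b - (b - a)%:C *: T a f) <= (b - a) * e.
    apply: ((orb_zen Xf a0 ab bd').2 _ _ XT (ltW e0)) => t /andP[t1 t2]; apply: kP.
    - by rewrite a0 (le_trans ab).
    - by rewrite (le_trans a0) // (le_trans t2).
    by rewrite ger0_norm ?subr_ge0 //; lra.
  have h2 : N (orb f (a + u) (b + u) - (b - a)%:C *: T (a + u) f) <= (b - a) * e.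
    rewrite -(sh b a).
    apply: ((orb_zen Xf q1 q2 q3).2 _ _ XT' (ltW e0)) => t /andP[t1 t2]; apply: kP.
    - by rewrite q1 (le_trans q2).
    - by rewrite (le_trans q1) // (le_trans t2).
    by rewrite ger0_norm ?subr_ge0 //; lra.
  have XB := (zenB X1 XZ).1; have XB' := (zenB X2 (zenZ (b - a)%:C XT').1).1.
  have -> : T u (orb f a b) - orb f (a + u) (b + u) =
     T u (orb f a b - (b - a)%:C *: T a f) -
     (orb f (a + u) (b + u) - (b - a)%:C *: T (a + u) f).
    rewrite (zen_sgB u0 X1 XZ) (zen_sgZ _ u0 XT).
    rewrite -(zen_sg_add u0 a0 Xf) [u + a]addrC opprB.
    by rewrite addrA subrK.
  apply: (le_trans (zenB (zen_sg_in u0 XB) XB').2); rewrite mulrDr; apply: lerD => //.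
  apply: (le_trans (T_bd ud XB)); rewrite mulrCA.
  exact: (ler_wpM2l M0 h1).
have [q1 q2] : 0 <= a + u /\ a + u <= b + u by split; lra.
have bd : b <= d by lra.
have X1 := (orb_zen Xf a0 ab bd).1; have X2 := (orb_zen Xf q1 q2 bud).1.
apply/eqP; rewrite -subr_eq0; apply/eqP; apply: nrm_eq0.
  exact: (zenB (zen_sg_in u0 X1) X2).1.
move=> e e0; have D0 : 0 < (b - a) * (M + 1) + 1.
  by rewrite ltr_wpDl // mulr_ge0 ?subr_ge0 // addr_ge0.
have bdu : b <= d - u by lra.
apply: (le_trans (H _ (divr_gt0 e0 D0) a b a0 ab bdu)).
have E (p : R) : (b - a) * (M * p + p) = (b - a) * (M + 1) * p by ring.
by rewrite E mulrA ler_pdivrMr // mulrC ler_pM2l // lerDl ler01.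
Qed.

(** Only the ends [0, t] and [h, h + t] of the interval of integration remain in the
    difference quotient. *)
Lemma generator_increment f h : X f -> 0 < h -> h < d ->
  generator X (zen_norm nu) T (orb f 0 h) (T h f - f).
Proof.
move=> Xf h0 hd; have h0' := ltW h0; have hd' := ltW hd.
have X0 := (orb_zen Xf (lexx 0) h0' hd').1; have XTh := zen_sg_in h0' Xf.
have XTf := (zenB XTh Xf).1.
split; [exact: X0|exact: XTf|].
have XQ t : 0 < t -> X ((t^-1)%:C *: (T t (orb f 0 h) - orb f 0 h) - (T h f - f)).
  by move=> /ltW t0; exact: (zenB (zenZ _ (zenB (zen_sg_in t0 X0) X0).1).1 XTf).1.
apply/cvg_at_right0 => [t t0|e e0].
  by exists (N ((t^-1)%:C *: (T t (orb f 0 h) - orb f 0 h) - (T h f - f)));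
    [exact: nrm_ge0|exact: zen_normK (XQ t t0)].
have e2 : 0 < e / 2 by rewrite divr_gt0.
have [k k0 kP] := orbit_unif Xf e2.
have dh0 : 0 < d - h by rewrite subr_gt0.
exists (Num.min k (Num.min h (d - h))); first by rewrite !lt_min k0 h0.
move=> t /andP[t0]; rewrite !lt_min => /and3P[tk th td].
rewrite (zen_normK (XQ t t0)) lee_fin.
have t0' := ltW t0; have th' := ltW th.
have htd : h + t <= d by lra.
have hht : h <= h + t by lra.
have tht : t <= h + t by lra.
have td' : t <= d by lra.
have tE : t - 0 = t by rewrite subr0.
have htE : h + t - h = t by ring.
have X1 := (orb_zen Xf h0' hht htd).1; have X2 := (orb_zen Xf (lexx 0) t0' td').1.
have E1 : T t (orb f 0 h) - orb f 0 h = orb f h (h + t) - orb f 0 t.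
  rewrite (orb_translate Xf t0' (lexx 0) h0' htd) add0r.
  rewrite (orb_split (lexx 0) t0' th' hd' Xf) (orb_split t0' th' hht htd Xf).
  by rewrite [X in _ - X]addrC opprD addrACA subrr add0r.
have h1 : N (orb f h (h + t) - (h + t - h)%:C *: T h f) <= (h + t - h) * (e / 2).
  apply: ((orb_zen Xf h0' hht htd).2 _ _ XTh (ltW e2)) => u /andP[u1 u2]; apply: kP.
  - by rewrite h0' hd'.
  - by rewrite (le_trans h0') // (le_trans u2).
  by rewrite ger0_norm ?subr_ge0 //; lra.
have h2 : N (orb f 0 t - (t - 0)%:C *: f) <= (t - 0) * (e / 2).
  apply: ((orb_zen Xf (lexx 0) t0' td').2 _ _ Xf (ltW e2)) => u /andP[u1 u2].
  have -> : T u f - f = T u f - T 0 f by rewrite (zen_sg0 Xf).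
  apply: kP; first by rewrite lexx ltW.
    by rewrite u1 (le_trans u2).
  by rewrite ger0_norm ?subr_ge0 //; lra.
rewrite htE in h1; rewrite tE in h2.
have tC : (t%:C : C) != 0 by rewrite -cmod_gt0 cmodR gtr0_norm.
have XA := (zenB X1 (zenZ t%:C XTh).1).1; have XB := (zenB X2 (zenZ t%:C Xf).1).1.
have -> : (t^-1)%:C *: (T t (orb f 0 h) - orb f 0 h) - (T h f - f) =
   (t^-1)%:C *: ((orb f h (h + t) - t%:C *: T h f) - (orb f 0 t - t%:C *: f)).
  have E (c t' p q u v : C) : c * t' = 1 -> c * (u - v) - (p - q) =
      c * ((u - t' * p) - (v - t' * q)).
    move=> ct; have -> : c * ((u - t' * p) - (v - t' * q)) =
      c * (u - v) - c * t' * (p - q) by ring.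
    by rewrite ct mul1r.
  rewrite E1; apply/funext => s; apply: E.
  by rewrite -rmorphM mulVf ?gt_eqF.
have tV : 0 <= t^-1 by rewrite invr_ge0.
apply: (le_trans (nrmZR tV (zenB XA XB).1)).
rewrite mulrC ler_pdivrMr //; apply: (le_trans (zenB XA XB).2).
apply: (le_trans (lerD h1 h2)); rewrite -mulrDr -splitr mulrC.
exact: lexx.
Qed.

(** The integral of the orbit over [0, h] differs from h f by at most e h in norm,
    hence by a multiple of e h in its derivative, by Cauchy's estimate; its image under the
    generator is the increment of the orbit. *)
Lemma sg_increment rho : 0 < rho -> exists2 c, 0 <= c & forall f s (l : C) h e,
  X f -> rho <= complex.Re (val s) -> cdiff setT (extend f) (val s) l ->
  0 < h < d -> 0 <= e -> (forall t, 0 <= t <= h -> N (T t f - f) <= e) ->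
  cmod (T h f s - f s - h%:C * (G s * l)) <= c * cmod (G s) * e * h.
Proof.
move=> r0; have r2 : 0 < rho / 2 by rewrite divr_gt0.
have r4 : 0 < rho / 4 by rewrite divr_gt0.
have [c c0 cP] := zen_point_evaluation nu_supp nu_doubling r2.
exists (8 * c / (rho / 4)); first by rewrite !mulr_ge0 // invr_ge0 ltW.
move=> f s l h e Xf rs dl /andP[h0 hd] e0 hN.
have h0' := ltW h0; have hd' := ltW hd.
have XO := (orb_zen Xf (lexx 0) h0' hd').1.
have := (orb_zen Xf (lexx 0) h0' hd').2 _ _ Xf e0; rewrite subr0 => /(_ hN) nO.
have [l' dl'] : holat (extend (orb f 0 h)) (val s) := zen_hol XO (valP s).
have := T_gen (generator_increment Xf h0 hd) s.
have -> : cderiv (orb f 0 h) s = l' by have [] := cdiff_derivable dl'.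
have -> : (T h f - f) s = T h f s - f s by [].
move=> ->; have XZ := (zenZ h%:C Xf).1; have XB := (zenB XO XZ).1.
have dB : cdiff setT (extend (orb f 0 h - h%:C *: f)) (val s) (l' - h%:C * l).
  have -> : extend (orb f 0 h - h%:C *: f) =
      (fun z => extend (orb f 0 h) z + (- h%:C) * extend f z).
    by apply/funext => z; rewrite extendB extendZ mulNr.
  have := cdiffD dl' (cdiffM (cdiff_cst setT (- h%:C) (val s)) dl).
  by rewrite mul0r add0r mulNr.
have HB z : csq (val s) (rho / 4) z -> rho / 2 <= complex.Re z.
  by move=> [/andP[z1 _] _]; lra.
have H : cmod (l' - h%:C * l) <= 8 * (c * (h * e)) / (rho / 4).
  apply: (cauchy_estimate r4 _ _ dB).
    by move=> z /HB hz; apply: (zen_hol XB); exact: lt_le_trans hz.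
  move=> z /HB hz; have hz' : hp z by exact: lt_le_trans hz.
  rewrite (extend_val _ hz'); apply: (le_trans (cP _ (exist _ z hz') XB hz)).
  exact: (ler_wpM2l c0 nO).
have -> : G s * l' - h%:C * (G s * l) = G s * (l' - h%:C * l) by ring.
rewrite cmodM mulrC; apply: (le_trans (ler_wpM2r (cmod_ge0 (G s)) H)).
rewrite le_eqVlt; apply/orP; left; apply/eqP; ring.
Qed.

(** The estimate for increments, applied at time s, where the orbit is continuous. *)
Lemma transp_orbit f (s : R) z : X f -> 0 <= s -> hp z ->
  transp (extend G) d (fun t => extend (T t f)) s z.
Proof.
move=> Xf s0 hz; have XT := zen_sg_in s0 Xf.
have [l dl] := zen_hol XT hz; exists l; split=> // eta eta0.
have [c c0 cP] := sg_increment hz.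
pose c' := c * cmod (G (exist _ z hz)).
have c'0 : 0 <= c' by rewrite mulr_ge0 // cmod_ge0.
have c1 : 0 < c' + 1 by rewrite ltr_wpDl.
have e0 := divr_gt0 eta0 c1; have e0' := ltW e0.
have [k k0 kP] := zen_sg_continuous XT e0.
exists (Num.min k d); first by rewrite lt_min k0.
move=> _ [t /andP[st td] ->]; rewrite -rmorphB cmodR ger0_norm ?subr_ge0 //.
rewrite lt_min => /andP[tk tsd].
have [->|ts] := eqVneq t s.
  by rewrite !subrr rmorph0 mulr0 subr0 cmod0 mulr0.
have h0 : 0 < t - s by rewrite subr_gt0 lt_def ts.
have hb : 0 < t - s < d by rewrite h0.
have := cP (T s f) (exist _ z hz) l (t - s) _ XT (lexx _) dl hb e0' _.
have -> : T (t - s) (T s f) = T t f.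
  by rewrite -(zen_sg_add (ltW h0) s0 Xf) subrK.
rewrite !(extend_val _ hz) [_%:C * _]mulrC => H.
apply: (le_trans (H _)).
  by move=> u /andP[u0 uh]; apply: kP; rewrite u0 (le_lt_trans uh).
rewrite -/c' ler_wpM2r ?(ltW h0) // mulrA ler_pdivrMr // mulrDr mulr1 mulrC lerDl.
exact: ltW.
Qed.

Lemma disc_Re z r : cmod (z - 1) <= r -> 1 - r <= complex.Re z.
Proof.
move=> zr; have := le_trans (Re_le_cmod _) zr.
by rewrite ReD ReN /= ler_norml => /andP[]; lra.
Qed.

Lemma kernel_succ n z : hp z ->
  extend (@cauchy_kernel R n) z = (z + 1) * extend (@cauchy_kernel R n.+1) z.
Proof.
move=> hz; rewrite !(extend_val _ hz) /cauchy_kernel /= exprS mulrA divff ?mul1r //.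
exact: hp_add1.
Qed.

(** The difference between T_t f and the composition of f with the quotient phi_t
    solves the transport equation and vanishes at time 0. *)
Lemma local_composition : exists (eps : R) (phi : R -> C -> C), 0 < eps /\
  forall t, 0 <= t <= eps -> forall z, cmod (z - 1) <= 1/4 -> hp (phi t z) /\
    forall f, X f -> extend (T t f) z = extend f (phi t z).
Proof.
have [m mP] := cauchy_kernel_zen nu_doubling.
have Xp := mP m (leqnn m); have Xq := mP m.+1 (leqnSn m).
pose p t := extend (T t (@cauchy_kernel R m)).
pose q t := extend (T t (@cauchy_kernel R m.+1)).
pose phi t z := p t z * (q t z)^-1 - 1.
have q40 : 0 < 1/4 :> R by rewrite divr_gt0.
have [c c0 cP] := zen_point_evaluation nu_supp nu_doubling q40.
(* On the disc of radius 1/2 about 1, |z + 1| is at most 5/2, so that the kernel is at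
   least kap; errors below kap/28 then move the quotient by at most 1/4, and the
   real part of z is at least 1/2. *)
pose kap : R := (2 / 5) ^+ m.+1.
have kap0 : 0 < kap by rewrite exprn_gt0 // divr_gt0.
have c1 : 0 < c + 1 by rewrite ltr_wpDl.
have e0 : 0 < kap / 28 / (c + 1) by rewrite !divr_gt0.
have [k1 k10 k1P] := zen_sg_continuous Xp e0.
have [k2 k20 k2P] := zen_sg_continuous Xq e0.
pose tau := Num.min d (Num.min (k1 / 2) (k2 / 2)).
have tau0 : 0 < tau by rewrite !lt_min d0 !divr_gt0.
have taud : tau <= d by rewrite ge_min lexx.
have tau1 t : t <= tau -> t < k1 by rewrite !le_min => /and3P[_ h _]; lra.
have tau2 t : t <= tau -> t < k2 by rewrite !le_min => /and3P[_ _ h]; lra.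
have pe f t z : X f -> 0 <= t -> 1/2 <= complex.Re z -> N (T t f - f) <= kap / 28 / (c + 1) ->
    cmod (extend (T t f) z - extend f z) <= kap / 28.
  move=> Xf t0 hz; have hz' : hp z by apply: lt_le_trans hz; lra.
  have hz4 : 1/4 <= complex.Re z by apply: le_trans hz; lra.
  rewrite !(extend_val _ hz').
  have := cP _ (exist _ z hz') (zenB (zen_sg_in t0 Xf) Xf).1 hz4.
  rewrite ler_pdivlMr // => h1 h2; apply: (le_trans h1); apply: le_trans h2.
  by rewrite mulrC ler_wpM2l ?nrm_ge0 // lerDl.
have D z : cmod (z - 1) < 1/2 -> 1/2 <= complex.Re z.
  by move=> /ltW/disc_Re; lra.
have Dhp z : cmod (z - 1) < 1/2 -> hp z.
  by move=> /D; apply: lt_le_trans; lra.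
have key t z : 0 <= t <= tau -> cmod (z - 1) < 1/2 ->
    q t z != 0 /\ 1/4 <= complex.Re (phi t z).
  move=> /andP[t0 tt] zD; have hz := Dhp z zD.
  have h1 : cmod (p t z - extend (@cauchy_kernel R m) z) <= kap / 28.
    by apply: pe => //; [exact: D|apply: k1P; rewrite t0 tau1].
  have h2 : cmod (q t z - extend (@cauchy_kernel R m.+1) z) <= kap / 28.
    by apply: pe => //; [exact: D|apply: k2P; rewrite t0 tau2].
  have z1 : cmod (z + 1) <= 5/2.
    have -> : z + 1 = (z - 1) + 2 by ring.
    apply: (le_trans (cmodD _ _)).
    have -> : cmod (2 : C) = 2 by rewrite -[2 : C](rmorph_nat (@real_complex R)) cmodR ger0_norm.
    by lra.
  have z10 : 0 < cmod (z + 1) by rewrite cmod_gt0; exact: hp_add1.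
  have h3 : kap <= cmod (extend (@cauchy_kernel R m.+1) z).
    rewrite (extend_val _ hz) /cauchy_kernel /= cmodX cmodV.
    apply: lerXn2r; rewrite ?nnegrE ?invr_ge0 ?cmod_ge0 ?divr_ge0 //.
    by rewrite -invf_div lef_pV2 ?posrE ?divr_gt0.
  rewrite (kernel_succ m hz) in h1; rewrite /phi.
  move: (p t z) (q t z) (extend _ z) h1 h2 h3 => P Q Q0 h1 h2 h3.
  have hQ : kap / 2 <= cmod Q by have := cmodB_ge Q0 Q; rewrite cmodBC; lra.
  have Qp : 0 < cmod Q by lra.
  have Qn : Q != 0 by rewrite -cmod_gt0.
  split=> //; have zR := D z zD.
  have E : P * Q^-1 - 1 = z + ((P - (z + 1) * Q0) - (z + 1) * (Q - Q0)) / Q by field.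
  have hE : cmod (((P - (z + 1) * Q0) - (z + 1) * (Q - Q0)) / Q) <= 1/4.
    rewrite cmodM cmodV ler_pdivrMr //.
    apply: (@le_trans _ _ (kap / 28 + 5 / 2 * (kap / 28))); last by lra.
    apply: (le_trans (cmodB _ _)); apply: lerD => //; rewrite cmodM.
    by apply: ler_pM => //; exact: cmod_ge0.
  have := le_trans (Re_le_cmod _) hE; rewrite E ReD ler_norml => /andP[].
  by move: (complex.Re (_ / Q)) => x; lra.
have Khyp : exists2 K, 0 < K & forall z, cmod (z - 1) < 1/2 -> cmod (extend G z) <= K.
  have [|z zc|K K0 KP] := @ccont_bounded R (extend G) 1 (1/2).
  - by lra.
  - apply: holat_ccont; apply/(hol_csq _ _ zc); first exact/analyticP.
    by rewrite /=; lra.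
  exists (K + 1); first by rewrite ltr_wpDl.
  by move=> z /ltW/ball_csq/KP; lra.
have [K K0 KP] := Khyp.
pose eps := Num.min tau (1/2 / (128 * K * expR 1)).
have eps0 : 0 < eps by rewrite lt_min tau0 !divr_gt0 // !mulr_gt0 // expR_gt0.
exists eps, phi; split=> // t /andP[t0 te] z zD.
have ttau : 0 <= t <= tau by rewrite t0; move: te; rewrite le_min => /andP[].
have zD2 : cmod (z - 1) < 1/2 by lra.
have phip t' z' : 0 <= t' <= tau -> cmod (z' - 1) < 1/2 -> hp (phi t' z').
  by move=> h1 h2; have [_] := key t' z' h1 h2; apply: lt_le_trans; lra.
split=> [|f Xf]; first exact: phip.
pose v t z := extend (T t f) z + (-1) * extend f (phi t z).
suff : v t z = 0 by rewrite /v mulN1r => /eqP; rewrite subr_eq0 => /eqP.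
have tp (s : R) w : 0 <= s <= tau -> cmod (w - 1) < 1/2 -> transp (extend G) d v s w.
  move=> stau wD; have [s0 _] := andP stau; have hw := Dhp w wD.
  have [qn _] := key s w stau wD.
  apply: (transpD (transp_orbit Xf s0 hw)).
  apply: (transpM (transp_cst _ _ (-1) s w)).
  apply: (@transp_comp _ _ _ (extend f) phi s w).
    by apply: (zen_hol Xf); exact: phip.
  apply: transpD; last exact: transp_cst.
  apply: transpM; first exact: transp_orbit.
  by apply: transpV => //; exact: transp_orbit.
have oc g (s : R) w : X g -> 0 <= s <= tau -> hp w ->
    ccont (tset 0 tau) (fun x => extend (T (complex.Re x) g) w) s%:C.
  move=> Xg stau hw; apply: (@tset_ccont _ (fun t => extend (T t g) w)) => //.
  have := orbit_segcont (exist _ w hw) Xg.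
  move=> /(segcont_sub (lexx 0) taud); apply: segcont_ext => x _.
  by rewrite (extend_val _ hw).
apply: (@transport_unique _ v (extend G) 1 (1/2) tau (c * (M * N f) + c * N f) K) => //.
- by rewrite addr_ge0 // !mulr_ge0 // nrm_ge0.
- by move=> s w h1 h2; have [l [h _]] := tp s w h1 h2; exists l.
- move=> s w h1 h2; have [_ hph] := key s w h1 h2; have hw := Dhp w h2.
  have hph' := phip s w h1 h2.
  apply: (le_trans (cmodD _ _)); rewrite mulN1r cmodN.
  have [s0 st] := andP h1.
  rewrite (extend_val _ hw) (extend_val _ hph'); apply: lerD; last exact: cP.
  apply: (le_trans (cP _ (exist _ w hw) (zen_sg_in s0 Xf) _)).
    by apply: le_trans (D w h2); lra.
  by apply: (ler_wpM2l c0); apply: T_bd => //; rewrite s0 (le_trans st).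
- move=> w wD; have hw := Dhp w wD; rewrite /v /phi /p /q.
  rewrite !(zen_sg0) // (kernel_succ m hw) mulfK ?addrK ?mulN1r ?subrr //.
  have [] := key 0 w _ wD; first by rewrite lexx ltW.
  by rewrite /q (zen_sg0).
- move=> w wD; have hw := Dhp w wD; apply: ccont_segcont => s stau.
  have [qn _] := key s w stau wD.
  apply: ccontD; first exact: oc.
  apply: ccontM; first exact: ccont_cst.
  apply: (@ccont_comp _ (tset 0 tau) setT (fun x => phi (complex.Re x) w) (extend f)) => //.
    apply: ccontD; last exact: ccont_cst.
    by apply: ccontM; [exact: oc|apply: ccontV => //; exact: oc].
  by apply: holat_ccont; apply: (zen_hol Xf); exact: phip.
- move=> w s l wD /andP[s0 /ltW st] dl.
  have st' : 0 <= s <= tau by rewrite s0.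
  exact: (transp_increment taud (tp s w st' wD) dl).
- by move: te; rewrite le_min => /andP[].
by apply: (le_trans zD); lra.
Qed.

End Semigroup.

(** * From a disc to the half-plane *)

Section Global.
Variable R : realType.
Local Notation C := R[i].
Local Notation mR := (measurableTypeR R).
Local Notation V := (Cplus R -> R[i]).
Variable nu : {measure set mR -> \bar R}.
Hypothesis nu_supp : supported_nneg nu.
Hypothesis nu_doubling : doubling nu.
Local Notation X := (zen_space nu).
Local Notation N := (nrm nu).
Variable S : V -> V.
Variable M : R.
Variable phi0 : C -> C.
Hypothesis M0 : 0 <= M.
Hypothesis S_in : forall f, X f -> X (S f).
Hypothesis S_sub : forall f g, X f -> X g -> S (f - g) = S f - S g.
Hypothesis S_bounded : forall f, X f -> N (S f) <= M * N f.
Hypothesis S_local : forall z, cmod (z - 1) <= 1/4 -> hp (phi0 z) /\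
    forall f, X f -> extend (S f) z = extend f (phi0 z).
Implicit Types (F H : C -> C) (f g k : V) (z w : C) (B : R).

Lemma hol_unique F H : hol F -> hol H ->
  (forall z, cmod (z - 1) <= 1/4 -> F z = H z) -> forall z, hp z -> F z = H z.
Proof.
move=> hF hH FH z hz; apply/eqP; rewrite -subr_eq0; apply/eqP.
have h1 : hp (1 : C) by rewrite /hp /= ltr01.
have q0 : 0 < 1/4 :> R by rewrite divr_gt0.
apply: (identity_theorem (f := fun w => F w - H w) _ h1 q0 _ hz).
  by move=> w hw; apply: holatB; [exact: hF|exact: hH].
by move=> w /ltW/FH ->; rewrite subrr.
Qed.

Variable m : nat.
Hypothesis Xm : X (@cauchy_kernel R m).
Let E : V := @cauchy_kernel R m.
Let P := extend (S E).

Lemma hol_P : hol P. Proof. exact: (zen_hol (S_in Xm)). Qed.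

Lemma P_neq0 : P 1 != 0.
Proof.
have [|h hP] := S_local (z := 1); first by rewrite subrr cmod0 divr_ge0.
rewrite /P (hP _ Xm) (extend_val _ h) /E /cauchy_kernel /= expf_neq0 // invr_neq0 //.
exact: hp_add1.
Qed.

(** Taking n-th roots removes the fixed factor P wherever it does not vanish; as it
    vanishes on no disc, continuity covers its zeros. *)
Lemma power_trick F B : hol F -> 0 <= B ->
  (forall z, hp z -> exists2 K, 0 <= K &
     forall n, cmod (F z) ^+ n * cmod (P z) <= K * B ^+ n) ->
  forall z, hp z -> cmod (F z) <= B.
Proof.
move=> hF B0 FP.
have H z : hp z -> P z != 0 -> cmod (F z) <= B.
  move=> hz Pz; rewrite leNgt; apply/negP => lt; have [K K0 KP] := FP z hz.
  have a0 : 0 < cmod (F z) by exact: le_lt_trans lt.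
  have K1 : 0 < K + 1 by rewrite ltr_wpDl.
  have q1 : 0 <= B / cmod (F z) < 1.
    by rewrite divr_ge0 ?(ltW a0) //= ltr_pdivrMr // mul1r.
  have P0 : 0 < cmod (P z) by rewrite cmod_gt0.
  have [n] := geo_small q1 (divr_gt0 P0 K1).
  rewrite expr_div_n ltr_pdivlMr // mulrAC ltr_pdivrMr ?exprn_gt0 //.
  apply/negP; rewrite -leNgt mulrC; apply: (le_trans (KP n)).
  by rewrite mulrC ler_wpM2l ?exprn_ge0 // lerDl.
move=> z hz; rewrite leNgt; apply/negP => lt.
have e0 : 0 < (cmod (F z) - B) / 2 by rewrite divr_gt0 // subr_gt0.
have cF : ccont setT F z by exact: holat_ccont (hF z hz).
have [kap kap0 kP] := cF _ e0.
have r0 : 0 < Num.min kap (complex.Re z) by rewrite lt_min kap0.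
have h1 : hp (1 : C) by rewrite /hp /= ltr01.
have := P_neq0; rewrite (identity_theorem hol_P hz r0 _ h1) ?eqxx // => w.
rewrite lt_min => /andP[wk wz].
have hw : hp w.
  by rewrite /hp /=; have := le_lt_trans (Re_le_cmod _) wz; rewrite ReD ReN ltr_norml; lra.
apply/eqP/negPn/negP => /(H w hw) h2.
have := kP w I wk; have := cmodB_ge (F z) (F w); rewrite cmodBC.
by move: (cmod _) (cmod _) (cmod _) lt h2 => p q r; lra.
Qed.

(** If F is near 1 the composition of k with phi0, then F^n P is the image of k^n E,
    whose norm is at most B^n times the norm of E. *)
Lemma multiplier_bound F k B : hol F -> hol (extend k) -> 0 <= B ->
  (forall s, cmod (k s) <= B) ->
  (forall z, cmod (z - 1) <= 1/4 -> F z = extend k (phi0 z)) ->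
  forall z, hp z -> cmod (F z) <= B.
Proof.
move=> hF hk B0 kB Fk; apply: power_trick => // z hz.
have [c c0 cP] := zen_point_evaluation nu_supp nu_doubling hz.
exists (c * (M * N E)); first by rewrite !mulr_ge0 // nrm_ge0.
move=> n; pose f : V := fun s => k s ^+ n * E s.
have hf : hol (extend f).
  apply: (@hol_ext _ (fun z => extend k z ^+ n * extend E z)) => w hw.
    by rewrite !(extend_val _ hw).
  by apply: holatM; [apply: holatX; exact: hk|exact: (zen_hol Xm)].
have [Xf Nf] : X f /\ N f <= B ^+ n * N E.
  apply: zen_bounded_mult => //; first exact: exprn_ge0.
  move=> s; rewrite /f cmodM cmodX ler_wpM2r ?cmod_ge0 //.
  by apply: lerXn2r; rewrite ?nnegrE ?cmod_ge0.
have Ef : F z ^+ n * P z = extend (S f) z.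
  apply: (hol_unique (F := fun z => F z ^+ n * P z)) => //.
  - by move=> w hw; apply: holatM; [apply: holatX; exact: hF|exact: hol_P].
  - exact: (zen_hol (S_in Xf)).
  move=> w wD; have [hw hS] := S_local wD.
  by rewrite /P !hS // Fk // !(extend_val _ hw).
rewrite -cmodX -cmodM Ef (extend_val _ hz).
apply: (le_trans (cP _ (exist _ z hz) (S_in Xf) (lexx _))).
rewrite -!mulrA; apply: (ler_wpM2l c0); apply: (le_trans (S_bounded Xf)).
by apply: (ler_wpM2l M0); rewrite mulrC.
Qed.

Lemma S_sup f B : X f -> 0 <= B -> (forall s, cmod (f s) <= B) ->
  forall s, cmod (S f s) <= B.
Proof.
move=> Xf B0 fB s; have := multiplier_bound (F := extend (S f)) (k := f) (B := B).
move=> /(_ (zen_hol (S_in Xf)) (zen_hol Xf) B0 fB _ (val s) (valP s)).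
rewrite extendE; apply => z /S_local[_ h]; exact: h.
Qed.

(** 1/(s+1) is a uniform limit of these functions, which decay fast enough to belong to
    the space. *)
Definition approx (n : nat) : V := restrict (fun z =>
  (z + 1)^-1 * (n.+1%:R%:C * (z + n.+1%:R%:C)^-1) ^+ m).

Lemma cmod_shift_ge (x : R) z : 0 <= x -> hp z ->
  x <= cmod (z + x%:C) /\ cmod z <= cmod (z + x%:C).
Proof.
move=> x0 hz; split.
  apply: le_trans (Re_le_cmod _); rewrite ReD /=; apply: le_trans (ler_norm _).
  by rewrite lerDr ltW.
rewrite -(@ler_pXn2r _ 2) ?nnegrE ?cmod_ge0 // !cmod_sqr ReD ImD /= addr0 lerD2r.
by rewrite ler_pXn2r ?nnegrE ?addr_ge0 ?lerDl // ltW.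
Qed.

Lemma one_minus_pow (w : C) n : cmod w <= 1 -> cmod (1 - w ^+ n) <= n%:R * cmod (1 - w).
Proof.
move=> w1; elim: n => [|n IH]; first by rewrite expr0 subrr cmod0 mul0r.
have -> : 1 - w ^+ n.+1 = (1 - w ^+ n) + w ^+ n * (1 - w) by rewrite exprSr; ring.
apply: (le_trans (cmodD _ _)); rewrite mulrSr mulrDl mul1r; apply: lerD => //.
rewrite cmodM cmodX ler_piMl ?cmod_ge0 //.
by rewrite exprn_ile1 // cmod_ge0.
Qed.

Lemma approxP n : X (approx n) /\ forall z, hp z ->
  cmod (extend (approx n) z - (z + 1)^-1) <= m%:R / n.+1%:R.
Proof.
pose x : R := n.+1%:R; have x0 : 0 < x by rewrite ltr0Sn.
rewrite -/x.
have nz z : hp z -> z + x%:C != 0.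
  move=> hz; rewrite -cmod_gt0; apply: (lt_le_trans x0).
  exact: (cmod_shift_ge (ltW x0) hz).1.
split.
  suff [] : X (approx n) /\ N (approx n) <= x ^+ m * N E by [].
  apply: zen_bounded_mult.
  - by rewrite exprn_ge0 // ltW.
  - apply: hol_restrict => z hz; apply: holatM.
      apply: holatV; first exact: hp_add1.
      by apply: holatD; [exact: holat_id|exact: holat_cst].
    apply: holatX; apply: holatM; first exact: holat_cst.
    apply: holatV; first exact: nz.
    by apply: holatD; [exact: holat_id|exact: holat_cst].
  - exact: Xm.
  move=> s; have hs : hp (val s) := valP s.
  rewrite /approx /restrict /E /cauchy_kernel -/x cmodM !cmodX cmodM exprMn mulrCA.
  rewrite cmodR ger0_norm ?(ltW x0) //; apply: ler_wpM2l; first by rewrite exprn_ge0 // ltW.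
  rewrite !cmodV; apply: (@le_trans _ _ (1 * (cmod (val s + x%:C))^-1 ^+ m)).
    rewrite ler_wpM2r ?exprn_ge0 ?invr_ge0 ?cmod_ge0 // invf_le1.
      exact: cmod_add1_ge1.
    by rewrite cmod_gt0 hp_add1.
  rewrite mul1r; apply: lerXn2r; rewrite ?nnegrE ?invr_ge0 ?cmod_ge0 //.
  rewrite lef_pV2 ?posrE ?cmod_gt0 ?nz ?hp_add1 //.
  have -> : val s + x%:C = (val s + 1) + (x - 1)%:C by rewrite rmorphB rmorph1; ring.
  apply: (cmod_shift_ge _ _).2; first by rewrite subr_ge0 /x ler1n.
  by rewrite /hp /= ReD /= addr_gt0.
move=> z hz; rewrite extend_restrict // -/x; have h1 := hp_add1 hz; have h2 := nz z hz.
have [g1 g2] := cmod_shift_ge (ltW x0) hz.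
rewrite -[X in _ - X]mulr1 -mulrBr cmodM cmodV [cmod (_ ^+ _ - 1)]cmodBC.
rewrite mulrC ler_pdivrMr ?cmod_gt0 //.
have p0 : 0 < cmod (z + x%:C) by rewrite cmod_gt0.
have w1 : cmod (x%:C / (z + x%:C)) <= 1.
  by rewrite cmodM cmodV cmodR ger0_norm ?(ltW x0) // ler_pdivrMr // mul1r.
apply: (le_trans (one_minus_pow m w1)); rewrite -mulrA; apply: ler_wpM2l => //.
have -> : 1 - x%:C / (z + x%:C) = z / (z + x%:C).
  by move: h2; move: (x%:C) => y h2; field.
rewrite cmodM cmodV ler_pdivrMr // -mulrA ler_pdivlMl // mulrC.
have [_ g3] := cmod_shift_ge ler01 hz; rewrite rmorph1 in g3.
by apply: ler_pM => //; exact: cmod_ge0.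
Qed.

(** The function 1/(s+1) itself need not belong to the space, but the operator does not
    increase the supremum norm, so that the images of the approximations converge
    uniformly. *)
Lemma inverse_symbol : exists psi, hol psi /\
  forall z, cmod (z - 1) <= 1/4 -> psi z = (phi0 z + 1)^-1.
Proof.
have XA n : X (approx n) := (approxP n).1.
have small e : 0 < e -> exists n0, forall n, (n0 <= n)%N -> m%:R / n.+1%:R <= e :> R.
  move=> e0; have m1 : 0 < m%:R + 1 :> R by rewrite ltr_wpDl.
  have [n0 nP] := inv_small (divr_gt0 e0 m1); exists n0 => n /nP.
  rewrite ler_pdivlMr // => h; apply: le_trans h; rewrite mulrC.
  by rewrite ler_wpM2l ?invr_ge0 // lerDl.
have uc : unif_cauchy (fun n => extend (S (approx n))).
  move=> rho e r0 e0; have e2 : 0 < e / 2 by rewrite divr_gt0.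
  have [n0 nP] := small _ e2; exists n0 => n l nn ll z rz.
  have hz : hp z by apply: lt_le_trans rz.
  rewrite !(extend_val _ hz).
  rewrite -[_ - _]/((S (approx n) - S (approx l)) (exist _ z hz)).
  rewrite -(S_sub (XA n) (XA l)).
  apply: S_sup; [exact: (zenB (XA n) (XA l)).1|exact: ltW|move=> s].
  have h1 := (approxP n).2 _ (valP s); have h2 := (approxP l).2 _ (valP s).
  rewrite extendE in h1; rewrite extendE in h2.
  have h3 := lerD (nP n nn) (nP l ll); rewrite -splitr in h3; apply: le_trans h3.
  rewrite -[(approx n - _) s]/(approx n s - approx l s).
  apply: (le_trans (cmod_triangle _ (val s + 1)^-1 _)).
  by rewrite [X in _ + X]cmodBC; exact: (lerD h1 h2).
have [psi psiP] := unif_cauchy_lim uc.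
exists psi; split; first by apply: (weierstrass _ psiP) => n; exact: (zen_hol (S_in (XA n))).
move=> z zD; have [hw hS] := S_local zD.
have hz : 1/2 <= complex.Re z.
  have := le_trans (Re_le_cmod _) zD; rewrite ReD ReN /= ler_norml; lra.
have q0 : 0 < 1/2 :> R by rewrite divr_gt0.
apply/eqP; rewrite -subr_eq0 -cmod_eq0 eq_le cmod_ge0 andbT.
apply/ler_addgt0Pr => e e0; rewrite add0r; have e2 : 0 < e / 2 by rewrite divr_gt0.
have [n0 nP] := small _ e2; have [n1 nP1] := psiP _ _ q0 e2.
pose n := maxn n0 n1.
have h1 := nP n (leq_maxl _ _); have h2 := nP1 n (leq_maxr _ _) z hz.
have h3 := (approxP n).2 _ hw; rewrite (hS _ (XA n)) in h2.
have h4 := lerD h2 (le_trans h3 h1); rewrite -splitr in h4; apply: le_trans h4.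
apply: (le_trans (cmod_triangle _ (extend (approx n) (phi0 z)) _)).
by rewrite [X in X + _]cmodBC.
Qed.

Lemma disc_half_plane (w : C) : cmod (2 * w - 1) < 1 -> w != 0 /\ 0 < complex.Re (w^-1 - 1).
Proof.
rewrite -(@ltr_pXn2r _ 2) ?nnegrE ?cmod_ge0 // cmod_sqr expr1n.
move=> h; have {h} : complex.Re w ^+ 2 + complex.Im w ^+ 2 < complex.Re w.
  by case: w h => x y /= h; nra.
move=> h; have h2 : 0 < complex.Re w ^+ 2 + complex.Im w ^+ 2.
  rewrite lt_def addr_ge0 ?sqr_ge0 // andbT; apply/eqP => h0.
  have := sqr_ge0 (complex.Im w); have : complex.Re w ^+ 2 <= 0.
    by have := sqr_ge0 (complex.Im w); lra.
  by move=> ? ?; move: h; rewrite h0; nra.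
split; first by apply/eqP => w0; move: h; rewrite w0 /= expr0n addr0 ltxx.
by rewrite ReD ReN ReV /= subr_gt0 ltr_pdivlMr // mul1r.
Qed.

Lemma half_plane_disc (w : C) : hp w -> cmod (2 * (w + 1)^-1 - 1) < 1.
Proof.
move=> hw; have h1 := hp_add1 hw.
have -> : 2 * (w + 1)^-1 - 1 = (1 - w) / (w + 1) by field.
rewrite cmodM cmodV ltr_pdivrMr ?cmod_gt0 // mul1r.
rewrite -(@ltr_pXn2r _ 2) ?nnegrE ?cmod_ge0 // !cmod_sqr.
by case: w hw {h1} => x y; rewrite /hp /= => x0; nra.
Qed.

(** The inverse psi of phi0 + 1 continues to the half-plane.  As 2 psi - 1 corresponds
    to the Cayley transform (1 - s)/(1 + s), it is bounded by 1; the maximum principle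
    keeps it in the open disc, and so 1/psi - 1 in the half-plane. *)
Lemma global_composition : exists phi : Cplus R -> Cplus R,
  analytic_selfmap phi /\ forall f, X f -> S f = f \o phi.
Proof.
have [psi [hpsi psiE]] := inverse_symbol.
pose F z := 2 * psi z - 1.
have hF : hol F.
  move=> z hz; apply: holatB; last exact: holat_cst.
  by apply: holatM; [exact: holat_cst|exact: hpsi].
have F1 z : hp z -> cmod (F z) <= 1.
  pose k : V := restrict (fun z => 2 * (z + 1)^-1 - 1).
  apply: (multiplier_bound (k := k)) => //.
  - apply: hol_restrict => w hw; apply: holatB; last exact: holat_cst.
    apply: holatM; first exact: holat_cst.
    apply: holatV; first exact: hp_add1.
    by apply: holatD; [exact: holat_id|exact: holat_cst].
  - by move=> s; apply: ltW; apply: half_plane_disc; exact: (valP s).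
  by move=> w wD; have [hw _] := S_local wD; rewrite extend_restrict // /F psiE.
have c1 : cmod (1 - 1 : C) <= 1/4 by rewrite subrr cmod0 divr_ge0.
have h1 : hp (1 : C) by rewrite /hp /= ltr01.
have Flt z : hp z -> cmod (F z) < 1.
  apply: (modulus_lt1 hF F1 h1); rewrite /F psiE //.
  by apply: half_plane_disc; have [] := S_local c1.
have phiP z : hp z -> psi z != 0 /\ hp ((psi z)^-1 - 1).
  by move=> /Flt/disc_half_plane.
pose phi (s : Cplus R) : Cplus R := exist _ _ (phiP (val s) (valP s)).2.
have hphi : hol (fun z => (psi z)^-1 - 1).
  move=> z hz; apply: holatB; last exact: holat_cst.
  by apply: holatV; [have [] := phiP z hz|exact: hpsi].
exists phi; split.
  by apply/analyticP; exact: (hol_restrict hphi).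
move=> f Xf; apply/funext => s; rewrite -extendE -[(f \o phi) s]/(f (phi s)).
rewrite -(extendE f (phi s)).
apply: (hol_unique (H := fun z => extend f ((psi z)^-1 - 1))) (valP s).
- exact: (zen_hol (S_in Xf)).
- move=> z hz; apply: (holat_comp (hphi z hz)).
  by apply: (zen_hol Xf); have [] := phiP z hz.
move=> z zD; have [hw hS] := S_local zD.
by rewrite hS // psiE // invrK addrK.
Qed.

End Global.

(** * The semigroup of symbols *)

Section Composition.
Variable R : realType.
Local Notation C := R[i].
Local Notation mR := (measurableTypeR R).
Local Notation V := (Cplus R -> R[i]).
Implicit Types (phi chi : Cplus R -> Cplus R) (f g : V).

Lemma analytic_selfmap_comp phi chi : analytic_selfmap phi -> analytic_selfmap chi ->
  analytic_selfmap (phi \o chi).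
Proof.
move=> /analyticP hp1 /analyticP hc; apply/analyticP.
apply: (@hol_ext _ (fun z =>
  extend (fun s => val (phi s)) (extend (fun s => val (chi s)) z))) => z hz.
  by rewrite !(extend_val _ hz) /= extendE.
apply: (holat_comp (hc z hz)); rewrite (extend_val _ hz); apply: hp1.
exact: (valP (chi _)).
Qed.

Variable nu : {measure set mR -> \bar R}.
Hypothesis nu_doubling : doubling nu.

(** The value of a symbol at a point is read off from the quotient of the images of two
    consecutive powers of 1/(s + 1). *)
Lemma composition_inj phi chi :
  (forall f, zen_space nu f -> f \o phi = f \o chi) -> phi = chi.
Proof.
move=> fE; have [m mP] := cauchy_kernel_zen nu_doubling.
have E1 := fE _ (mP m (leqnn m)); have E2 := fE _ (mP m.+1 (leqnSn m)).
apply/funext => s; apply: val_inj => /=.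
have h s' : val s' = @cauchy_kernel R m s' / @cauchy_kernel R m.+1 s' - 1.
  have n0 := hp_add1 (valP s' : hp (val s')).
  by rewrite /cauchy_kernel exprS invfM invrK mulrC -mulrA mulVf ?mulr1 ?addrK //
    expf_neq0 // invr_neq0.
rewrite (h (phi s)) (h (chi s)).
have := congr1 (fun f => f s) E1; have := congr1 (fun f => f s) E2.
by rewrite /comp => -> ->.
Qed.

End Composition.

Theorem theorem4p3 (R : realType)
    (nu : {measure set (measurableTypeR R) -> \bar R})
    (nu_supp : supported_nneg nu)
    (nu_regular : regular_measure nu)
    (nu_doubling : doubling nu)
    (T : R -> (Cplus R -> R[i]) -> (Cplus R -> R[i]))
    (T_C0 : C0_semigroup (zen_space nu) (zen_norm nu) T)
    (G : Cplus R -> R[i])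
    (G_analytic : analytic G)
    (T_gen : forall f g : Cplus R -> R[i],
      generator (zen_space nu) (zen_norm nu) T f g ->
      forall s : Cplus R, g s = G s * cderiv f s) :
  composition_semigroup nu T.
Proof.
have [d [M [d0 M0 TM]]] := zen_sg_locally_bounded nu_supp nu_doubling T_C0.
have [eps [phi0 [eps0 loc]]] :=
  local_composition nu_supp nu_doubling T_C0 d0 M0 TM G_analytic T_gen.
have [m mP] := cauchy_kernel_zen nu_doubling.
have Xm := mP m (leqnn m).
have short u : 0 <= u -> u <= eps -> exists phi, analytic_selfmap phi /\
    forall f, zen_space nu f -> T u f = f \o phi.
  move=> u0 ue; have [K K0 KP] := zen_sg_bounded T_C0 u0.
  apply: (global_composition nu_supp nu_doubling K0 _ _ KP _ Xm).
  - by move=> f Xf; exact: (zen_sg_in T_C0 u0 Xf).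
  - by move=> f g Xf Xg; exact: (zen_sgB nu_doubling T_C0 u0 Xf Xg).
  by move=> z zD; apply: (loc u) => //; rewrite u0.
have steps u (n : nat) : 0 <= u -> u <= eps -> exists phi, analytic_selfmap phi /\
    forall f, zen_space nu f -> T (u *+ n.+1) f = f \o phi.
  move=> u0 ue; elim: n => [|n [phi [hphi phiE]]]; first exact: short.
  have [chi [hchi chiE]] := short u u0 ue.
  exists (phi \o chi); split; first exact: analytic_selfmap_comp.
  move=> f Xf; have un : 0 <= u *+ n.+1 by rewrite mulrn_wge0.
  rewrite mulrS (zen_sg_add T_C0 u0 un Xf) (chiE _ (zen_sg_in T_C0 un Xf)).
  by rewrite (phiE f Xf).
have all t : exists phi, 0 <= t -> analytic_selfmap phi /\
    forall f, zen_space nu f -> T t f = f \o phi.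
  have [t0|] := boolP (0 <= t); last by exists id.
  have nb := archi_boundP (divr_ge0 t0 (ltW eps0)).
  pose n := Num.bound (t / eps).
  have n0 : 0 < n.+1%:R :> R by rewrite ltr0Sn.
  have [||phi [hphi phiE]] := steps (t / n.+1%:R) n.
  - by rewrite divr_ge0 // ltW.
  - rewrite ler_pdivrMr // mulrC -ler_pdivrMr //.
    by apply: ltW; apply: (lt_le_trans nb); rewrite ler_nat.
  exists phi => _; split=> // f Xf.
  by rewrite -(phiE f Xf) -[_ *+ _]mulr_natr divfK ?gt_eqF.
have [phi phiP] := choice all.
exists phi; split; last by move=> t f t0 Xf; have [_ h] := phiP t t0; exact: h.
split.
- by move=> t t0; have [h _] := phiP t t0.
- apply: (composition_inj nu_doubling) => f Xf; have [_ h] := phiP 0 (lexx 0).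
  by rewrite -(h f Xf) (zen_sg0 T_C0 Xf).
move=> t u t0 u0; apply: (composition_inj nu_doubling) => f Xf.
have [_ ht] := phiP t t0; have [_ hu] := phiP u u0.
have [_ htu] := phiP (t + u) (addr_ge0 t0 u0).
have Xt := zen_sg_in T_C0 t0 Xf; have Xu := zen_sg_in T_C0 u0 Xf.
rewrite -(htu f Xf) [t + u]addrC (zen_sg_add T_C0 u0 t0 Xf).
by rewrite (hu _ Xt) (ht f Xf).
Qed.
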